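(* Let $p=p(n)$ and $G\in\mathcal G(n,p)$. If $p\le \frac13 n^{-3/4}\log^{1/4} n$ and $p=\omega(n^{-5/4})$, then with high probability $G$ is not reconstructible from its $2$-neighbourhoods.
   Context: $\mathcal G(n,p)$ is the Erdős–Rényi random graph on vertex set $[n]$ in which each pair is an edge independently with probability $p$. ''With high probability'' means with probability tending to $1$ as $n\to\infty$. For a graph $G$, a vertex $v$ and an integer $r\ge1$, the $r$-neighbourhood $N_r^{(G)}(v)$ is the subgraph of $G$ induced by the vertices at distance at most $r$ from $v$, considered as a graph rooted at $v$. Graphs $G$ and $H$ have isomorphic $r$-neighbourhoods if there is a bijection $\phi:V(G)\to V(H)$ such that for every $v\in V(G)$ there is a graph isomorphism $N_r^{(G)}(v)\to N_r^{(H)}(\phi(v))$ mapping $v$ to $\phi(v)$. $G$ is reconstructible from its $r$-neighbourhoods if every graph $H$ with $r$-neighbourhoods isomorphic to those of $G$ is isomorphic to $G$. *)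

(* Defs.v *)
From HB Require Import structures.
From mathcomp Require Import all_boot all_order all_algebra.
From mathcomp Require Import boolp classical_sets reals topology normedtype sequences exp.
Set Implicit Arguments. Unset Strict Implicit. Unset Printing Implicit Defensive.
Import Order.TTheory GRing.Theory Num.Theory.

(* Graphs on vertex set [n] = 'I_n are given by edge sets
   E : {set {set 'I_n}}; only 2-element members matter. *)
Definition graph (n : nat) := {set {set 'I_n}}.

Definition adj n (E : graph n) (x y : 'I_n) : bool :=
  (x != y) && ([set x; y] \in E).

Definition pairs (n : nat) : {set {set 'I_n}} := [set e : {set 'I_n} | #|e| == 2].

Fixpoint ball n (E : graph n) (r : nat) (v : 'I_n) : {set 'I_n} :=
  match r with
  | 0 => [set v]
  | r'.+1 => ball E r' v :|: [set y | [exists x in ball E r' v, adj E x y]]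
  end.

Definition rooted_nbhd_iso n (r : nat) (G H : graph n) (v w : 'I_n) : Prop :=
  exists f : 'I_n -> 'I_n,
    [/\ {in ball G r v &, injective f},
        f @: ball G r v = ball H r w,
        f v = w &
        {in ball G r v &, forall x y, adj G x y = adj H (f x) (f y)}].

Definition iso_nbhds n (r : nat) (G H : graph n) : Prop :=
  exists phi : 'I_n -> 'I_n, bijective phi /\
    forall v, rooted_nbhd_iso r G H v (phi v).

Definition graph_iso n (G H : graph n) : Prop :=
  exists f : 'I_n -> 'I_n, bijective f /\
    forall x y, adj G x y = adj H (f x) (f y).

Definition reconstructible n (r : nat) (G : graph n) : Prop :=
  forall H : graph n, iso_nbhds r G H -> graph_iso G H.

Definition Gnp_prob {R : realType} (n : nat) (p : R) (A : graph n -> Prop) : R :=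
  \sum_(E : graph n | (E \subset pairs n) && `[< A E >])
     (p ^+ #|E| * (1 - p) ^+ (#|pairs n| - #|E|))%R.

(* Main.v *)
Require Import Defs.
From HB Require Import structures.
From mathcomp Require Import all_boot all_order all_algebra.
From mathcomp Require Import boolp reals sequences exp.
From mathcomp Require Import ring lra zify.
Set Implicit Arguments. Unset Strict Implicit. Unset Printing Implicit Defensive.
Import Order.TTheory GRing.Theory Num.Theory.
Local Open Scope ring_scope.

(** Take disjoint edges ab and cd with deg a = deg c and deg b = deg d and replace them by
    ad and cb.  If none of ab, cd, ad, cb lies on a cycle of length at most 5 before or after
    the switch (and nearby vertices span no further edges), then every vertex keeps its
    2-neighbourhood up to isomorphism.  Writing s(v) for the sum of the degrees of the
    neighbours of v, the invariant sum of s(x) s(y) over the edges xy changes by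
    (s(a) - s(c)) (s(d) - s(b)), so the graph is not reconstructible as soon as
    s(a) <> s(c) and s(b) <> s(d).

    If np <= (ln n)/20, the second moment method gives two components that are paths on five
    vertices, and switching turns them into paths on four and on six vertices.

    If np >= (ln n)/20, reveal first the edges inside a small vertex set, then the edges
    leaving the endpoints of its isolated edges.  By pigeonhole this yields about n^(1/10)
    pairs of edges with matching degrees and disjoint neighbourhoods.  The remaining
    conditions on these pairs (no common neighbour, and odd s(a) - s(c) and s(b) - s(d))
    depend on disjoint sets of unrevealed pairs, hence are independent, and each holds with
    probability at least about exp(- 4 n^3 p^4) >= n^(-4/81), which is where the constant
    1/3 enters. *)

(** The trials must be independent and must inspect pairs that are still random; this forces the
    staged exposure. The initial set has about n^(56/100) vertices: large enough to contain many
    edges, small enough that almost all of them are isolated. The second exposure fixes degrees and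
    guarantees that outer neighbours are private. Degrees lie in a window of width of order (np ln
    n)^(1/2), so the pigeonhole runs over the square of that width. Odd differences replace non-zero
    ones because a parity indicator is an affine function of a sign, and signs multiply over
    independent vertices. A vertex spoils a trial when it is adjacent both to the union of A and C
    and to that of B and D. Each union has about 2np elements, so about 4 n^3 p^4 spoiling vertices
    are expected, and the upper bound on p gives n^3 p^4 <= (ln n)/81. Since 4/81 < 1/10, there is
    room for lossy constants. This needs endpoints with outer neighbours, which are typical only
    when np is large. For smaller np the expected number of path components has order n^5 p^4
    exp(-5np), and p = omega(n^(-5/4)) makes it diverge. *)

Section RandomSubset.
Variables (R : realFieldType) (I : finType).
Implicit Types (p : R) (S T E : {set I}) (f g : {set I} -> R).

(** The ground set [T] is a parameter, so that the same expectation serves for [pairs n] and for the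
    pairs that remain after an exposure. *)
Definition expect p T f : R :=
  \sum_(E : {set I} | E \subset T) p ^+ #|E| * (1 - p) ^+ (#|T| - #|E|) * f E.

Definition prob p T (A : pred {set I}) : R := expect p T (fun E => (A E)%:R).

Lemma eq_expect p T f g :
  (forall E, E \subset T -> f E = g E) -> expect p T f = expect p T g.
Proof. by move=> fg; apply: eq_bigr => E ET; rewrite fg. Qed.

Lemma expectD p T f g :
  expect p T (fun E => f E + g E) = expect p T f + expect p T g.
Proof. by rewrite -big_split; apply: eq_bigr => E _; rewrite mulrDr. Qed.

Lemma expectZ p T c f : expect p T (fun E => c * f E) = c * expect p T f.
Proof. by rewrite mulr_sumr; apply: eq_bigr => E _; rewrite mulrCA. Qed.

Lemma expectZr p T c f : expect p T (fun E => f E * c) = expect p T f * c.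
Proof. by rewrite mulr_suml; apply: eq_bigr => E _; rewrite mulrA. Qed.

Lemma expect_sum (J : finType) (P : pred J) p T (F : J -> {set I} -> R) :
  expect p T (fun E => \sum_(j | P j) F j E) = \sum_(j | P j) expect p T (F j).
Proof. by rewrite exchange_big; apply: eq_bigr => E _; rewrite mulr_sumr. Qed.

Lemma expect_ge0 p T f : 0 <= p <= 1 ->
  (forall E, E \subset T -> 0 <= f E) -> 0 <= expect p T f.
Proof.
move=> /andP[p0 p1] f0; apply: sumr_ge0 => E ET.
by rewrite !mulr_ge0 ?exprn_ge0 ?f0 // subr_ge0.
Qed.

Lemma le_expect p T f g : 0 <= p <= 1 ->
  (forall E, E \subset T -> f E <= g E) -> expect p T f <= expect p T g.
Proof.
move=> /andP[p0 p1] fg; apply: ler_sum => E ET.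
by rewrite ler_wpM2l ?fg // mulr_ge0 ?exprn_ge0 // subr_ge0.
Qed.

(** A subset of [T] splits uniquely into its parts inside and outside [S], and the weights multiply.
    Every conditioning on revealed edges goes through this iterated expectation. *)
Lemma expect_split p S T f : S \subset T ->
  expect p T f =
  expect p S (fun E1 => expect p (T :\: S) (fun E2 => f (E1 :|: E2))).
Proof.
move=> ST; rewrite /expect.
rewrite (partition_big (fun E => E :&: S) (fun E1 => E1 \subset S)) /=; last first.
  by move=> E _; apply: subsetIr.
apply: eq_bigr => E1 E1S; rewrite mulr_sumr.
rewrite (reindex_onto (fun E2 => E1 :|: E2) (fun E => E :\: S)) /=; last first.
  by move=> E /andP[ET /eqP <-]; apply: setID.
apply: eq_big => [E2|E2].
  apply/idP/idP => [/andP[/andP[sub _] /eqP eE2]|sub].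
    by rewrite -eE2; apply: setSD.
  have dis : E2 :&: S = set0.
    by apply/setP => x; rewrite !inE; apply/andP => -[/(subsetP sub)]; rewrite inE => /andP[/negbTE->].
  rewrite subUset (subset_trans E1S ST) (subset_trans sub (subsetDl _ _)) /=.
  rewrite setIUl dis setU0 setDUl; apply/andP; split; first by apply/eqP/setIidPl.
  apply/eqP/setP => x; rewrite !inE; have := subsetP E1S x; have := subsetP sub x.
  by rewrite inE; case: (x \in S); case: (x \in E1); case: (x \in E2) => //= H1 H2; 
    try (by have := H1 isT); try (by have := H2 isT).
move=> /andP[/andP[sub /eqP eE1] /eqP eE2].
have E2s : E2 \subset T :\: S by rewrite -eE2; apply: setSD.
have cU : #|E1 :|: E2| = (#|E1| + #|E2|)%N.
  have : [disjoint E1 & E2].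
    by rewrite -setI_eq0 -eE1 -eE2; apply/eqP/setP => x; rewrite !inE; case: (x \in S); rewrite ?andbF.
  by rewrite -leq_card_setU => /eqP.
have := subset_leq_card E1S; have := subset_leq_card E2s.
rewrite cU (cardsDS ST) => c2 c1; have c3 := subset_leq_card ST.
have -> : (#|T| - (#|E1| + #|E2|) = (#|S| - #|E1|) + ((#|T| - #|S|) - #|E2|))%N by lia.
by rewrite !exprD; ring.
Qed.

Lemma expect_set0 p f : expect p set0 f = f set0.
Proof.
rewrite /expect (bigD1 set0) ?sub0set //= big1 ?addr0 => [|E].
  by rewrite cards0 !expr0 !mul1r.
by rewrite subset0 => /andP[/eqP-> /eqP].
Qed.

Lemma expect_set1 p x f : expect p [set x] f = (1 - p) * f set0 + p * f [set x].
Proof.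
rewrite /expect (bigD1 set0) ?sub0set //= (bigD1 [set x]) /=; last first.
  by rewrite subxx -cards_eq0 cards1.
rewrite big1 ?addr0 => [|E /andP[/andP[]]].
  by rewrite cards0 cards1 expr0 subn0 subnn !expr1 expr0 mul1r mulr1.
by rewrite subset1 => /orP[]/eqP-> /eqP // _ /eqP.
Qed.

Lemma expect_const p T c : expect p T (fun=> c) = c.
Proof.
elim: {T}_.+1 {-2}T (ltnSn #|T|) => // k IH T cT.
have [->|[x xT]] := set_0Vmem T; first by rewrite expect_set0.
rewrite (@expect_split _ [set x]) ?sub1set // expect_set1 IH.
  by rewrite -mulrDl subrK mul1r.
by rewrite -ltnS (leq_trans _ cT) // ltnS [in X in (_ <= X)%N](cardsD1 x) xT.
Qed.

Lemma expect_local p S T f g : S \subset T ->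
  (forall E, E \subset T -> f E = g (E :&: S)) -> expect p T f = expect p S g.
Proof.
move=> ST fg; rewrite (expect_split p _ ST); apply: eq_expect => E1 E1S.
rewrite -[RHS](expect_const p (T :\: S)); apply: eq_expect => E2 E2S.
rewrite fg; last by rewrite subUset (subset_trans E1S ST) (subset_trans E2S (subsetDl _ _)).
rewrite setIUl (setIidPl E1S); suff -> : E2 :&: S = set0 by rewrite setU0.
by apply/setP => x; rewrite !inE; apply/andP => -[/(subsetP E2S)]; rewrite inE => /andP[/negbTE->].
Qed.

(** Independence over disjoint regions. A duplicate-free list of indices lets the induction split
    off one region [S j] from the ground set at a time. *)
Lemma expect_prod (J : eqType) p T (r : seq J) (S : J -> {set I})
    (f : J -> {set I} -> R) :
  uniq r -> (forall j, j \in r -> S j \subset T) ->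
  {in r &, forall j k, j != k -> [disjoint S j & S k]} ->
  expect p T (fun E => \prod_(j <- r) f j (E :&: S j)) =
  \prod_(j <- r) expect p (S j) (f j).
Proof.
elim: r T => [|j r IH] T /=.
  by move=> _ _ _; rewrite big_nil -[RHS](expect_const p T); apply: eq_expect => E _; rewrite big_nil.
move=> /andP[jr ur] sT dis; have jT := sT j (mem_head _ _).
rewrite big_cons (expect_split p _ jT) -expectZr; apply: eq_expect => E1 E1j.
rewrite -(IH (T :\: S j)) //; last 2 first.
- move=> k kr; rewrite subsetD sT ?in_cons ?kr ?orbT //=.
  by apply: dis; rewrite ?in_cons ?eqxx ?kr ?orbT //; apply: contraNneq jr => <-.
- by move=> k l kr lr; apply: dis; rewrite in_cons ?kr ?lr orbT.
rewrite -expectZ; apply: eq_expect => E2 E2j; rewrite big_cons.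
have e2 : E2 :&: S j = set0.
  by apply/setP => x; rewrite !inE; apply/andP => -[/(subsetP E2j)]; rewrite inE => /andP[/negbTE->].
rewrite setIUl e2 setU0 (setIidPl E1j); congr (_ * _).
apply: eq_big_seq => k kr; rewrite setIUl.
suff -> : E1 :&: S k = set0 by rewrite set0U.
apply/eqP; rewrite setI_eq0; apply: disjointWl E1j _.
by apply: dis; rewrite ?in_cons ?eqxx ?kr ?orbT //; apply: contraNneq jr => ->.
Qed.

Lemma prob_pattern p T S S' : S \subset T -> S' \subset T -> [disjoint S & S'] ->
  prob p T (fun E => (S \subset E) && [disjoint S' & E]) =
  p ^+ #|S| * (1 - p) ^+ #|S'|.
Proof.
move=> ST S'T dis.
have all_in S0 : expect p S0 (fun E => (E == S0)%:R) = p ^+ #|S0|.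
  rewrite /expect (bigD1 S0) //= eqxx big1 ?addr0 => [|E /andP[_ /negbTE->]].
    by rewrite subnn expr0 !mulr1.
  by rewrite mulr0.
have all_out S0 : expect p S0 (fun E => (E == set0)%:R) = (1 - p) ^+ #|S0|.
  rewrite /expect (bigD1 set0) ?sub0set //= eqxx big1 ?addr0 => [|E /andP[_ /negbTE->]].
    by rewrite cards0 subn0 expr0 mulr1 mul1r.
  by rewrite mulr0.
rewrite /prob -all_in -all_out -expectZr (expect_split p _ ST); apply: eq_expect => E1 E1S.
have S'TS : S' \subset T :\: S by rewrite subsetD S'T disjoint_sym.
rewrite -[in RHS](expect_local (T := T :\: S) (f := fun E => [disjoint S' & E]%:R) _ S'TS).
  rewrite -expectZ; apply: eq_expect => E2 E2S; rewrite -natrM mulnb; congr ((_ && _)%:R).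
    rewrite eqEsubset E1S /=; apply/idP/idP => [sub|]; last by move=> sub; apply: subset_trans sub (subsetUl _ _).
    apply/subsetP => x xS; have := subsetP sub _ xS; rewrite inE => /orP[//|/(subsetP E2S)].
    by rewrite inE xS.
  rewrite -!setI_eq0 setIUr; suff -> : S' :&: E1 = set0 by rewrite set0U.
  by apply/eqP; rewrite setI_eq0 disjoint_sym; apply: disjointWl E1S dis.
by move=> E _; rewrite -setI_eq0 setIC.
Qed.

Lemma prob_sub p T S : S \subset T -> prob p T (fun E => S \subset E) = p ^+ #|S|.
Proof.
move=> ST; have := prob_pattern p ST (sub0set T); rewrite -setI_eq0 setI0 => /(_ (eqxx _)).
rewrite cards0 expr0 mulr1 => <-; apply: eq_expect => E _.
by rewrite -[[disjoint set0 & E]]setI_eq0 set0I eqxx andbT.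
Qed.

Lemma prob_ge0 p T A : 0 <= p <= 1 -> 0 <= prob p T A.
Proof. by move=> p01; apply: expect_ge0 => // E _; apply: ler0n. Qed.

Lemma le_prob p T (A B : pred {set I}) : 0 <= p <= 1 ->
  (forall E, E \subset T -> A E -> B E) -> prob p T A <= prob p T B.
Proof.
move=> p01 AB; apply: le_expect => // E ET.
by case: (boolP (A E)) => [/(AB _ ET)->|_]; rewrite ?ler0n.
Qed.


Lemma probU p T (A B : pred {set I}) : 0 <= p <= 1 ->
  prob p T (fun E => A E || B E) <= prob p T A + prob p T B.
Proof.
move=> p01; rewrite -expectD; apply: le_expect => // E _.
by case: (A E); case: (B E); rewrite /= ?addr0 ?add0r ?lerDl ?ler01.
Qed.

Lemma prob_exists (J : finType) (P : pred J) p T (A : J -> pred {set I}) :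
  0 <= p <= 1 ->
  prob p T (fun E => [exists (j | P j), A j E]) <= \sum_(j | P j) prob p T (A j).
Proof.
move=> p01; rewrite -expect_sum; apply: le_expect => // E _.
case: existsP => [[j /andP[Pj Aj]]|_].
  by rewrite (bigD1 j) //= Aj lerDl sumr_ge0 // => i _; apply: ler0n.
by apply: sumr_ge0 => i _; apply: ler0n.
Qed.

Lemma prob_markov p T (A : pred {set I}) (X : {set I} -> R) (c : R) :
  0 <= p <= 1 -> 0 < c ->
  (forall E, E \subset T -> 0 <= X E) ->
  (forall E, E \subset T -> A E -> c <= X E) -> prob p T A <= expect p T X / c.
Proof.
move=> p01 c0 X0 AX; rewrite ler_pdivlMr // -expectZr; apply: le_expect => // E ET.
by case: (boolP (A E)) => [/(AX _ ET)|_]; rewrite ?mul1r ?mul0r // X0.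
Qed.

Lemma prob_predC p T (A : pred {set I}) :
  prob p T (fun E => ~~ A E) = 1 - prob p T A.
Proof.
rewrite -(expect_const p T 1) -[X in _ - X]mul1r -mulNr -expectZ -expectD.
by apply: eq_expect => E _; case: (A E); rewrite /= mulN1r ?subrr ?subr0.
Qed.

Lemma prob_le1 p T (A : pred {set I}) : 0 <= p <= 1 -> prob p T A <= 1.
Proof.
by move=> p01; rewrite -subr_ge0 -prob_predC prob_ge0.
Qed.

(** Two-stage exposure: [B] says that the first stage went well. Where it fails, the conditional
    probability of [A] is bounded by 1, and by 1 + [e2] as [e2] is nonnegative. *)
Lemma prob_stage p S T (A B : pred {set I}) (e1 e2 : R) : 0 <= p <= 1 -> S \subset T ->
  prob p S (fun E => ~~ B E) <= e1 ->
  (forall E1, E1 \subset S -> B E1 -> prob p (T :\: S) (fun E2 => A (E1 :|: E2)) <= e2) ->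
  0 <= e2 -> prob p T A <= e1 + e2.
Proof.
move=> p01 ST Be1 Ae2 e20; rewrite /prob (expect_split p _ ST).
apply: le_trans (_ : expect p S (fun E => (~~ B E)%:R + e2) <= _).
  apply: le_expect => // E1 E1S; case: (boolP (B E1)) => BE /=.
    by rewrite add0r Ae2.
  by apply: le_trans (prob_le1 _ _ p01) _; rewrite lerDl.
by rewrite expectD expect_const lerD2r.
Qed.

Lemma expect_mem p T e : e \in T -> expect p T (fun E => (e \in E)%:R) = p.
Proof.
move=> eT; rewrite -[RHS]expr1 -(cards1 e) -(@prob_sub _ T) ?sub1set //.
by apply: eq_expect => E _; rewrite sub1set.
Qed.

Lemma expect_mem2 p T e e' : e \in T -> e' \in T ->
  expect p T (fun E => (e \in E)%:R * (e' \in E)%:R) = if e == e' then p else p ^+ 2.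
Proof.
move=> eT e'T; have := @prob_sub p T [set e; e']; rewrite subUset !sub1set eT e'T => /(_ isT).
rewrite cards2 => h; rewrite -[LHS](_ : prob p T (fun E => [set e; e'] \subset E) = _).
  by rewrite h; case: eqP; rewrite ?expr1.
by apply: eq_expect => E _; rewrite -natrM mulnb subUset !sub1set.
Qed.

Lemma card_mem_sum T E : #|T :&: E|%:R = \sum_(e in T) (e \in E)%:R :> R.
Proof.
rewrite -sum1_card natr_sum big_mkcond [RHS]big_mkcond; apply: eq_bigr => e _.
by rewrite inE; case: (e \in T); case: (e \in E).
Qed.

Lemma expect_card p T S : S \subset T ->
  expect p T (fun E => #|S :&: E|%:R) = #|S|%:R * p.
Proof.
move=> ST; under eq_expect do rewrite card_mem_sum.
rewrite expect_sum (eq_bigr (fun=> p)) => [|e eS].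
  by rewrite sumr_const mulr_natl.
by rewrite expect_mem // (subsetP ST).
Qed.

Lemma expect_card_var p T S : S \subset T ->
  expect p T (fun E => (#|S :&: E|%:R - #|S|%:R * p) ^+ 2) = #|S|%:R * p * (1 - p).
Proof.
move=> ST; pose m : R := #|S|%:R * p.
have sq : expect p T (fun E => #|S :&: E|%:R * #|S :&: E|%:R) =
    #|S|%:R * (p - p ^+ 2) + #|S|%:R ^+ 2 * p ^+ 2.
  under eq_expect => E _.
    rewrite card_mem_sum mulr_suml; under eq_bigr do rewrite mulr_sumr; over.
  rewrite expect_sum; under eq_bigr do rewrite expect_sum.
  (* For fixed [e], the diagonal term is [p] and each other term is [p ^+ 2]; the sum is written as
     if all were [p ^+ 2], plus a correction. *)
  rewrite (eq_bigr (fun=> (p - p ^+ 2) + #|S|%:R * p ^+ 2)).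
    by rewrite sumr_const -mulr_natl; ring.
  move=> e eS; under eq_bigr => e' e'S do rewrite expect_mem2 ?(subsetP ST) //.
  rewrite (bigD1 e) //= eqxx (eq_bigr (fun=> p ^+ 2)) => [|e' /andP[_]]; last first.
    by rewrite eq_sym => /negbTE->.
  rewrite sumr_const [in RHS](cardD1 e) eS natrD /=.
  rewrite (_ : #|[pred x in S | x != e]| = #|[predD1 S & e]|); last first.
    by apply: eq_card => x; rewrite !inE andbC.
  by rewrite -mulr_natl; ring.
under eq_expect => E _.
  rewrite (_ : _ ^+ 2 = #|S :&: E|%:R * #|S :&: E|%:R + (- 2 * m * #|S :&: E|%:R + m ^+ 2));
    last by rewrite -/m; ring.
  over.
by rewrite !expectD expectZ expect_card // expect_const sq /m; ring.
Qed.

(** Chebyshev for a binomial variable, with the factor 1 - p of the variance bounded by 1. *)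
Lemma prob_card_dev p T S (w : R) : 0 <= p <= 1 -> S \subset T -> 0 < w ->
  prob p T (fun E => w <= `|#|S :&: E|%:R - #|S|%:R * p|) <= #|S|%:R * p / w ^+ 2.
Proof.
move=> p01 ST w0; apply: le_trans (_ : #|S|%:R * p * (1 - p) / w ^+ 2 <= _); last first.
  have /andP[p0 _] := p01.
  by rewrite ler_wpM2r ?invr_ge0 ?sqr_ge0 // ler_piMr ?mulr_ge0 ?ler0n // gerBl.
rewrite -(expect_card_var p ST); apply: prob_markov => //; first by rewrite exprn_gt0.
  by move=> E _; apply: sqr_ge0.
move=> E _ /= h; rewrite -[leRHS]real_normK ?num_real //.
by rewrite lerXn2r ?nnegrE // ltW.
Qed.

End RandomSubset.

Lemma eq_set2 (T : finType) (x y a b : T) :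
  ([set x; y] == [set a; b]) = ((x == a) && (y == b)) || ((x == b) && (y == a)).
Proof.
apply/eqP/idP => [e|/orP[]/andP[/eqP-> /eqP->]//]; last exact: setUC.
have hx : (x == a) || (x == b) by rewrite -in_set2 -e set21.
have hy : (y == a) || (y == b) by rewrite -in_set2 -e set22.
have ha : (a == x) || (a == y) by rewrite -in_set2 e set21.
have hb : (b == x) || (b == y) by rewrite -in_set2 e set22.
case/orP: hx => /eqP xE; subst x; rewrite eqxx /=.
  by case/orP: hb => /eqP hb; subst; rewrite ?eqxx // orbb // in hy *; rewrite hy ?orbT.
by case/orP: ha => /eqP ha; subst; rewrite ?eqxx ?orbT // orbb // in hy *; rewrite hy ?orbT.
Qed.

(** * The switch of two edges and its effect on 2-neighbourhoods *)

Section Switch.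
Variable n : nat.
Implicit Types (G H : graph n) (x y z : 'I_n).

Definition nb G x : {set 'I_n} := [set y | adj G x y].

Lemma adjC G x y : adj G x y = adj G y x.
Proof. by rewrite /adj eq_sym setUC. Qed.

Lemma adjxx G x : adj G x x = false.
Proof. by rewrite /adj eqxx. Qed.

Lemma ballS G r v :
  ball G r.+1 v = ball G r v :|: [set y | [exists x in ball G r v, adj G x y]].
Proof. by []. Qed.

Lemma in_ball1 G v y : (y \in ball G 1 v) = (y == v) || adj G v y.
Proof.
rewrite /= !inE; congr (_ || _); apply/existsP/idP => [[x]|vy].
  by rewrite inE => /andP[/eqP->].
by exists v; rewrite inE eqxx.
Qed.

Lemma in_ball2 G v y :
  (y \in ball G 2 v) = [|| y == v, adj G v y | [exists u, adj G v u && adj G u y]].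
Proof.
rewrite (_ : (y \in ball G 2 v) =
  (y \in ball G 1 v) || [exists x in ball G 1 v, adj G x y]); last by rewrite ballS inE [in X in _ || X]inE.
rewrite in_ball1 -orbA; case: eqVneq => //= yv; case: (boolP (adj G v y)) => //= nvy.
apply/existsP/existsP => -[u /andP[]].
  by rewrite in_ball1 => /orP[/eqP->|vu uy]; [rewrite (negbTE nvy)|exists u; rewrite vu].
by move=> vu uy; exists u; rewrite in_ball1 vu orbT.
Qed.

(** A ball of radius r+1 is determined by the edges that start at distance at most r, so agreement
    is required only for pairs with one end in the smaller ball. *)
Lemma ball_imset G H (f : 'I_n -> 'I_n) r v : bijective f ->
  {in ball G r v, forall y z, adj G y z = adj H (f y) (f z)} ->
  f @: ball G r.+1 v = ball H r.+1 (f v).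
Proof.
move=> [g fK gK]; elim: r => [|r IH] agree.
  apply/setP => y; rewrite in_ball1; apply/imsetP/idP => [[x]|].
    by rewrite in_ball1 => /orP[/eqP-> ->|vx ->]; rewrite ?eqxx // -agree ?vx ?orbT // inE.
  rewrite -[y]gK -agree ?inE // (inj_eq (can_inj fK)) => h.
  by exists (g y) => //; rewrite in_ball1.
have sub : ball G r v \subset ball G r.+1 v by apply: subsetUl.
have {}IH := IH (fun y yr => agree y (subsetP sub y yr)).
rewrite [in LHS]ballS [in RHS]ballS imsetU IH; congr (_ :|: _).
apply/setP => y; rewrite inE; apply/imsetP/existsP => [[x]|[x /andP[]]].
  rewrite inE => /existsP[u /andP[ur ux]] ->; exists (f u).
  by rewrite -IH imset_f //= -agree.
rewrite -IH => /imsetP[u ur ->]; rewrite -[y]gK -agree // => ug.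
by exists (g y) => //; rewrite inE; apply/existsP; exists u; rewrite ur.
Qed.

(** The agreement on edges leaving the 1-ball identifies the two 2-balls; the agreement inside the
    2-ball then makes the map an isomorphism. Neither condition asks [f] to be an isomorphism
    further away. *)
Lemma rooted_nbhd_iso_fixed G H (f : 'I_n -> 'I_n) v : involutive f -> f v = v ->
  {in ball G 1 v, forall y z, adj G y z = adj H (f y) (f z)} ->
  {in ball G 2 v &, forall y z, adj G y z = adj H (f y) (f z)} ->
  rooted_nbhd_iso 2 G H v v.
Proof.
move=> fK fv near far; exists f; split=> //.
  by move=> y z _ _; apply: (can_inj fK).
by rewrite (ball_imset (H := H)) ?fv //; apply: inv_bij.
Qed.

(* Two edges ab and cd with matching degrees whose outer neighbourhoods A, B, C, D
   are so far apart that ab, cd, ad and cb lie on no cycle of length at most 5. *)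
Record switchable G a b c d (A B C D : {set 'I_n}) : Prop := Switchable {
  sw_a : nb G a = b |: A; sw_b : nb G b = a |: B;
  sw_c : nb G c = d |: C; sw_d : nb G d = c |: D;
  sw_uniq : uniq [:: a; b; c; d];
  sw_notin : [/\ a \notin A :|: B :|: C :|: D, b \notin A :|: B :|: C :|: D,
                 c \notin A :|: B :|: C :|: D & d \notin A :|: B :|: C :|: D];
  sw_AC : [disjoint A & C]; sw_BD : [disjoint B & D];
  sw_cardAC : #|A| = #|C|; sw_cardBD : #|B| = #|D|;
  sw_indep : {in A :|: B :|: C :|: D &, forall x y, ~~ adj G x y};
  sw_sep : {in A :|: C & B :|: D, forall x z y, ~~ (adj G x y && adj G y z)} }.

Definition switch G a b c d : graph n :=
  [set [set a; d]; [set c; b]] :|: (G :\: [set [set a; b]; [set c; d]]).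

(** The two symmetries, exchanging the ends of both edges and exchanging the two edges, act on
    [switch] and on [switchable]. They carry [a] to each of the other three endpoints, so only the
    surroundings of [a] need an argument. *)
Lemma switchC1 G a b c d : switch G a b c d = switch G b a d c.
Proof.
rewrite /switch (setUC [set a] [set b]) (setUC [set c] [set d]); congr (_ :|: _).
by rewrite setUC (setUC [set a]) (setUC [set c]).
Qed.

Lemma switchC2 G a b c d : switch G a b c d = switch G c d a b.
Proof. by rewrite /switch [in LHS]setUC [in RHS]setUC; congr (_ :\: _ :|: _); rewrite setUC. Qed.

Lemma switchableC1 G a b c d A B C D :
  switchable G a b c d A B C D -> switchable G b a d c B A D C.
Proof.
move=> [ha hb hc hd hu [na nb nc nd] hAC hBD cAC cBD hin hsep].
have e : B :|: A :|: D :|: C = A :|: B :|: C :|: D.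
  by rewrite (setUC B) -!setUA (setUC D).
split; rewrite ?e //.
  by move: hu; rewrite /= !inE !negb_or (eq_sym b a) (eq_sym d c) => /and4P[/and3P[-> -> ->] /andP[-> ->] -> _].
move=> x z xs zs y; rewrite andbC ![adj _ _ z]adjC [adj _ x _]adjC; exact: hsep.
Qed.

Lemma switchableC2 G a b c d A B C D :
  switchable G a b c d A B C D -> switchable G c d a b C D A B.
Proof.
move=> [ha hb hc hd hu [na nb nc nd] hAC hBD cAC cBD hin hsep].
have e : C :|: D :|: A :|: B = A :|: B :|: C :|: D.
  by rewrite -setUA setUC setUA.
split; rewrite ?e // 1?disjoint_sym //.
  move: hu; rewrite /= !inE !negb_or (eq_sym d) (eq_sym d) (eq_sym c b) (eq_sym c a).
  by move=> /and4P[/and3P[-> -> ->] /andP[-> ->] -> _].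
by move=> x z xs zs y; apply: hsep; rewrite setUC.
Qed.

Lemma adj_switch G a b c d x y : uniq [:: a; b; c; d] ->
  adj (switch G a b c d) x y =
  [|| (x == a) && (y == d), (x == d) && (y == a), (x == c) && (y == b), (x == b) && (y == c) |
   adj G x y && ~~ [|| (x == a) && (y == b), (x == b) && (y == a),
                       (x == c) && (y == d) | (x == d) && (y == c)]].
Proof.
move=> /= hu; rewrite /adj /switch !inE !eq_set2 -!orbA.
case: (eqVneq x y) => [->|xy] /=; last first.
  by case: ([set x; y] \in G); rewrite ?andbT ?andbF.
move: hu; rewrite !inE !negb_or => /and4P[/and3P[ab ac ad] /andP[bc bd] cd _].
have no u v : u != v -> (y == u) && (y == v) = false.
  by move=> uv; apply/andP => -[/eqP-> /eqP e]; rewrite e eqxx in uv.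
by rewrite !no // eq_sym.
Qed.

End Switch.

(** Only the degrees of [b] and [d] match, not what lies beyond [B] and [D]; an arbitrary matching
    of the two sets suffices because a 2-neighbourhood near [a] does not see further. *)
Lemma exchange_involution (T : finType) (b d : T) (B D : {set T}) :
  b \notin B :|: D -> d \notin B :|: D -> [disjoint B & D] -> #|B| = #|D| ->
  exists f : T -> T, [/\ involutive f, f b = d, f d = b,
    (forall y, (f y \in B) = (y \in D)) &
    (forall y, y != b -> y != d -> y \notin B :|: D -> f y = y)].
Proof.
rewrite !inE !negb_or => /andP[bB bD] /andP[dB dD] dis cBD.
have nD y : y \in B -> y \in D = false by move=> yB; apply: disjointFr dis yB.
have nB y : y \in D -> y \in B = false by move=> yD; apply: disjointFl dis yD.
(* The k-th element of [B] in its enumeration is exchanged with the k-th element of [D]; equal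
   cardinalities keep the index in range. *)
pose f y := if y == b then d else if y == d then b else
  if y \in B then nth y (enum D) (index y (enum B)) else
  if y \in D then nth y (enum B) (index y (enum D)) else y.
have fB y : y \in B -> f y = nth y (enum D) (index y (enum B)).
  move=> yB; rewrite /f yB; case: eqP => [e|_]; first by rewrite -e yB in bB.
  by case: eqP => // e; rewrite -e yB in dB.
have fD y : y \in D -> f y = nth y (enum B) (index y (enum D)).
  move=> yD; rewrite /f yD nB //; case: eqP => [e|_]; first by rewrite -e yD in bD.
  by case: eqP => // e; rewrite -e yD in dD.
have fBD y : y \in B -> f y \in D.
  by move=> yB; rewrite fB // -mem_enum mem_nth // -cardE -cBD cardE index_mem mem_enum.
have fDB y : y \in D -> f y \in B.
  by move=> yD; rewrite fD // -mem_enum mem_nth // -cardE cBD cardE index_mem mem_enum.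
have fb : f b = d by rewrite /f eqxx.
have fd : f d = b by rewrite /f eqxx; case: eqP.
have fo y : y != b -> y != d -> y \notin B :|: D -> f y = y.
  by rewrite !inE negb_or /f => /negbTE-> /negbTE-> /andP[/negbTE-> /negbTE->].
have fK : involutive f.
  move=> y; case: (boolP (y \in B)) => yB.
    rewrite (fD (f y)) ?fBD // fB // index_uniq ?enum_uniq //.
      by rewrite (set_nth_default y) ?nth_index ?mem_enum // index_mem mem_enum.
    by rewrite -cardE -cBD cardE index_mem mem_enum.
  case: (boolP (y \in D)) => yD.
    rewrite (fB (f y)) ?fDB // fD // index_uniq ?enum_uniq //.
      by rewrite (set_nth_default y) ?nth_index ?mem_enum // index_mem mem_enum.
    by rewrite -cardE cBD cardE index_mem mem_enum.
  case: (eqVneq y b) => [->|yb]; first by rewrite fb fd.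
  case: (eqVneq y d) => [->|yd]; first by rewrite fd fb.
  by rewrite !fo // inE negb_or yB.
exists f; split=> // y; apply/idP/idP; last exact: fDB.
case: (boolP (y \in D)) => // yD; case: (boolP (y \in B)) => yB.
  by move=> h; have := fBD _ yB; rewrite nD.
case: (eqVneq y b) => [->|yb]; first by rewrite fb (negbTE dB).
case: (eqVneq y d) => [->|yd]; first by rewrite fd (negbTE bB).
by rewrite fo ?(negbTE yB) // inE negb_or yB.
Qed.

Section SwitchIso.
Variable n : nat.
Implicit Types (G H : graph n) (x y z : 'I_n).

Lemma in_nb G x y : (y \in nb G x) = adj G x y.
Proof. by rewrite inE. Qed.

Lemma nb_switch G a b c d A B C D : switchable G a b c d A B C D ->
  nb (switch G a b c d) a = d |: A.
Proof.
move=> sw; have /= hu := sw_uniq sw; have [na _ _ _] := sw_notin sw.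
apply/setP => y; rewrite inE adj_switch ?(sw_uniq sw) // eqxx /=.
have -> : adj G a y = (y \in b |: A) by rewrite -(sw_a sw) inE.
move: hu; rewrite !inE !negb_or => /and4P[/and3P[ab ac ad] /andP[bc bd] cd _].
rewrite (negbTE ab) (negbTE ac) (negbTE ad) /= ?orbF ?inE.
case: (eqVneq y d) => //= _; case: (eqVneq y b) => //= [->|_]; rewrite ?andbF ?andbT //.
have [_ nb _ _] := sw_notin sw.
by move: nb; rewrite !inE !negb_or => /andP[/andP[/andP[/negbTE-> _] _] _].
Qed.

Lemma nb_switch_out G a b c d x : uniq [:: a; b; c; d] ->
  x \notin [:: a; b; c; d] -> nb (switch G a b c d) x = nb G x.
Proof.
move=> hu; rewrite !inE !negb_or => /and4P[/negbTE xa /negbTE xb /negbTE xc /negbTE xd].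
by apply/setP => y; rewrite !inE adj_switch // xa xb xc xd /= andbT.
Qed.

(* The involution exchanging b with d and B with D carries G to the switched graph,
   except on pairs joining B or D to their remaining neighbours. *)
Lemma adj_exchange G a b c d A B C D f : switchable G a b c d A B C D ->
  involutive f -> f b = d -> f d = b -> (forall y, (f y \in B) = (y \in D)) ->
  (forall y, y != b -> y != d -> y \notin B :|: D -> f y = y) ->
  let far w z := [&& w \in B :|: D, z != b, z != d & [exists u in B :|: D, adj G u z]] in
  forall y z, ~~ far y z -> ~~ far z y ->
  adj G y z = adj (switch G a b c d) (f y) (f z).
Proof.
move=> sw fK fb fd fB fo far.
have fD y : (f y \in D) = (y \in B) by rewrite -fB fK.
have hu := sw_uniq sw; have [na nb' nc nd] := sw_notin sw.
have /= := hu; rewrite !inE !negb_or => /and4P[/and3P[ab ac ad] /andP[bc bd] cd _].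
have nW v : v \notin A :|: B :|: C :|: D -> v \notin B :|: D.
  by rewrite !inE !negb_or => /andP[/andP[/andP[_ ->] _] ->].
have fa : f a = a by rewrite fo ?nW.
have fc : f c = c by rewrite fo ?nW // eq_sym.
have swb := nb_switch (switchableC1 sw).
have swd := nb_switch (switchableC1 (switchableC2 sw)).
rewrite -switchC1 in swb; rewrite -switchC1 -switchC2 in swd.
have fe y z : (f y == z) = (y == f z) by rewrite -{1}(fK z) (inj_eq (inv_inj fK)).
(* At [b] and [d] agreement is complete: [f] carries the neighbours [a |: B] of [b] to [a |: D],
   which are the neighbours of [d] after the switch, and likewise for [d]. *)
have Eb z : adj G b z = adj (switch G a b c d) (f b) (f z).
  have -> : adj G b z = (z \in nb G b) by rewrite inE.
  have -> : adj (switch G a b c d) (f b) (f z) = (f z \in nb (switch G a b c d) d).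
    by rewrite fb inE.
  by rewrite swd (sw_b sw) !inE fD fe fa.
have Ed z : adj G d z = adj (switch G a b c d) (f d) (f z).
  have -> : adj G d z = (z \in nb G d) by rewrite inE.
  have -> : adj (switch G a b c d) (f d) (f z) = (f z \in nb (switch G a b c d) b).
    by rewrite fd inE.
  by rewrite swb (sw_d sw) !inE fB fe fc.
have fW y : (f y \in B :|: D) = (y \in B :|: D) by rewrite !inE fB fD orbC.
have WU y : y \in B :|: D -> y \in A :|: B :|: C :|: D.
  by rewrite !inE => /orP[]->; rewrite ?orbT.
have Uout y : y \in A :|: B :|: C :|: D -> y \notin [:: a; b; c; d].
  move=> yU; rewrite !inE !negb_or; apply/and4P.
  by split; apply: contraTneq yU => ->.
(* Here [z] has no neighbour at all in [B :|: D], so both sides are false: [f] keeps [y] in that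
   set, and [z] is either fixed by [f] or lies in the independent set itself. *)
have EW y z : z != b -> z != d -> y \in B :|: D -> ~~ far y z ->
    adj G y z = adj (switch G a b c d) (f y) (f z).
  move=> zb zd yW; rewrite /far yW zb zd /= => /existsPn nf.
  have -> : adj G y z = false by have := nf y; rewrite yW => /negbTE.
  have -> : adj (switch G a b c d) (f y) (f z) = adj G (f y) (f z).
    have fyU := Uout _ (WU (f y) _); have := nb_switch_out G hu (fyU _); rewrite fW => /(_ yW).
    by move/setP/(_ (f z)); rewrite !inE.
  apply/esym/negbTE; case: (boolP (z \in B :|: D)) => zW.
    by rewrite (sw_indep sw) // WU // fW.
  by rewrite (fo z) //; have := nf (f y); rewrite fW yW.
move=> y z fyz fzy.
case: (eqVneq y b) => [->//|yb]; case: (eqVneq y d) => [->//|yd].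
case: (eqVneq z b) => [->|zb]; first by rewrite adjC [RHS]adjC.
case: (eqVneq z d) => [->|zd]; first by rewrite adjC [RHS]adjC.
case: (boolP (y \in B :|: D)) => yW; first exact: EW.
case: (boolP (z \in B :|: D)) => zW; first by rewrite adjC [RHS]adjC EW.
rewrite !fo // adj_switch // (negbTE yb) (negbTE yd) (negbTE zb) (negbTE zd).
by rewrite ?andbF /= ?andbF /= andbT.
Qed.


(** Separation with both ends equal to [x]: a common element would return to itself through its
    neighbour [a] or [c]. *)
Lemma switchable_sides G a b c d A B C D x : switchable G a b c d A B C D ->
  x \in A :|: C -> x \notin B :|: D.
Proof.
move=> sw xAC; apply/negP => xBD.
have adjx y : adj G x y -> False.
  by move=> xy; have := sw_sep sw xAC xBD y; rewrite (adjC _ y) xy.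
move: xAC; rewrite !inE => /orP[] h.
  by apply: (adjx a); rewrite adjC -in_nb (sw_a sw) !inE h orbT.
by apply: (adjx c); rewrite adjC -in_nb (sw_c sw) !inE h orbT.
Qed.

(** The exchange of [b] with [d] and of [B] with [D] is the isomorphism. It errs only on pairs
    joining [B] or [D] to a vertex other than [b] and [d], and no such pair is visible within
    distance 2 of [a] or of a vertex of [A]. *)
Lemma switch_nbhd_iso_near G a b c d A B C D v : switchable G a b c d A B C D ->
  v \in a |: A -> rooted_nbhd_iso 2 G (switch G a b c d) v v.
Proof.
move=> sw va; have [na nb' nc nd] := sw_notin sw.
have /= := sw_uniq sw; rewrite !inE !negb_or => /and4P[/and3P[ab ac ad] /andP[bc bd] cd _].
have nW u : u \notin A :|: B :|: C :|: D -> u \notin B :|: D.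
  by rewrite !inE !negb_or => /andP[/andP[/andP[_ ->] _] ->].
have WU y : y \in B :|: D -> y \in A :|: B :|: C :|: D.
  by rewrite !inE => /orP[]->; rewrite ?orbT.
have AU y : y \in A -> y \in A :|: B :|: C :|: D by rewrite !inE => ->.
have AAC y : y \in A -> y \in A :|: C by rewrite !inE => ->.
have AW y : y \in A -> y \notin B :|: D by move/AAC; apply: switchable_sides sw.
have [f [fK fb fd fB fo]] := exchange_involution (nW _ nb') (nW _ nd) (sw_BD sw) (sw_cardBD sw).
have indep := sw_indep sw; have sep := sw_sep sw.
have nba y : adj G a y -> y = b \/ y \in A.
  move=> ay; have : y \in nb G a by rewrite inE.
  by rewrite (sw_a sw) !inE => /orP[/eqP|]; [left|right].
have nbb y : adj G b y -> y = a \/ y \in B.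
  move=> ay; have : y \in nb G b by rewrite inE.
  by rewrite (sw_b sw) !inE => /orP[/eqP|]; [left|right].
have Wa u : u \in B :|: D -> ~~ adj G u a.
  move=> uW; apply/negP; rewrite adjC => /nba[ub|/AW]; last by rewrite uW.
  by have := nW _ nb'; rewrite -ub uW.
have WA u y : u \in B :|: D -> y \in A -> ~~ adj G u y by move=> /WU uU /AU; apply: indep.
have N1 y : y \in ball G 1 v -> y \notin B :|: D.
  rewrite in_ball1; move: va; rewrite !(in_setU1 v) => /orP[/eqP->|vA].
    by move=> /orP[/eqP->|/nba[->|/AW//]]; apply: nW.
  move=> /orP[/eqP->|vy]; first exact: AW.
  by apply/negP => /WA/(_ vA); rewrite adjC vy.
have N2 y : y \in ball G 1 v -> y != b -> forall u, u \in B :|: D -> ~~ adj G u y.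
  rewrite in_ball1; move: va; rewrite !(in_setU1 v) => /orP[/eqP->|vA].
    move=> /orP[/eqP-> _ u /Wa//|/nba[->|yA _ u uW]]; first by rewrite eqxx.
    exact: WA.
  move=> /orP[/eqP-> _ u uW|vy _ u uW]; first exact: WA.
  by have := sep v u (AAC _ vA) uW y; rewrite vy adjC.
have agree := adj_exchange sw fK fb fd fB fo.
apply: (rooted_nbhd_iso_fixed fK).
- move: va; rewrite in_setU1 => /orP[/eqP->|vA]; first by rewrite fo ?nW.
  rewrite fo ?AW //; first by apply: contraNneq nb' => <-; apply: AU.
  by apply: contraNneq nd => <-; apply: AU.
- move=> y yv z; apply: agree; apply/negP => /and4P[].
    by rewrite (negbTE (N1 y yv)).
  by move=> _ yb _ /existsP[u /andP[uW]]; rewrite (negbTE (N2 y yv yb u uW)).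
move: va; rewrite in_setU1 => /orP[/eqP va|vA].
  (* Around [a] the ball does contain [B], but its remaining neighbours are at distance 3; vertices
     reached through [A] are not adjacent to [B] or [D] by separation. *)
  have N3 z : z \in ball G 2 v -> z != b -> forall u, u \in B :|: D -> ~~ adj G u z.
    rewrite in_ball2 orbA -in_ball1 => /orP[|/existsP[w /andP[]]]; first exact: N2.
    rewrite va => /nba[->|wA] wz zb u uW.
      by case: (nbb _ wz) => [->|zB]; [exact: Wa|apply: indep; apply: WU => //; rewrite inE zB].
    by have := sep w u (AAC _ wA) uW z; rewrite wz adjC.
  move=> y z yv zv; apply: agree; apply/negP => /and4P[] _ h _ /existsP[u /andP[uW]].
    by rewrite (negbTE (N3 z zv h u uW)).
  by rewrite (negbTE (N3 y yv h u uW)).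
(* Around a vertex of [A] even the sets [B] and [D] are out of reach. *)
have N3 z : z \in ball G 2 v -> z \notin B :|: D.
  rewrite in_ball2 orbA -in_ball1 => /orP[|/existsP[w vwz]]; first exact: N1.
  by apply/negP => zW; have := sep v z (AAC _ vA) zW w; rewrite vwz.
by move=> y z yv zv; apply: agree; apply/negP => /and4P[]; rewrite (negbTE (N3 _ _)).
Qed.

(** The identity works: such a [v] can reach [a] or [c] in two steps only through [A :|: C], and [b]
    or [d] only through [B :|: D]. Doing both would make [v] a common neighbour of the two sides, so
    no switched pair lies in its 2-ball. *)
Lemma switch_nbhd_iso_far G a b c d A B C D v : switchable G a b c d A B C D ->
  v \notin [:: a; b; c; d] -> v \notin A :|: B :|: C :|: D ->
  rooted_nbhd_iso 2 G (switch G a b c d) v v.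
Proof.
move=> sw; have hu := sw_uniq sw; rewrite !inE !negb_or.
move=> /and4P[va vb vc vd] /andP[/andP[/andP[vA vB] vC] vD].
have nva : ~~ adj G v a.
  by rewrite adjC; have := in_setU1 v b A; rewrite -(sw_a sw) inE (negbTE vb) => ->.
have nvb : ~~ adj G v b.
  by rewrite adjC; have := in_setU1 v a B; rewrite -(sw_b sw) inE (negbTE va) => ->.
have nvc : ~~ adj G v c.
  by rewrite adjC; have := in_setU1 v d C; rewrite -(sw_c sw) inE (negbTE vd) => ->.
have nvd : ~~ adj G v d.
  by rewrite adjC; have := in_setU1 v c D; rewrite -(sw_d sw) inE (negbTE vc) => ->.
apply: (@rooted_nbhd_iso_fixed _ _ _ id) => //.
  move=> y; rewrite in_ball1 => yv z.
  have yo : y \notin [:: a; b; c; d].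
    rewrite !inE !negb_or; case/orP: yv => [/eqP->|vy]; first by rewrite va vb vc vd.
    by apply/and4P; split; apply: contraTneq vy => ->.
  by have := nb_switch_out G hu yo; move/setP/(_ z); rewrite !inE.
have via u w P : nb G u = w |: P -> v != u -> ~~ adj G v u -> ~~ adj G v w -> u \in ball G 2 v ->
    exists2 x, x \in P & adj G v x.
  move=> nbu vu nvu nvw; rewrite in_ball2 (eq_sym u) (negbTE vu) (negbTE nvu) /=.
  move=> /existsP[x /andP[vx]]; rewrite adjC => ux; exists x => //.
  have : x \in nb G u by rewrite inE.
  by rewrite nbu in_setU1; case: eqP => //= xw; rewrite xw (negbTE nvw) in vx.
have viaAC u : (u == a) || (u == c) -> u \in ball G 2 v -> exists2 x, x \in A :|: C & adj G v x.
  move=> /orP[]/eqP->.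
    by move=> /(via _ _ _ (sw_a sw) va nva nvb)[x xA vx]; exists x; rewrite // inE xA.
  by move=> /(via _ _ _ (sw_c sw) vc nvc nvd)[x xA vx]; exists x; rewrite // inE xA orbT.
have viaBD u : (u == b) || (u == d) -> u \in ball G 2 v -> exists2 x, x \in B :|: D & adj G v x.
  move=> /orP[]/eqP->.
    by move=> /(via _ _ _ (sw_b sw) vb nvb nva)[x xA vx]; exists x; rewrite // inE xA.
  by move=> /(via _ _ _ (sw_d sw) vd nvd nvc)[x xA vx]; exists x; rewrite // inE xA orbT.
have no u w : u \in ball G 2 v -> w \in ball G 2 v ->
    ((u == a) || (u == c)) && ((w == b) || (w == d)) = false.
  move=> uv wv; apply/negP => /andP[/viaAC/(_ uv)[x xAC vx] /viaBD/(_ wv)[z zBD vz]].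
  by have := sw_sep sw xAC zBD v; rewrite adjC vx vz.
move=> y z yv zv.
have noyz u w : (u == a) || (u == c) -> (w == b) || (w == d) -> (y == u) && (z == w) = false.
  by move=> ou ow; apply/andP => -[/eqP yu /eqP zw]; have := no y z yv zv; rewrite yu zw ou ow.
have nozy u w : (u == a) || (u == c) -> (w == b) || (w == d) -> (y == w) && (z == u) = false.
  by move=> ou ow; apply/andP => -[/eqP yu /eqP zw]; have := no z y zv yv; rewrite yu zw ou ow.
rewrite adj_switch // (noyz a d) ?eqxx ?orbT // (nozy a d) ?eqxx ?orbT //.
rewrite (noyz c b) ?eqxx ?orbT // (nozy c b) ?eqxx ?orbT //.
rewrite (noyz a b) ?eqxx ?orbT // (nozy a b) ?eqxx ?orbT //.
by rewrite (noyz c d) ?eqxx ?orbT // (nozy c d) ?eqxx ?orbT //= andbT.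
Qed.

Lemma switch_iso_nbhds G a b c d A B C D : switchable G a b c d A B C D ->
  iso_nbhds 2 G (switch G a b c d).
Proof.
move=> sw; exists id; split; first by exists id.
move=> v; case: (boolP (v \in a |: A)) => [|va]; first exact: switch_nbhd_iso_near sw.
case: (boolP (v \in b |: B)) => [|vb].
  by rewrite switchC1; apply: switch_nbhd_iso_near (switchableC1 sw).
case: (boolP (v \in c |: C)) => [|vc].
  by rewrite switchC2; apply: switch_nbhd_iso_near (switchableC2 sw).
case: (boolP (v \in d |: D)) => [|vd].
  by rewrite switchC2 switchC1; apply: switch_nbhd_iso_near (switchableC1 (switchableC2 sw)).
move: va vb vc vd; rewrite !in_setU1 !negb_or => /andP[va vA] /andP[vb vB] /andP[vc vC] /andP[vd vD].
apply: (switch_nbhd_iso_far sw); first by rewrite !inE !negb_or va vb vc vd.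
by rewrite !inE !negb_or vA vB vC vD.
Qed.

(** * An isomorphism invariant that the switch changes *)

Definition nb_deg G x : nat := \sum_(y in nb G x) #|nb G y|.

(** The sum of s(x) s(y) over ordered adjacent pairs: every edge counts twice, whence the factor 2
    in [switch_edge_weight]. *)
Definition edge_weight G : int :=
  \sum_x \sum_(y in nb G x) (nb_deg G x)%:Z * (nb_deg G y)%:Z.

Lemma graph_iso_edge_weight G H : graph_iso G H -> edge_weight G = edge_weight H.
Proof.
move=> [f [[g fK gK] fadj]].
have fnb x : nb H (f x) = f @: nb G x.
  apply/setP => y; rewrite inE -[y]gK -fadj; apply/idP/imsetP => [h|[z]].
    by exists (g y); rewrite ?inE.
  by rewrite inE => h /(can_inj fK)->.
have finj := can_inj fK.
have fdeg x : nb_deg H (f x) = nb_deg G x.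
  rewrite /nb_deg fnb big_imset /=; last by move=> y z _ _; apply: finj.
  by apply: eq_bigr => y _; rewrite fnb card_imset.
rewrite /edge_weight [RHS](reindex f) /=; last by exists g => x _.
apply: eq_bigr => x _; rewrite fnb big_imset /=; last by move=> y z _ _; apply: finj.
by apply: eq_bigr => y _; rewrite !fdeg.
Qed.

(** Each endpoint trades one neighbour for another of the same degree, for instance [a] trades [b]
    for [d], and all degrees stay as they were. *)
Lemma switch_nb_deg G a b c d A B C D : switchable G a b c d A B C D ->
  (forall x, #|nb (switch G a b c d) x| = #|nb G x|) /\
  (forall x, nb_deg (switch G a b c d) x = nb_deg G x).
Proof.
move=> sw; have hu := sw_uniq sw.
have sb := switchableC1 sw; have sc := switchableC2 sw; have sd := switchableC1 sc.
have ha := nb_switch sw; have hb := nb_switch sb; have hc := nb_switch sc; have hd := nb_switch sd.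
rewrite -switchC1 in hb; rewrite -switchC2 in hc; rewrite -switchC1 -switchC2 in hd.
have [na nb' nc nd] := sw_notin sw.
have nin v (P : {set 'I_n}) : v \notin A :|: B :|: C :|: D -> P \subset A :|: B :|: C :|: D -> v \notin P.
  by move=> nv sP; apply: contraNN nv => /(subsetP sP).
have sA : A \subset A :|: B :|: C :|: D by rewrite -!setUA subsetUl.
have sB : B \subset A :|: B :|: C :|: D by rewrite (setUC A) -!setUA subsetUl.
have sC : C \subset A :|: B :|: C :|: D by rewrite (setUC _ C) -!setUA subsetUl.
have sD : D \subset A :|: B :|: C :|: D by rewrite subsetUr.
have bA := nin b A nb' sA; have dA := nin d A nd sA; have bC := nin b C nb' sC; have dC := nin d C nd sC.
have aB := nin a B na sB; have cB := nin c B nc sB; have aD := nin a D na sD; have cD := nin c D nc sD.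
have cards x : #|nb (switch G a b c d) x| = #|nb G x|.
  case: (boolP (x \in [:: a; b; c; d])) => [|xo]; last by rewrite nb_switch_out.
  rewrite !inE => /or4P[]/eqP->.
  - by rewrite ha (sw_a sw) !cardsU1 bA dA.
  - by rewrite hb (sw_b sw) !cardsU1 aB cB.
  - by rewrite hc (sw_c sw) !cardsU1 bC dC.
  - by rewrite hd (sw_d sw) !cardsU1 aD cD.
have dAC : #|nb G a| = #|nb G c| by rewrite (sw_a sw) (sw_c sw) !cardsU1 bA dC (sw_cardAC sw).
have dBD : #|nb G b| = #|nb G d| by rewrite (sw_b sw) (sw_d sw) !cardsU1 aB cD (sw_cardBD sw).
split=> // x; rewrite /nb_deg; under eq_bigr do rewrite cards.
case: (boolP (x \in [:: a; b; c; d])) => [|xo]; last by rewrite nb_switch_out.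
rewrite !inE => /or4P[]/eqP->.
- by rewrite ha (sw_a sw) !big_setU1 //= dBD.
- by rewrite hb (sw_b sw) !big_setU1 //= dAC.
- by rewrite hc (sw_c sw) !big_setU1 //= dBD.
- by rewrite hd (sw_d sw) !big_setU1 //= dAC.
Qed.

Lemma switch_edge_weight G a b c d A B C D : switchable G a b c d A B C D ->
  edge_weight (switch G a b c d) = edge_weight G +
    2 * ((nb_deg G a)%:Z - (nb_deg G c)%:Z) * ((nb_deg G d)%:Z - (nb_deg G b)%:Z).
Proof.
move=> sw; have hu := sw_uniq sw.
have sb := switchableC1 sw; have sc := switchableC2 sw; have sd := switchableC1 sc.
have ha := nb_switch sw; have hb := nb_switch sb; have hc := nb_switch sc; have hd := nb_switch sd.
rewrite -switchC1 in hb; rewrite -switchC2 in hc; rewrite -switchC1 -switchC2 in hd.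
have [na nb' nc nd] := sw_notin sw.
have nin v (P : {set 'I_n}) : v \notin A :|: B :|: C :|: D -> P \subset A :|: B :|: C :|: D -> v \notin P.
  by move=> nv sP; apply: contraNN nv => /(subsetP sP).
have sA : A \subset A :|: B :|: C :|: D by rewrite -!setUA subsetUl.
have sB : B \subset A :|: B :|: C :|: D by rewrite (setUC A) -!setUA subsetUl.
have sC : C \subset A :|: B :|: C :|: D by rewrite (setUC _ C) -!setUA subsetUl.
have sD : D \subset A :|: B :|: C :|: D by rewrite subsetUr.
have bA := nin b A nb' sA; have dA := nin d A nd sA; have bC := nin b C nb' sC; have dC := nin d C nd sC.
have aB := nin a B na sB; have cB := nin c B nc sB; have aD := nin a D na sD; have cD := nin c D nc sD.
have [_ degE] := switch_nb_deg sw.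
rewrite /edge_weight; under eq_bigr do under eq_bigr do rewrite !degE.
pose F H x : int := \sum_(y in nb H x) (nb_deg G x)%:Z * (nb_deg G y)%:Z.
rewrite -[LHS]/(\sum_x F (switch G a b c d) x) -[in RHS]/(\sum_x F G x + _).
have split4 K : \sum_x F K x = F K a + (F K b + (F K c + (F K d +
    \sum_(x | x \notin [:: a; b; c; d]) F K x))).
  move: hu => /= ; rewrite !inE !negb_or => /and4P[/and3P[ab ac ad] /andP[bc bd] cd _].
  rewrite (bigD1 a) //= (bigD1 b) 1?eq_sym //= (bigD1 c) /=; last by rewrite eq_sym ac eq_sym bc.
  rewrite (bigD1 d) /=; last by rewrite eq_sym ad eq_sym bd eq_sym cd.
  by do 4 congr (_ + _); apply: eq_bigl => x; rewrite !inE !negb_or -!andbA.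
rewrite !split4; have -> : \sum_(x | x \notin [:: a; b; c; d]) F (switch G a b c d) x =
    \sum_(x | x \notin [:: a; b; c; d]) F G x.
  by apply: eq_bigr => x xo; rewrite /F nb_switch_out.
rewrite /F ha hb hc hd (sw_a sw) (sw_b sw) (sw_c sw) (sw_d sw).
(* The sums over [A], [B], [C], [D] cancel. With s for [nb_deg], what remains is twice s(a)s(d) +
   s(c)s(b) - s(a)s(b) - s(c)s(d), which factors. *)
rewrite !big_setU1 //=; ring.
Qed.

Theorem switchable_not_reconstructible G a b c d A B C D :
  switchable G a b c d A B C D -> nb_deg G a != nb_deg G c -> nb_deg G b != nb_deg G d ->
  ~ reconstructible 2 G.
Proof.
move=> sw nac nbd rec; have := graph_iso_edge_weight (rec _ (switch_iso_nbhds sw)).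
rewrite (switch_edge_weight sw) => /eqP; rewrite -subr_eq0 opprD addrA subrr sub0r oppr_eq0.
rewrite !mulf_eq0 /= !subr_eq0 !eqz_nat (negbTE nac) eq_sym (negbTE nbd).
by [].
Qed.

End SwitchIso.

(** * The probability that a trial succeeds, and independent trials *)

Section Trials.
Variables (R : realFieldType) (I : finType).
Implicit Types (p : R) (S T E P Q : {set I}) (f g : {set I} -> R).

Lemma expect_sign p T : expect p T (fun E => (-1) ^+ #|E|) = (1 - p *+ 2) ^+ #|T|.
Proof.
elim: {T}_.+1 {-2}T (ltnSn #|T|) => // k IH T cT.
have [->|[x xT]] := set_0Vmem T; first by rewrite expect_set0 cards0.
rewrite (@expect_split _ _ _ [set x]) ?sub1set // expect_set1.
under eq_expect do rewrite set0U.
rewrite [in X in _ + _ * X](eq_expect p (g := fun E => -1 * (-1) ^+ #|E|)); last first.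
  move=> E /subsetP sE; rewrite cardsU1; suff -> : x \in E = false by rewrite exprS.
  by apply/negP => /sE; rewrite !inE eqxx.
rewrite expectZ IH.
  by rewrite [in RHS](cardsD1 x) xT exprS; ring.
by rewrite -ltnS (leq_trans _ cT) // ltnS [in X in (_ <= X)%N](cardsD1 x) xT.
Qed.

Lemma expect_empty p T : expect p T (fun E => (E == set0)%:R) = (1 - p) ^+ #|T|.
Proof.
have := @prob_pattern R I p T set0 T (sub0set T) (subxx T).
rewrite -setI_eq0 set0I eqxx cards0 expr0 mul1r => /(_ isT) <-; apply: eq_expect => E ET.
by rewrite sub0set /= disjoint_sym -setI_eq0 (setIidPl ET).
Qed.

Lemma expect_indep p T S S' f g : S \subset T -> S' \subset T -> [disjoint S & S'] ->
  expect p T (fun E => f (E :&: S) * g (E :&: S')) = expect p S f * expect p S' g.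
Proof.
move=> ST S'T dis.
have := @expect_prod R I bool p T [:: true; false] (fun b => if b then S else S')
  (fun b => if b then f else g) isT.
rewrite !big_cons !big_nil !mulr1 => <-.
- by apply: eq_expect => E _; rewrite !big_cons big_nil mulr1.
- by case.
- by case=> [] [] //; rewrite disjoint_sym.
Qed.

(* [y] is harmless when [E] misses [P] or [Q]; the four weights below are the
   expectations of this indicator twisted by the signs of [#|E :&: P|] and [#|E :&: Q|]. *)
Definition misses (P Q E : {set I}) : bool := (E :&: P == set0) || (E :&: Q == set0).

(** Inclusion-exclusion writes the indicator through those of missing [P] and of missing [Q]. An
    empty set has sign 1, so a sign is absorbed by the indicator on the same set, and each term is a
    product of a function of [E :&: P] and one of [E :&: Q]. *)
Lemma expect_misses p T P Q : P \subset T -> Q \subset T -> [disjoint P & Q] ->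
  let q := 1 - p in let r := 1 - p *+ 2 in let a := #|P| in let b := #|Q| in
  [/\ expect p T (fun E => (misses P Q E)%:R) = q ^+ a + q ^+ b - q ^+ a * q ^+ b,
      expect p T (fun E => (misses P Q E)%:R * (-1) ^+ #|E :&: P|) =
        q ^+ a + r ^+ a * q ^+ b - q ^+ a * q ^+ b,
      expect p T (fun E => (misses P Q E)%:R * (-1) ^+ #|E :&: Q|) =
        q ^+ a * r ^+ b + q ^+ b - q ^+ a * q ^+ b &
      expect p T (fun E => (misses P Q E)%:R * (-1) ^+ #|E :&: P| * (-1) ^+ #|E :&: Q|) =
        q ^+ a * r ^+ b + r ^+ a * q ^+ b - q ^+ a * q ^+ b].
Proof.
move=> PT QT dis q r a b.
pose z (E : {set I}) : R := (E == set0)%:R; pose s (E : {set I}) : R := (-1) ^+ #|E|.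
have zs E : z E * s E = z E by rewrite /z /s; case: eqP => [->|]; rewrite ?cards0 ?mul1r ?mul0r.
have mE E : (misses P Q E)%:R = z (E :&: P) + z (E :&: Q) - z (E :&: P) * z (E :&: Q).
  by rewrite /misses /z; case: eqP; case: eqP => _ _ /=; ring.
have I2 f g := expect_indep p f g PT QT dis.
have one S : expect p S (fun _ => 1 : R) = 1 by apply: expect_const.
have zE S : expect p S z = (1 - p) ^+ #|S| by apply: expect_empty.
have sE S : expect p S s = (1 - p *+ 2) ^+ #|S| by apply: expect_sign.
have comb (f1 g1 f2 g2 : {set I} -> R) (h : {set I} -> R) :
    (forall E, h E = f1 (E :&: P) * g1 (E :&: Q) + f2 (E :&: P) * g2 (E :&: Q) +
       (-1) * (z (E :&: P) * z (E :&: Q))) ->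
    expect p T h = expect p P f1 * expect p Q g1 + expect p P f2 * expect p Q g2 -
      q ^+ a * q ^+ b.
  move=> hE; rewrite (eq_expect p (g := fun E => f1 (E :&: P) * g1 (E :&: Q) +
    f2 (E :&: P) * g2 (E :&: Q) + (-1) * (z (E :&: P) * z (E :&: Q)))) //.
  by rewrite !expectD expectZ !I2 !zE mulN1r.
split.
- rewrite (comb z (fun=> 1) (fun=> 1) z) ?one ?zE ?mulr1 ?mul1r // => E.
  by rewrite mE; ring.
- rewrite (comb z (fun=> 1) s z) ?one ?zE ?sE ?mulr1 ?mul1r // => E.
  rewrite mE -/(s (E :&: P)); have := zs (E :&: P).
  set u := z _; set v := s _; set w := z _ => e.
  by transitivity (u * v + w * v - (u * v) * w); [ring|rewrite e; ring].
- rewrite (comb z s (fun=> 1) z) ?one ?zE ?sE ?mulr1 ?mul1r // => E.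
  rewrite mE -/(s (E :&: Q)); have := zs (E :&: Q).
  set u := z (E :&: Q); set v := s _; set w := z _ => e.
  by transitivity (u * v + w * v - (u * v) * w); [ring|rewrite e; ring].
rewrite (comb z s s z) ?one ?zE ?sE ?mulr1 ?mul1r // => E.
rewrite mE -/(s (E :&: P)) -/(s (E :&: Q)); have := zs (E :&: P); have := zs (E :&: Q).
set u := z (E :&: P); set v := s (E :&: P); set u' := z (E :&: Q); set v' := s (E :&: Q) => e' e.
by transitivity ((u * v) * v' + (u' * v') * v - (u * v) * (u' * v')); [ring|rewrite e e'; ring].
Qed.

(** In the application [P y] and [Q y] are the pairs joining [y] to the outer neighbours of [a], [c]
    and of [b], [d]. The first clause then forbids common neighbours in [Z]; the odd totals make
    s(a) - s(c) and s(b) - s(d) odd. *)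
Definition trial (Y : finType) (Z : {set Y}) (P Q : Y -> {set I}) (E : {set I}) : bool :=
  [&& [forall y in Z, misses (P y) (Q y) E],
      odd (\sum_(y in Z) #|E :&: P y|) & odd (\sum_(y in Z) #|E :&: Q y|)].

(* Expanding the two parity indicators as [(1 - sign) / 2] turns the trial into four
   products over [y], whose factors are independent. *)
Lemma prob_trial p (Y : finType) (Z : {set Y}) (P Q : Y -> {set I}) T (a b : nat) :
  (forall y, y \in Z -> P y :|: Q y \subset T) ->
  (forall y, y \in Z -> [disjoint P y & Q y]) ->
  {in Z &, forall y y', y != y' -> [disjoint P y :|: Q y & P y' :|: Q y']} ->
  (forall y, y \in Z -> #|P y| = a) -> (forall y, y \in Z -> #|Q y| = b) ->
  let q := 1 - p in let r := 1 - p *+ 2 in let N := #|Z| in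
  prob p T (trial Z P Q) = ((q ^+ a + q ^+ b - q ^+ a * q ^+ b) ^+ N -
     (q ^+ a + r ^+ a * q ^+ b - q ^+ a * q ^+ b) ^+ N -
     (q ^+ a * r ^+ b + q ^+ b - q ^+ a * q ^+ b) ^+ N +
     (q ^+ a * r ^+ b + r ^+ a * q ^+ b - q ^+ a * q ^+ b) ^+ N) / 4.
Proof.
move=> PQT dis dis2 Pa Qb q r N.
pose t y E : R := (misses (P y) (Q y) E)%:R.
pose sP y E : R := (-1) ^+ #|E :&: P y|; pose sQ y E : R := (-1) ^+ #|E :&: Q y|.
have prodE (h : Y -> {set I} -> R) c :
    (forall y E, h y (E :&: (P y :|: Q y)) = h y E) ->
    (forall y, y \in Z -> expect p T (h y) = c) ->
    expect p T (fun E => \prod_(y in Z) h y E) = c ^+ N.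
  move=> loc hc; rewrite /N -prodr_const -big_enum /=.
  have pw : {in enum Z &, forall y y', y != y' -> [disjoint P y :|: Q y & P y' :|: Q y']}.
    by move=> y y'; rewrite !mem_enum; apply: dis2.
  have sub y : y \in enum Z -> P y :|: Q y \subset T by rewrite mem_enum; apply: PQT.
  have := expect_prod p h (enum_uniq Z) sub pw => e.
  transitivity (\prod_(y <- enum Z) expect p (P y :|: Q y) (h y)).
    by rewrite -e; apply: eq_expect => E _; rewrite big_enum; apply: eq_bigr => y _; rewrite loc.
  rewrite !big_enum /=; apply: eq_bigr => y yZ; rewrite -(hc y yZ).
  by apply/esym/expect_local => [|E _]; rewrite ?PQT ?loc.
have locP y E : (E :&: (P y :|: Q y)) :&: P y = E :&: P y.
  by rewrite -setIA (setIidPr (subsetUl _ _)).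
have locQ y E : (E :&: (P y :|: Q y)) :&: Q y = E :&: Q y.
  by rewrite -setIA (setIidPr (subsetUr _ _)).
have loct y E : t y (E :&: (P y :|: Q y)) = t y E by rewrite /t /misses locP locQ.
have locsP y E : sP y (E :&: (P y :|: Q y)) = sP y E by rewrite /sP locP.
have locsQ y E : sQ y (E :&: (P y :|: Q y)) = sQ y E by rewrite /sQ locQ.
have PT y : y \in Z -> P y \subset T by move=> yZ; apply: subset_trans (PQT y yZ); apply: subsetUl.
have QT y : y \in Z -> Q y \subset T by move=> yZ; apply: subset_trans (PQT y yZ); apply: subsetUr.
have e4 y yZ := expect_misses p (PT y yZ) (QT y yZ) (dis y yZ).
have E0 := prodE t (q ^+ a + q ^+ b - q ^+ a * q ^+ b) loct.
have E1 := prodE (fun y E => t y E * sP y E) (q ^+ a + r ^+ a * q ^+ b - q ^+ a * q ^+ b).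
have E2 := prodE (fun y E => t y E * sQ y E) (q ^+ a * r ^+ b + q ^+ b - q ^+ a * q ^+ b).
have E3 := prodE (fun y E => t y E * sP y E * sQ y E)
  (q ^+ a * r ^+ b + r ^+ a * q ^+ b - q ^+ a * q ^+ b).
have [a1 a2 a3 a4] : [/\ forall y, y \in Z -> expect p T (t y) = q ^+ a + q ^+ b - q ^+ a * q ^+ b,
   forall y, y \in Z -> expect p T (fun E => t y E * sP y E) = q ^+ a + r ^+ a * q ^+ b - q ^+ a * q ^+ b,
   forall y, y \in Z -> expect p T (fun E => t y E * sQ y E) = q ^+ a * r ^+ b + q ^+ b - q ^+ a * q ^+ b &
   forall y, y \in Z -> expect p T (fun E => t y E * sP y E * sQ y E) =
     q ^+ a * r ^+ b + r ^+ a * q ^+ b - q ^+ a * q ^+ b].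
  by split=> y yZ; have [] := e4 y yZ; rewrite Pa // Qb.
rewrite -(E0 a1) -(E1 _ a2) -?(E2 _ a3) -?(E3 _ a4);
  try by move=> y E; rewrite ?loct ?locsP ?locsQ.
have lin f1 f2 f3 f4 : expect p T f1 - expect p T f2 - expect p T f3 + expect p T f4 =
    expect p T (fun E => f1 E - f2 E - f3 E + f4 E).
  transitivity (expect p T (fun E => f1 E + (-1 * f2 E + (-1 * f3 E + f4 E)))).
    rewrite expectD (expectD p T (fun E => -1 * f2 E)) (expectD p T (fun E => -1 * f3 E)).
    by rewrite (expectZ p T (-1) f2) (expectZ p T (-1) f3); ring.
  by apply: eq_expect => E _; ring.
rewrite lin -expectZr; apply: eq_expect => E _.
have -> : \prod_(y in Z) (t y E * sP y E) = \prod_(y in Z) t y E * \prod_(y in Z) sP y E.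
  exact: big_split.
have -> : \prod_(y in Z) (t y E * sQ y E) = \prod_(y in Z) t y E * \prod_(y in Z) sQ y E.
  exact: big_split.
have -> : \prod_(y in Z) (t y E * sP y E * sQ y E) =
    \prod_(y in Z) t y E * \prod_(y in Z) sP y E * \prod_(y in Z) sQ y E.
  by rewrite -!big_split.
have signE m : (odd m)%:R = (1 - (-1) ^+ m) / 2 :> R.
  by rewrite -signr_odd; case: (odd m); rewrite /= ?expr1 ?expr0; lra.
have tE : \prod_(y in Z) t y E = [forall y in Z, misses (P y) (Q y) E]%:R.
  case: forallP => [h|/forallP/forallPn[y]].
    by rewrite big1 // => y yZ; rewrite /t; have := h y; rewrite yZ => /= ->.
  by rewrite negb_imply => /andP[yZ ny]; rewrite (bigD1 y) //= /t (negbTE ny) mul0r.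
have -> : \prod_(y in Z) sP y E = (-1) ^+ (\sum_(y in Z) #|E :&: P y|) by apply: prodrXr.
have -> : \prod_(y in Z) sQ y E = (-1) ^+ (\sum_(y in Z) #|E :&: Q y|) by apply: prodrXr.
rewrite tE /trial -!mulnb !natrM !signE.
set x := (-1) ^+ (\sum_(y in Z) #|E :&: P y|); set x' := (-1) ^+ _; set w := _%:R.
by field.
Qed.

Lemma bernoulli_ineq (x : R) k : 0 <= x <= 1 -> 1 - k%:R * x <= (1 - x) ^+ k.
Proof.
move=> /andP[x0 x1]; elim: k => [|k IH]; first by rewrite mul0r subr0 expr0.
have y0 : 0 <= 1 - x by rewrite subr_ge0.
rewrite exprS; apply: le_trans (ler_wpM2l y0 IH).
rewrite -natr1; have := mulr_ge0 (ler0n R k) (mulr_ge0 x0 x0); nra.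
Qed.

(** The unsigned factor is t = 1 - (1 - q^a)(1 - q^b), at least 1 - a b p^2. Each factor with one
    sign is at most t q, so its N-th power is at most a quarter of t^N, and the doubly signed term
    is nonnegative. This leaves (1 - 1/4 - 1/4)/4 = 1/8 of t^N. *)
Lemma trial_prob_ge p a b N : 0 <= p <= 1 -> (0 < a)%N -> (0 < b)%N ->
  a%:R * p <= 4^-1 -> b%:R * p <= 4^-1 -> (1 - p) ^+ N <= 4^-1 ->
  let q := 1 - p in let r := 1 - p *+ 2 in
  (1 - a%:R * b%:R * p ^+ 2) ^+ N / 8 <=
  ((q ^+ a + q ^+ b - q ^+ a * q ^+ b) ^+ N -
     (q ^+ a + r ^+ a * q ^+ b - q ^+ a * q ^+ b) ^+ N -
     (q ^+ a * r ^+ b + q ^+ b - q ^+ a * q ^+ b) ^+ N +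
     (q ^+ a * r ^+ b + r ^+ a * q ^+ b - q ^+ a * q ^+ b) ^+ N) / 4.
Proof.
move=> p01 a0 b0 ap bp qN; cbv zeta; set q := 1 - p; set r := 1 - p *+ 2.
have /andP[p0 p1] := p01.
have bound k : (0 < k)%N -> k%:R * p <= 4^-1 ->
    [/\ 1 - k%:R * p <= q ^+ k, q ^+ k <= 1, 1 - 2 * (k%:R * p) <= r ^+ k & r ^+ k <= 1 - 2 * p].
  move=> k0 kp; have k1 : 1 <= k%:R :> R by rewrite ler1n.
  have p4 : p <= 4^-1 by apply: le_trans kp; rewrite ler_peMl.
  split; first exact: bernoulli_ineq.
  - by rewrite exprn_ile1 // /q; lra.
  - have -> : r = 1 - 2 * p by rewrite /r mulr2n; ring.
    by rewrite mulrCA; apply: bernoulli_ineq; lra.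
  - have -> : r = 1 - 2 * p by rewrite /r mulr2n; ring.
    by rewrite -[leRHS]expr1 ler_wiXn2l //; lra.
have [A1 A2 A3 A4] := bound a a0 ap; have [B1 B2 B3 B4] := bound b b0 bp.
have x0 : 0 <= a%:R * p by rewrite mulr_ge0.
have y0 : 0 <= b%:R * p by rewrite mulr_ge0.
have -> : a%:R * b%:R * p ^+ 2 = (a%:R * p) * (b%:R * p) by ring.
move: A1 A2 A3 A4 B1 B2 B3 B4 x0 y0 ap bp; rewrite -/q.
move: (a%:R * p) (b%:R * p) (q ^+ a) (q ^+ b) (r ^+ a) (r ^+ b) => x y A B A' B'.
move=> A1 A2 A3 A4 B1 B2 B3 B4 x0 y0 ap bp.
set t := A + B - A * B; set tA := A + A' * B - A * B; set tB := A * B' + B - A * B.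
have t1 : t <= 1 by rewrite /t; nra.
have t0 : 1 - x * y <= t by rewrite /t; nra.
have xy : x * y <= 1 by nra.
(* The difference t - tA equals B (1 - A'), which is at least 2 p B; as B >= 3/4, this exceeds p and
   hence p t. *)
have tA1 : tA <= t * q.
  have : A' * B <= (1 - 2 * p) * B by rewrite ler_wpM2r //; lra.
  have : p * t <= p by rewrite ler_piMr.
  have : p <= 2 * p * B by nra.
  by rewrite /tA /q /t; nra.
have tB1 : tB <= t * q.
  have : A * B' <= A * (1 - 2 * p) by rewrite ler_wpM2l //; lra.
  have : p * t <= p by rewrite ler_piMr.
  have : p <= 2 * p * A by nra.
  by rewrite /tB /q /t; nra.
have tA0 : 0 <= tA by rewrite /tA; nra.
have tB0 : 0 <= tB by rewrite /tB; nra.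
have tAB : 0 <= A * B' + A' * B - A * B by nra.
have tN : 0 <= t ^+ N by rewrite exprn_ge0 //; lra.
have hA : tA ^+ N <= t ^+ N * q ^+ N by rewrite -exprMn lerXn2r ?nnegrE // mulr_ge0 /q; lra.
have hB : tB ^+ N <= t ^+ N * q ^+ N by rewrite -exprMn lerXn2r ?nnegrE // mulr_ge0 /q; lra.
have hq : t ^+ N * q ^+ N <= t ^+ N / 4 by rewrite ler_wpM2l.
have hAB : 0 <= (A * B' + A' * B - A * B) ^+ N by rewrite exprn_ge0.
have ht : (1 - x * y) ^+ N <= t ^+ N by rewrite lerXn2r ?nnegrE //; lra.
by lra.
Qed.

(** Trial k depends only on the pairs in its region [S k]; these regions are disjoint, so the
    failure probabilities multiply. *)
Lemma prob_no_trial p (Y : finType) (Z : {set Y}) K (P Q : 'I_K -> Y -> {set I}) T a b :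
  0 <= p <= 1 ->
  (forall k y, y \in Z -> P k y :|: Q k y \subset T) ->
  (forall k y, y \in Z -> [disjoint P k y & Q k y]) ->
  (forall k y k' y', y \in Z -> y' \in Z -> (k, y) != (k', y') ->
     [disjoint P k y :|: Q k y & P k' y' :|: Q k' y']) ->
  (forall k y, y \in Z -> #|P k y| = a) -> (forall k y, y \in Z -> #|Q k y| = b) ->
  (0 < a)%N -> (0 < b)%N ->
  a%:R * p <= 4^-1 -> b%:R * p <= 4^-1 -> (1 - p) ^+ #|Z| <= 4^-1 ->
  prob p T (fun E => [forall k, ~~ trial Z (P k) (Q k) E]) <=
    (1 - (1 - a%:R * b%:R * p ^+ 2) ^+ #|Z| / 8) ^+ K.
Proof.
move=> p01 PQT dis dis2 Pa Qb a0 b0 ap bp qN.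
pose S k := \bigcup_(y in Z) (P k y :|: Q k y).
have ST k : S k \subset T by apply/bigcupsP => y yZ; apply: PQT.
have disS k k' : k != k' -> [disjoint S k & S k'].
  move=> kk; rewrite disjoint_sym; apply: bigcup_disjoint => y yZ.
  rewrite disjoint_sym; apply: bigcup_disjoint => y' y'Z; rewrite dis2 //.
  by apply: contraNneq kk => -[->].
have sub k y : y \in Z -> P k y :|: Q k y \subset S k by move=> yZ; rewrite /S (bigD1 y) //= subsetUl.
have subP k y : y \in Z -> P k y \subset S k by move=> /(sub k); rewrite subUset => /andP[].
have subQ k y : y \in Z -> Q k y \subset S k by move=> /(sub k); rewrite subUset => /andP[].
have loc k E : trial Z (P k) (Q k) (E :&: S k) = trial Z (P k) (Q k) E.
  have eP y : y \in Z -> (E :&: S k) :&: P k y = E :&: P k y.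
    by move=> yZ; rewrite -setIA (setIidPr (subP k y yZ)).
  have eQ y : y \in Z -> (E :&: S k) :&: Q k y = E :&: Q k y.
    by move=> yZ; rewrite -setIA (setIidPr (subQ k y yZ)).
  rewrite /trial; congr [&& _, odd _ & odd _].
  - by apply: eq_forallb_in => y yZ; rewrite /misses eP ?eQ.
  - by apply: eq_bigr => y yZ; rewrite eP.
  - by apply: eq_bigr => y yZ; rewrite eQ.
set d := _ ^+ #|Z| / 8.
have dk k : d <= prob p (S k) (trial Z (P k) (Q k)).
  have dis3 : {in Z &, forall y y', y != y' -> [disjoint P k y :|: Q k y & P k y' :|: Q k y']}.
    by move=> y y' yZ y'Z yy; rewrite dis2 //; apply: contraNneq yy => -[->].
  rewrite (prob_trial p (sub k) (dis k) dis3 (Pa k) (Qb k)).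
  exact: trial_prob_ge.
pose F k E : R := 1 - (trial Z (P k) (Q k) E)%:R.
have -> : prob p T (fun E => [forall k, ~~ trial Z (P k) (Q k) E]) =
    expect p T (fun E => \prod_(k <- index_enum 'I_K) F k (E :&: S k)).
  apply: eq_expect => E _; rewrite /F; under eq_bigr do rewrite loc.
  case: forallP => [h|/forallP/forallPn[k]].
    by rewrite big1 // => k _; rewrite (negbTE (h k)) subr0.
  by rewrite negbK => tk; rewrite (bigD1 k) //= tk subrr mul0r.
rewrite expect_prod ?index_enum_uniq //; last by move=> k k' _ _; apply: disS.
apply: le_trans (_ : \prod_(k <- index_enum 'I_K) (1 - d) <= _); last first.
  by rewrite prodr_const card_ord.
apply: ler_prod => k _; have -> : expect p (S k) (F k) = 1 - prob p (S k) (trial Z (P k) (Q k)).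
  by rewrite -prob_predC; apply: eq_expect => E _; rewrite /F; case: trial; rewrite ?subrr ?subr0.
by rewrite subr_ge0 prob_le1 // lerD2l lerN2 dk.
Qed.

End Trials.

(** * From a successful trial to a graph that is not reconstructible *)

Section Configuration.
Variable n : nat.
Implicit Types (E : graph n) (F U Z : {set 'I_n}) (v x y z : 'I_n).

Definition outer E F v : {set 'I_n} := nb E v :\: F.

(* The edges revealed so far are those of [E], the unrevealed pairs are those in [T],
   and every pair meeting [F] has been revealed.  Each of [a], [b], [c], [d] has
   private neighbours outside [F]. *)
Record quad_config E (T : graph n) F i j a b c d : Prop := QuadConfig {
  qc_E : E \subset pairs n;
  qc_T : forall e, e \in T -> [disjoint e & F];
  qc_uniq : uniq [:: a; b; c; d];
  qc_F : [/\ a \in F, b \in F, c \in F & d \in F];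
  qc_a : nb E a :&: F = [set b]; qc_b : nb E b :&: F = [set a];
  qc_c : nb E c :&: F = [set d]; qc_d : nb E d :&: F = [set c];
  qc_private : forall v x, v \in [:: a; b; c; d] -> x \in outer E F v -> nb E x = [set v];
  qc_ia : #|outer E F a| = i; qc_jb : #|outer E F b| = j;
  qc_ic : #|outer E F c| = i; qc_jd : #|outer E F d| = j }.

Definition quad_nbhd E F a b c d : {set 'I_n} :=
  outer E F a :|: outer E F b :|: outer E F c :|: outer E F d.

Definition spokes (S : {set 'I_n}) y : {set {set 'I_n}} := [set [set x; y] | x in S].

Lemma set2_injl y : injective (fun x : 'I_n => [set x; y]).
Proof.
move=> x x' /= /eqP; rewrite eq_set2 => /orP[/andP[/eqP]//|/andP[/eqP-> /eqP->]//].
Qed.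

(** Double counting turns the total in [trial], taken over [Z], into a sum over outer neighbours,
    which is the form in which it enters s(a) and s(c). *)
Lemma sum_spokes E (S Z : {set 'I_n}) :
  \sum_(y in Z) #|E :&: spokes S y| = \sum_(x in S) #|[set y in Z | [set x; y] \in E]|.
Proof.
transitivity (\sum_(y in Z) \sum_(x in S) ([set x; y] \in E : nat)).
  apply: eq_bigr => y _; rewrite -sum1_card.
  rewrite (eq_bigl (fun e => (e \in spokes S y) && (e \in E))); last by move=> e; rewrite inE andbC.
  rewrite big_mkcondr /= big_imset /=; last by move=> x x' _ _; apply: set2_injl.
  by apply: eq_bigr => x _; case: (_ \in E).
rewrite exchange_big; apply: eq_bigr => x _; rewrite -sum1_card big_mkcond [RHS]big_mkcond.
by apply: eq_bigr => y _; rewrite inE; case: (y \in Z); case: (_ \in E).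
Qed.

(** Private outer neighbours and the absence of [E2]-edges inside [U] leave an outer neighbour with
    its own endpoint and neighbours in [Z] only. This gives [switchable], with separation supplied
    by [misses]. Since the degrees match, s(a) - s(c) is the difference of the numbers of [E2]-edges
    from [A] and from [C] to [Z]. *)
Lemma quad_not_reconstructible E1 T F i j a b c d E2 U Z :
  quad_config E1 T F i j a b c d -> E2 \subset T -> quad_nbhd E1 F a b c d \subset U ->
  {in U &, forall x y, [set x; y] \notin E2} -> Z = ~: (F :|: U) ->
  trial Z (spokes (outer E1 F a :|: outer E1 F c)) (spokes (outer E1 F b :|: outer E1 F d)) E2 ->
  ~ reconstructible 2 (E1 :|: E2).
Proof.
move=> qc E2T QU indep ZE /and3P[/forall_inP mis oddAC oddBD].
have /= hu := qc_uniq qc; have [aF bF cF dF] := qc_F qc.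
set A := outer E1 F a in QU mis oddAC oddBD *; set B := outer E1 F b in QU mis oddAC oddBD *.
set C := outer E1 F c in QU mis oddAC oddBD *; set D := outer E1 F d in QU mis oddAC oddBD *.
pose E := E1 :|: E2; rewrite -/E.
have adjE x y : adj E x y = adj E1 x y || adj E2 x y.
  by rewrite /adj inE; case: (x != y).
have adj2F v y : v \in F -> adj E2 v y = false.
  move=> vF; apply/negP => /andP[_ /(subsetP E2T)/(qc_T qc)].
  by move/disjointFr/(_ (set21 v y)); rewrite vF.
have nbF v : v \in F -> nb E v = nb E1 v.
  by move=> vF; apply/setP => y; rewrite !inE adjE adj2F ?orbF.
have outF v x : x \in outer E1 F v -> x \notin F by rewrite inE => /andP[].
pose z x := [set y in Z | [set x; y] \in E2].
have nbO v x : v \in [:: a; b; c; d] -> x \in outer E1 F v -> x \in U -> nb E x = v |: z x.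
  move=> vq xv xU; apply/setP => y; rewrite [RHS]in_setU1 in_nb adjE.
  have -> : adj E1 x y = (y == v) by rewrite -in_nb (qc_private qc vq xv) inE.
  case: eqVneq => //= yv; rewrite inE ZE !inE negb_or /adj.
  case: (boolP ([set x; y] \in E2)) => xy2; rewrite ?andbF ?andbT //.
  have yF : y \notin F.
    have := qc_T qc (subsetP E2T _ xy2); move/disjointFr => /(_ y); rewrite set22 => h.
    by apply/negP; rewrite h.
  have yU : y \notin U by apply: contraTN xy2 => yU; apply: indep.
  by rewrite yF yU /=; apply: contraNneq yU => <-.
have QE x : (x \in quad_nbhd E1 F a b c d) = [|| x \in A, x \in B, x \in C | x \in D].
  by rewrite !inE -!orbA.
have nbQ v x : v \in [:: a; b; c; d] -> x \in outer E1 F v -> nb E x = v |: z x.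
  move=> vq xv; apply: nbO => //; apply: (subsetP QU); rewrite QE.
  by move: vq xv; rewrite !inE => /or4P[]/eqP-> ->; rewrite ?orbT.
have [aq bq cq dq] : [/\ a \in [:: a; b; c; d], b \in [:: a; b; c; d],
    c \in [:: a; b; c; d] & d \in [:: a; b; c; d]].
  by rewrite !inE !eqxx !orbT.
have splitF v w : nb E1 v :&: F = [set w] -> v \in F -> nb E v = w |: outer E1 F v.
  by move=> h vF; rewrite nbF // -[LHS](setID (nb E1 v) F) h.
have ha := splitF _ _ (qc_a qc) aF; have hb := splitF _ _ (qc_b qc) bF.
have hc := splitF _ _ (qc_c qc) cF; have hd := splitF _ _ (qc_d qc) dF.
have notQ v : v \in F -> v \notin A :|: B :|: C :|: D.
  move=> vF; rewrite !inE vF /=; by [].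
have zZ x y : y \in z x -> [/\ y \in Z, y \notin F & y \notin U].
  by rewrite inE => /andP[yZ _]; split=> //; move: yZ; rewrite ZE !inE negb_or => /andP[].
have own v w x : v \in [:: a; b; c; d] -> w \in [:: a; b; c; d] -> x \in outer E1 F v ->
    x \in outer E1 F w -> v = w.
  move=> vq wq xv xw; apply/set1P; rewrite -(qc_private qc wq xw) (qc_private qc vq xv).
  exact: set11.
move: hu; rewrite !inE !negb_or => /and4P[/and3P[ab ac ad] /andP[bc bd] cd _].
have nbvF v x y : v \in [:: a; b; c; d] -> x \in outer E1 F v -> adj E x y -> y = v \/ y \in z x.
  by move=> vq xv; rewrite -in_nb (nbQ v) // in_setU1 => /orP[/eqP|]; [left|right].
have qF v : v \in [:: a; b; c; d] -> v \in F by rewrite !inE => /or4P[]/eqP->.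
have sw : switchable E a b c d A B C D.
  split; rewrite ?(qc_uniq qc) ?ha ?hb ?hc ?hd //.
  - by split; apply: notQ.
  - rewrite -setI_eq0; apply/eqP/setP => x; rewrite [RHS]inE; apply/negP => /setIP[xA xC].
    by move: ac; rewrite (own a c x) ?eqxx.
  - rewrite -setI_eq0; apply/eqP/setP => x; rewrite [RHS]inE; apply/negP => /setIP[xA xC].
    by move: bd; rewrite (own b d x) ?eqxx.
  - by rewrite (qc_ia qc) (qc_ic qc).
  - by rewrite (qc_jb qc) (qc_jd qc).
  - move=> x y xQ yQ; apply/negP => xy.
    have [v vq xv] : exists2 v, v \in [:: a; b; c; d] & x \in outer E1 F v.
      move: xQ; rewrite !in_setU -!orbA => /or4P[] h; [exists a|exists b|exists c|exists d] => //.
    have [yv|/zZ[_ _]] := nbvF v x y vq xv xy.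
      by have := notQ _ (qF v vq); rewrite -yv yQ.
    by rewrite (subsetP QU) // QE; move: yQ; rewrite !in_setU -!orbA.
  move=> x x' xAC xBD y; apply/negP => /andP[xy]; rewrite adjC => x'y.
  have [v [vq vac xv]] : exists v, [/\ v \in [:: a; b; c; d], (v == a) || (v == c) & x \in outer E1 F v].
    by move: xAC; rewrite in_setU => /orP[] h; [exists a|exists c]; rewrite eqxx ?orbT.
  have [w [wq wbd xw]] : exists w, [/\ w \in [:: a; b; c; d], (w == b) || (w == d) & x' \in outer E1 F w].
    by move: xBD; rewrite in_setU => /orP[] h; [exists b|exists d]; rewrite eqxx ?orbT.
  (* A common neighbour [y] is an endpoint for both [x] and [x'], impossible since [v] and [w]
     differ; or an endpoint for one and in [Z] for the other, impossible since [Z] avoids [F]; or in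
     [Z] for both, which the trial excludes. *)
  have [yv|yz] := nbvF v x y vq xv xy.
    have [yw|/zZ[_ yF _]] := nbvF w x' y wq xw x'y; last by rewrite yv qF in yF.
    have vw : v = w by rewrite -yv -yw.
    move: wbd; rewrite -vw; case/orP: vac => /eqP->; first by rewrite (negbTE ab) (negbTE ad).
    by rewrite (eq_sym c b) (negbTE bc) (negbTE cd).
  have [yw|yz'] := nbvF w x' y wq xw x'y; first by have [_] := zZ _ _ yz; rewrite yw qF.
  have spoke (P : {set 'I_n}) u : u \in P -> y \in z u -> (E2 :&: spokes P y == set0) = false.
    move=> uP; rewrite inE => /andP[_ uy]; apply/negP => /eqP e.
    by have := in_set0 [set u; y]; rewrite -e in_setI uy (imset_f (fun x => [set x; y]) uP).
  by have [yZ _ _] := zZ _ _ yz; have := mis y yZ; rewrite /misses (spoke _ x) // (spoke _ x').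
have degO v x : v \in [:: a; b; c; d] -> x \in outer E1 F v -> #|nb E x| = (1 + #|z x|)%N.
  move=> vq xv; rewrite (nbQ v) // cardsU1; congr (_ + _)%N.
  by case: (boolP (v \in z x)) => // /zZ[_]; rewrite qF.
have nb_degE v w k : v \in [:: a; b; c; d] -> nb E v = w |: outer E1 F v -> w \in F ->
    #|nb E w| = k.+1 -> nb_deg E v = (k.+1 + (#|outer E1 F v| + \sum_(x in outer E1 F v) #|z x|))%N.
  move=> vq hv wF wk; rewrite /nb_deg hv big_setU1 /=; last by rewrite inE wF.
  rewrite wk; congr (_ + _)%N; rewrite (eq_bigr (fun x => 1 + #|z x|)%N) => [|x xv].
    by rewrite big_split /= sum1_card.
  exact: degO vq xv.
have degF v w : nb E v = w |: outer E1 F v -> w \in F -> #|nb E v| = #|outer E1 F v|.+1.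
  by move=> hv wF; rewrite hv cardsU1 inE wF.
have dA := degF _ _ ha bF; have dB := degF _ _ hb aF.
have dC := degF _ _ hc dF; have dD := degF _ _ hd cF.
(* Two equal numbers have an even sum. *)
have odd_neq (P Q : {set 'I_n}) : [disjoint P & Q] ->
    odd (\sum_(y in Z) #|E2 :&: spokes (P :|: Q) y|) ->
    \sum_(x in P) #|z x| != \sum_(x in Q) #|z x|.
  move=> PQ; rewrite sum_spokes (eq_bigl [predU P & Q]); last by move=> x; rewrite !inE.
  have -> : \sum_(x in [predU P & Q]) #|[set y in Z | [set x; y] \in E2]| =
      (\sum_(x in P) #|z x| + \sum_(x in Q) #|z x|)%N by apply: bigU.
  by apply: contraTneq => ->; rewrite addnn odd_double.
apply: (switchable_not_reconstructible sw).
  rewrite (nb_degE _ _ _ aq ha bF dB) (nb_degE _ _ _ cq hc dF dD).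
  rewrite (qc_ia qc) (qc_ic qc) (qc_jb qc) (qc_jd qc) !eqn_add2l.
  exact: odd_neq (sw_AC sw) oddAC.
rewrite (nb_degE _ _ _ bq hb aF dA) (nb_degE _ _ _ dq hd cF dC).
rewrite (qc_ia qc) (qc_ic qc) (qc_jb qc) (qc_jd qc) !eqn_add2l.
exact: odd_neq (sw_BD sw) oddBD.
Qed.

End Configuration.

Lemma card_pairs_inside n (T : graph n) (U : {set 'I_n}) : T \subset pairs n ->
  (#|[set e in T | e \subset U]| <= #|U| ^ 2)%N.
Proof.
move=> Tp; apply: leq_trans (_ : #|[set e : {set 'I_n} | e \subset U & #|e| == 2]| <= _)%N.
  apply/subset_leq_card/subsetP => e; rewrite !inE => /andP[eT ->] /=.
  by have := subsetP Tp _ eT; rewrite inE.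
rewrite cards_draws bin2 -divn2; apply: leq_trans (leq_div _ _) _.
by rewrite -mulnn leq_mul2l leq_pred orbT.
Qed.

Lemma prob_some_edge (R : realFieldType) n (p : R) (T S : graph n) : 0 <= p <= 1 ->
  S \subset T -> prob p T (fun E => [exists e in S, e \in E]) <= #|S|%:R * p.
Proof.
move=> p01 ST; apply: le_trans (@prob_exists R _ _ (mem S) p T (fun e E => e \in E) p01) _.
rewrite (eq_bigr (fun=> p)) ?sumr_const ?mulr_natl // => e eS.
by apply: expect_mem; apply: (subsetP ST).
Qed.

(** Taking for [U] the union of all the neighbourhoods gives every trial the same set [Z]. The price
    is the first error term, the chance of an edge inside [U]; the second is the chance that all K
    trials fail. *)
Lemma quads_not_reconstructible (R : realType) n (p : R) (E1 T : graph n) F i j K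
    (a b c d : 'I_K -> 'I_n) :
  let U := \bigcup_k quad_nbhd E1 F (a k) (b k) (c k) (d k) in
  let Z := ~: (F :|: U) in
  0 <= p <= 1 -> T \subset pairs n ->
  (forall k, quad_config E1 T F i j (a k) (b k) (c k) (d k)) ->
  (forall k k' v, v \in [:: a k; b k; c k; d k] -> v \in [:: a k'; b k'; c k'; d k'] -> k = k') ->
  (forall x y, x \in U -> y \in Z -> [set x; y] \in T) ->
  (0 < i)%N -> (0 < j)%N -> (i + i)%:R * p <= 4^-1 -> (j + j)%:R * p <= 4^-1 ->
  (1 - p) ^+ #|Z| <= 4^-1 ->
  prob p T (fun E2 => `[< reconstructible 2 (E1 :|: E2) >]) <=
    #|U|%:R ^+ 2 * p + (1 - (1 - (i + i)%:R * (j + j)%:R * p ^+ 2) ^+ #|Z| / 8) ^+ K.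
Proof.
move=> U Z p01 Tp qc inj hT i0 j0 ip jp pZ.
pose AC k := outer E1 F (a k) :|: outer E1 F (c k).
pose BD k := outer E1 F (b k) :|: outer E1 F (d k).
pose P k y := spokes (AC k) y; pose Q k y := spokes (BD k) y.
have UE k x : (x \in quad_nbhd E1 F (a k) (b k) (c k) (d k)) = (x \in AC k :|: BD k).
  by rewrite !in_setU -!orbA; congr (_ || _); rewrite orbCA.
have UK k : quad_nbhd E1 F (a k) (b k) (c k) (d k) \subset U.
  by rewrite /U (bigD1 k) //= subsetUl.
have ownP k x : x \in AC k :|: BD k ->
    exists v, [/\ v \in [:: a k; b k; c k; d k], x \in outer E1 F v & nb E1 x = [set v]].
  rewrite -UE !in_setU -!orbA => xq.
  have [v vq xv] : exists2 v, v \in [:: a k; b k; c k; d k] & x \in outer E1 F v.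
    by case/or4P: xq => h; [exists (a k)|exists (b k)|exists (c k)|exists (d k)];
      rewrite ?h // !inE eqxx ?orbT.
  by exists v; split=> //; apply: qc_private (qc k) _ _ vq xv.
have U_AB k x : x \in AC k :|: BD k -> x \in U.
  by rewrite -UE; apply: (subsetP (UK k)).
have ZU y : y \in Z -> y \notin U by rewrite !inE negb_or => /andP[].
have spokesU (A B : {set 'I_n}) y : spokes (A :|: B) y = spokes A y :|: spokes B y.
  exact: imsetU.
have cardS (A B : {set 'I_n}) y : [disjoint A & B] -> #|spokes (A :|: B) y| = (#|A| + #|B|)%N.
  move=> dAB; rewrite card_imset; last exact: set2_injl.
  by apply/eqP; rewrite eq_sym eq_sym leq_card_setU.
have own2 k v w x : v \in [:: a k; b k; c k; d k] -> w \in [:: a k; b k; c k; d k] ->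
    x \in outer E1 F v -> x \in outer E1 F w -> v = w.
  move=> vq wq xv xw; apply/set1P.
  by rewrite -(qc_private (qc k) wq xw) (qc_private (qc k) vq xv) set11.
have dis_out k v w : v \in [:: a k; b k; c k; d k] -> w \in [:: a k; b k; c k; d k] ->
    v != w -> [disjoint outer E1 F v & outer E1 F w].
  move=> vq wq vw; rewrite -setI_eq0; apply/eqP/setP => x; rewrite in_setI [RHS]inE.
  by apply/negP => /andP[xv xw]; move: vw; rewrite (own2 k v w x) ?eqxx.
have hq k : [/\ a k \in [:: a k; b k; c k; d k], b k \in [:: a k; b k; c k; d k],
    c k \in [:: a k; b k; c k; d k] & d k \in [:: a k; b k; c k; d k]].
  by rewrite !inE !eqxx !orbT.
have ne k : [/\ a k != c k, b k != d k & [&& a k != b k, a k != d k, c k != b k & c k != d k]].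
  have := qc_uniq (qc k); rewrite /= !inE !negb_or (eq_sym (c k) (b k)).
  by move=> /and4P[/and3P[-> -> ->] /andP[-> ->] -> _].
(* [U] and [Z] are disjoint, so a pair between them determines which end is which; disjointness of
   spokes reduces to that of the outer neighbourhoods. *)
have spoke_inj (S S' : {set 'I_n}) y y' : S \subset U -> S' \subset U -> y \in Z -> y' \in Z ->
    forall e, e \in spokes S y -> e \in spokes S' y' -> y = y' /\ exists2 x, x \in S & x \in S'.
  move=> SU S'U yZ y'Z e /imsetP[x xS ->] /imsetP[x' x'S] /eqP; rewrite eq_set2.
  case/orP => /andP[/eqP xx /eqP yy]; first by split=> //; exists x; rewrite // xx.
  by have := ZU _ y'Z; rewrite -xx (subsetP SU).
have ACU k : AC k \subset U by apply/subsetP => x xA; apply: (U_AB k); rewrite inE xA.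
have BDU k : BD k \subset U by apply/subsetP => x xA; apply: (U_AB k); rewrite inE xA orbT.
pose insideU (E2 : graph n) := [exists e in [set e in T | e \subset U], e \in E2].
apply: le_trans (_ : prob p T (fun E2 => insideU E2 || [forall k, ~~ trial Z (P k) (Q k) E2]) <= _).
  apply: le_prob => // E2 E2T /asboolP rec; apply/negPn/negP; rewrite negb_or.
  move=> /andP[/existsPn noU /forallPn[k]]; rewrite negbK => tk.
  apply: (quad_not_reconstructible (qc k) E2T (UK k) _ (erefl Z) tk) => //.
  move=> x y xU yU; apply/negP => xy; have := noU [set x; y].
  by rewrite inE xy (subsetP E2T) // subUset !sub1set xU yU.
apply: le_trans (probU _ _ _ p01) _; apply: lerD.
  apply: le_trans (prob_some_edge p01 _) _; first by apply/subsetP => e; rewrite inE => /andP[].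
  by rewrite ler_wpM2r //; [case/andP: p01|rewrite -natrX ler_nat card_pairs_inside].
apply: prob_no_trial => //; rewrite ?addn_gt0 ?i0 ?j0 //.
- move=> k y yZ; rewrite -spokesU; apply/subsetP => e /imsetP[x xU ->].
  by apply: hT => //; apply: U_AB xU.
- move=> k y yZ; rewrite -setI_eq0; apply/eqP/setP => e; rewrite in_setI [RHS]inE.
  apply/negP => /andP[eP eQ]; have [_ [x xAC xBD]] := spoke_inj _ _ _ _ (ACU k) (BDU k) yZ yZ e eP eQ.
  have [aq bq cq dq] := hq k; have [_ _ /and4P[n1 n2 n3 n4]] := ne k.
  move: xAC xBD; rewrite !in_setU => /orP[] x1 /orP[] x2.
  + by rewrite (own2 k _ _ x aq bq) ?eqxx in n1.
  + by rewrite (own2 k _ _ x aq dq) ?eqxx in n2.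
  + by rewrite (own2 k _ _ x cq bq) ?eqxx in n3.
  + by rewrite (own2 k _ _ x cq dq) ?eqxx in n4.
- move=> k y k' y' yZ y'Z kk; rewrite -!spokesU -setI_eq0; apply/eqP/setP => e.
  rewrite in_setI [RHS]inE; apply/negP => /andP[eP eQ].
  have S1 : AC k :|: BD k \subset U by rewrite subUset ACU BDU.
  have S2 : AC k' :|: BD k' \subset U by rewrite subUset ACU BDU.
  have [yy [x /ownP[v [vq xv nv]] /ownP[w [wq xw nw]]]] := spoke_inj _ _ _ _ S1 S2 yZ y'Z e eP eQ.
  have vw : v = w by apply/set1P; rewrite -nw nv set11.
  by move: kk; rewrite yy (inj k k' v) ?eqxx // vw.
- move=> k y _; have [aq _ cq _] := hq k; have [n1 _ _] := ne k.
  by rewrite cardS ?(qc_ia (qc k)) ?(qc_ic (qc k)) //; apply: dis_out aq cq n1.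
move=> k y _; have [_ bq _ dq] := hq k; have [_ n1 _] := ne k.
by rewrite cardS ?(qc_jb (qc k)) ?(qc_jd (qc k)) //; apply: dis_out bq dq n1.
Qed.

Lemma pigeonhole (T L : finType) (G : {set T}) (f : T -> L) k :
  (0 < k)%N -> (k * #|L| <= #|G|)%N -> (0 < #|L|)%N ->
  exists l, (k <= #|[set x in G | f x == l]|)%N.
Proof.
move=> k0 kG L0; apply/existsP; apply: contraTT kG => /existsPn small.
rewrite -ltnNge -sum1_card (partition_big f predT) //=.
apply: leq_ltn_trans (_ : \sum_(l : L) k.-1 < _)%N.
  apply: leq_sum => l _; rewrite -ltnS prednK // ltnNge.
  by apply: contra (small l); rewrite -sum1_card; under [in X in _ -> X]eq_bigl do rewrite inE.
by rewrite sum_nat_const mulnC ltn_mul2r L0 ltn_predL.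
Qed.

Lemma two_injections (T : finType) (C : {set T}) K : (K + K <= #|C|)%N ->
  exists e e' : 'I_K -> T, [/\ injective e, injective e', forall k k', e k != e' k' &
    forall k, e k \in C /\ e' k \in C].
Proof.
move=> h; exists (fun k => enum_val (widen_ord h (lshift K k))).
exists (fun k => enum_val (widen_ord h (rshift K k))); split.
- by move=> k k' /enum_val_inj/(congr1 val)/= /val_inj.
- by move=> k k' /enum_val_inj/(congr1 val)/= /addnI/val_inj.
- move=> k k'; apply/eqP => /enum_val_inj/(congr1 val)/= e.
  by have := ltn_ord k; rewrite e ltnNge leq_addr.
by move=> k; split; apply: enum_valP.
Qed.

(** * Second exposure: the edges leaving the endpoints of the isolated edges *)

Section Degrees.
Variables (R : realType) (n : nat).
Implicit Types (p : R) (E T : graph n) (F : {set 'I_n}) (v x y : 'I_n).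

Definition pairs_in F : graph n := [set e in pairs n | e \subset F].

(** [F0] is the initial vertex set and [F] the set of endpoints of the chosen isolated edges inside
    it. *)
Definition joins (F F0 : {set 'I_n}) : graph n := \bigcup_(v in F) spokes (~: F0) v.

Definition clash F F0 E v : bool :=
  [exists u : 'I_n * 'I_n, [&& u.1 \notin F0, u.2 \in F & u.2 != v] &&
     (([set u.1; v] \in E) && ([set u.1; u.2] \in E))].

(** The three clauses negate what a quad asks of an endpoint: private outer neighbours, at least one
    of them, and a number of them within [w] of its mean. *)
Definition bad_vertex p (w : nat) F F0 E v : bool :=
  [|| clash F F0 E v, E :&: spokes (~: F0) v == set0 |
    w%:R <= `|#|spokes (~: F0) v :&: E|%:R - #|spokes (~: F0) v|%:R * p|].

Lemma card_spokes (S : {set 'I_n}) v : #|spokes S v| = #|S|.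
Proof. by rewrite card_imset //; apply: set2_injl. Qed.

Lemma card_spokesI E (S : {set 'I_n}) v :
  #|spokes S v :&: E| = #|[set x in S | [set x; v] \in E]|.
Proof.
rewrite -(card_spokes _ v); apply: eq_card => e; rewrite in_setI.
apply/andP/imsetP => [[/imsetP[x xS ->] xE]|[x]]; first by exists x; rewrite // inE xS.
by rewrite inE => /andP[xS xE] ->; split=> //; apply: (imset_f (fun x => [set x; v]) xS).
Qed.

Lemma prob_clash p F F0 T v : 0 <= p <= 1 -> joins F F0 \subset T -> v \in F ->
  prob p T (clash F F0 ^~ v) <= #|~: F0|%:R * #|F|%:R * p ^+ 2.
Proof.
move=> p01 JT vF; have /andP[p0 p1] := p01.
have inT x u : x \notin F0 -> u \in F -> [set x; u] \in T.
  move=> xF uF; apply: (subsetP JT); apply/bigcupP; exists u => //.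
  by apply: (imset_f (fun x => [set x; u])); rewrite inE.
apply: le_trans (@prob_exists R _ _ (fun u : 'I_n * 'I_n => [&& u.1 \notin F0, u.2 \in F & u.2 != v])
  p T (fun u E => ([set u.1; v] \in E) && ([set u.1; u.2] \in E)) p01) _.
rewrite (eq_bigr (fun=> p ^+ 2)) => [|[x u] /and3P[/= xF uF uv]]; last first.
  transitivity (expect p T (fun E => ([set x; v] \in E)%:R * ([set x; u] \in E)%:R)).
    by apply: eq_expect => E _; rewrite -natrM mulnb.
  rewrite expect_mem2 ?inT // eq_set2 eqxx (eq_sym v) (negbTE uv) /=.
  by case: eqP => // xu; case: eqP => // vx; rewrite vx xu eqxx in uv.
rewrite sumr_const -[leLHS]mulr_natl ler_wpM2r ?sqr_ge0 // -natrM ler_nat -cardsX.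
by apply: subset_leq_card; apply/subsetP => -[x u]; rewrite !inE /= => /and3P[-> ->].
Qed.

Lemma prob_bad_vertex p (w : nat) F F0 T v : 0 <= p <= 1 -> (0 < w)%N -> joins F F0 \subset T ->
  v \in F -> prob p T (bad_vertex p w F F0 ^~ v) <=
    #|~: F0|%:R * #|F|%:R * p ^+ 2 + ((1 - p) ^+ #|~: F0| + #|~: F0|%:R * p / w%:R ^+ 2).
Proof.
move=> p01 w0 JT vF.
have ST : spokes (~: F0) v \subset T by apply: subset_trans JT; rewrite /joins (bigD1 v) //= subsetUl.
apply: le_trans (probU _ _ _ p01) _; apply: lerD; first exact: prob_clash.
apply: le_trans (probU _ _ _ p01) _; apply: lerD.
  have := @prob_pattern R _ p T set0 _ (sub0set T) ST.
  rewrite -setI_eq0 set0I eqxx cards0 expr0 mul1r card_spokes => /(_ isT) <-.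
  by apply: le_prob => // E _; rewrite sub0set -setI_eq0 setIC.
by rewrite -(card_spokes _ v); apply: prob_card_dev; rewrite ?ltr0n.
Qed.

End Degrees.

Lemma nat_window (R : realType) (m : R) (w : nat) : 0 <= m ->
  (* The window starts at [truncn m - w]; if this natural subtraction is cut off at 0, the window
     still reaches beyond m + w. *)
  exists lo : nat, forall c : nat, `|c%:R - m| < w%:R -> (lo <= c < lo + (2 * w).+1)%N.
Proof.
move=> m0; exists (Num.truncn m - w)%N => c; rewrite ltr_norml => /andP[h1 h2].
have /andP[t1 t2] := truncn_itv m0.
have c1 : (c < (Num.truncn m).+1 + w)%N by rewrite -(ltr_nat R) natrD; lra.
have c2 : (Num.truncn m < c + w)%N by rewrite -(ltr_nat R) natrD; lra.
by lia.
Qed.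

Section Matching.
Variables (R : realType) (n : nat).
Implicit Types (p : R) (E T : graph n) (F : {set 'I_n}) (v x y : 'I_n).

Record isolated_matching E F0 M (a b : 'I_M -> 'I_n) : Prop := IsolatedMatching {
  im_in : forall i, a i \in F0 /\ b i \in F0;
  im_a : forall i, nb E (a i) = [set b i];
  im_b : forall i, nb E (b i) = [set a i];
  im_inj : forall i j v, v \in [:: a i; b i] -> v \in [:: a j; b j] -> i = j }.

Definition endpoints M (a b : 'I_M -> 'I_n) : {set 'I_n} := \bigcup_i [set a i; b i].

(** Selecting a bad endpoint from every edge that has one is injective, since the edges are
    disjoint. *)
Lemma card_bad_edges p (w : nat) F0 E1 E M (a b : 'I_M -> 'I_n) : isolated_matching E1 F0 a b ->
  let F := endpoints a b in
  (M <= #|[set i | ~~ bad_vertex p w F F0 E (a i) && ~~ bad_vertex p w F F0 E (b i)]| +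
        #|[set v in F | bad_vertex p w F F0 E v]|)%N.
Proof.
move=> im; cbv zeta; set F := endpoints a b; rewrite -[leqLHS]card_ord -(cardsC [set i | ~~ bad_vertex p w F F0 E (a i) && ~~ bad_vertex p w F F0 E (b i)]).
rewrite leq_add2l; pose h i := if bad_vertex p w F F0 E (a i) then a i else b i.
have hi i : h i \in [:: a i; b i] by rewrite /h; case: ifP; rewrite !inE eqxx ?orbT.
rewrite -(card_imset _ (f := h)); last by move=> i j e; apply: (im_inj im (hi i)); rewrite e.
apply: subset_leq_card; apply/subsetP => v /imsetP[i]; rewrite !inE negb_and !negbK => bi ->.
apply/andP; split; first by apply/bigcupP; exists i => //; have := hi i; rewrite !inE.
by rewrite /h; move: bi; case: ifP => // ->.
Qed.

(** At most M/2 bad vertices leave at least M/2 edges with two good ends. Their pairs of outer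
    degrees take at most (2w+1)^2 values, so 2K edges share one value; these are grouped into K
    disjoint quads. *)
Lemma matching_quads p (w : nat) F0 E1 E2 M (a b : 'I_M -> 'I_n) (K D : nat) :
  isolated_matching E1 F0 a b ->
  let F := endpoints a b in
  0 <= p <= 1 -> E1 \subset pairs_in F0 -> E2 \subset joins F F0 -> (0 < K)%N ->
  (2 * ((K + K) * (2 * w).+1 ^ 2) <= M)%N ->
  #|~: F0|%:R * p + w%:R <= D%:R ->
  (2 * #|[set v in F | bad_vertex p w F F0 E2 v]| <= M)%N ->
  exists i j (e e' : 'I_K -> 'I_M), let E := E1 :|: E2 in let T := pairs n :\: pairs_in F0 :\: joins F F0 in
   [/\ (0 < i <= D)%N, (0 < j <= D)%N,
     forall k, quad_config E T F i j (a (e k)) (b (e k)) (a (e' k)) (b (e' k)),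
     forall k k' v, v \in [:: a (e k); b (e k); a (e' k); b (e' k)] ->
        v \in [:: a (e k'); b (e k'); a (e' k'); b (e' k')] -> k = k' &
     forall v, v \in F -> outer E F v \subset ~: F0].
Proof.
move=> im F p01 E1in E2in K0 MK Dw few.
have FF0 : F \subset F0.
  by apply/bigcupsP => i _; rewrite subUset !sub1set; apply/andP/(im_in im).
have joinP e : e \in joins F F0 -> exists v x, [/\ v \in F, x \notin F0 & e = [set x; v]].
  by move=> /bigcupP[v vF /imsetP[x]]; rewrite inE => xF ->; exists v, x.
have adj2 v y : v \in F -> adj E2 v y = (y \notin F0) && ([set y; v] \in E2).
  move=> vF; rewrite /adj setUC; case: (boolP ([set y; v] \in E2)) => [h|]; rewrite ?andbF // andbT.
  have [u [x [uF xF0 /eqP]]] := joinP _ (subsetP E2in _ h).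
  rewrite eq_set2 => /orP[]/andP[/eqP yx /eqP vu]; last by rewrite -vu (subsetP FF0) in xF0.
  by rewrite yx xF0 andbT; apply: contraNneq xF0 => <-; apply: (subsetP FF0).
have adj1F0 v y : adj E1 v y -> y \in F0.
  move=> /andP[_ /(subsetP E1in)]; rewrite inE => /andP[_ /subsetP]; apply; exact: set22.
pose N v := [set x in ~: F0 | [set x; v] \in E2].
pose E := E1 :|: E2.
have adjE v y : adj E v y = adj E1 v y || adj E2 v y by rewrite /adj inE; case: (v != y).
have nbE v : v \in F -> nb E v = nb E1 v :|: N v.
  by move=> vF; apply/setP => y; rewrite in_setU !in_nb adjE adj2 // !inE.
have NF v : N v :&: F = set0.
  apply/setP => x; rewrite !inE; apply/negP => /andP[/andP[xF0 _] /(subsetP FF0)].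
  by rewrite (negbTE xF0).
have nb1F v : nb E1 v \subset F0 by apply/subsetP => y; rewrite in_nb; apply: adj1F0.
have endF i v : v \in [:: a i; b i] -> v \in F.
  by move=> vi; apply/bigcupP; exists i => //; move: vi; rewrite !inE.
have mate i : [/\ nb E (a i) :&: F = [set b i], nb E (b i) :&: F = [set a i],
    outer E F (a i) = N (a i) & outer E F (b i) = N (b i)].
  have [aF bF] : a i \in F /\ b i \in F by split; apply: (endF i); rewrite !inE eqxx ?orbT.
  have ND v : N v :\: F = N v.
    by apply/setDidPl; rewrite -setI_eq0 NF.
  rewrite /outer !nbE // (im_a im) (im_b im) !setIUl !setDUl !NF !setU0 !ND.
  by split; rewrite ?(setIidPl _) ?sub1set // (_ : _ :\: F = set0) ?set0U //; apply/eqP;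
    rewrite setD_eq0 sub1set.
have outN v : v \in F -> outer E F v = N v.
  move=> /bigcupP[t _]; rewrite in_set2; have [_ _ oa ob] := mate t.
  by case/orP => /eqP->.
have cardN v : #|spokes (~: F0) v :&: E2| = #|N v| by apply: card_spokesI.
have m0 : 0 <= #|~: F0|%:R * p by have /andP[p0 _] := p01; rewrite mulr_ge0.
have [lo win] := nat_window w m0.
pose good v := ~~ bad_vertex p w F F0 E2 v.
have goodP v : good v -> [/\ ~~ clash F F0 E2 v, (0 < #|N v|)%N, (#|N v| <= D)%N &
    (lo <= #|N v| < lo + (2 * w).+1)%N].
  rewrite /good /bad_vertex !negb_or => /and3P[ncl ne]; rewrite -ltNge card_spokes cardN => dev.
  split=> //; last exact: win.
    by rewrite -cardN card_gt0 setIC.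
  by move: dev; rewrite ltr_norml -(ler_nat R) => /andP[]; lra.
pose G := [set i | good (a i) && good (b i)].
have MG := card_bad_edges p w E2 im; cbv zeta in MG; rewrite -/F -/G in MG.
have GK : ((K + K) * #|{: 'I_(2 * w).+1 * 'I_(2 * w).+1}| <= #|G|)%N.
  rewrite card_prod !card_ord mulnn -(leq_pmul2l (ltn0Sn 1)); apply: leq_trans MK _.
  move: MG few; set g := #|G|; set h := #|[set v in F | _]|; lia.
(* For good edges the shifted degrees fit the ordinal type, so [inord] loses nothing there. *)
pose f i : 'I_(2 * w).+1 * 'I_(2 * w).+1 := (inord (#|N (a i)| - lo), inord (#|N (b i)| - lo)).
have KK : (0 < K + K)%N by rewrite addn_gt0 K0.
have [|l cl] := pigeonhole f KK GK; first by rewrite card_prod !card_ord.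
have [e [e' [ie ie' ee' eC]]] := two_injections cl.
have [k0 _] : exists k : 'I_K, true by exists (Ordinal K0).
pose i := #|N (a (e k0))|; pose j := #|N (b (e k0))|.
have same t t' : t \in G -> t' \in G -> f t = f t' ->
    #|N (a t)| = #|N (a t')| /\ #|N (b t)| = #|N (b t')|.
  rewrite !inE => /andP[/goodP[_ _ _ w1] /goodP[_ _ _ w2]] /andP[/goodP[_ _ _ w3] /goodP[_ _ _ w4]].
  have iN u : (lo <= u < lo + (2 * w).+1)%N -> nat_of_ord (inord (u - lo) : 'I_(2 * w).+1) = (u - lo)%N.
    by move=> /andP[h1 h2]; rewrite inordK //; lia.
  move=> ff; have := congr1 (fun l => nat_of_ord l.1) ff; have := congr1 (fun l => nat_of_ord l.2) ff.
  rewrite /f /= !iN // => e1 e2.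
  move: w1 w2 w3 w4 => /andP[w1 _] /andP[w2 _] /andP[w3 _] /andP[w4 _].
  by rewrite -(subnK w1) e2 (subnK w3) -(subnK w2) e1 (subnK w4).
have inG k : [/\ e k \in G, e' k \in G, f (e k) = l & f (e' k) = l].
  by have := eC k; rewrite !inE => -[/andP[-> /eqP->] /andP[-> /eqP->]].
have [G0 _ f0 _] := inG k0.
have degs k : [/\ #|N (a (e k))| = i, #|N (b (e k))| = j, #|N (a (e' k))| = i & #|N (b (e' k))| = j].
  have [g g' fk fk'] := inG k.
  by have [-> ->] := same _ _ g G0 (etrans fk (esym f0)); have [-> ->] := same _ _ g' G0 (etrans fk' (esym f0)).
have goodq k v : v \in [:: a (e k); b (e k); a (e' k); b (e' k)] -> good v /\ v \in F.
  have [] := inG k; rewrite !in_set => /andP[g1 g2] /andP[g3 g4] _ _.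
  by rewrite !inE => /or4P[]/eqP->; split=> //; [apply: (endF (e k))|apply: (endF (e k))|
    apply: (endF (e' k))|apply: (endF (e' k))]; rewrite !inE eqxx ?orbT.
exists i, j, e, e'; split.
- have [] := goodq k0 (a (e k0)); first by rewrite !inE eqxx.
  by move=> /goodP[_ h1 h2 _] _; rewrite h1.
- have [] := goodq k0 (b (e k0)); first by rewrite !inE eqxx orbT.
  by move=> /goodP[_ h1 h2 _] _; rewrite h1.
- move=> k; have [ma mb oa ob] := mate (e k); have [ma' mb' oa' ob'] := mate (e' k).
  have [d1 d2 d3 d4] := degs k.
  have nself t : a t != b t.
    apply/negP => /eqP h; have := in_nb E1 (a t) (a t); rewrite (im_a im) adjxx h.
    by rewrite in_set1 eqxx.
  have ne2 t t' u v : t != t' -> u \in [:: a t; b t] -> v \in [:: a t'; b t'] -> u != v.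
    by move=> tt ut vt; apply: contraNneq tt => uv; rewrite (im_inj im ut (j := t')) // uv.
  have ine t : a t \in [:: a t; b t] by rewrite inE eqxx.
  have ine' t : b t \in [:: a t; b t] by rewrite !inE eqxx orbT.
  split; rewrite ?oa ?ob ?oa' ?ob' //.
  + rewrite subUset; apply/andP; split; first by apply: subset_trans E1in _; apply/subsetP => u; rewrite inE => /andP[].
    apply/subsetP => u /(subsetP E2in)/joinP[v [x [vF xF ->]]]; rewrite inE cards2.
    by rewrite (_ : x != v) //; apply: contraNneq xF => ->; apply: (subsetP FF0).
  + move=> u; rewrite !in_setD => /and3P[nj nin up]; rewrite -setI_eq0.
    apply/eqP/setP => v; rewrite in_setI [RHS]inE; apply/negP => /andP[vu vF].
    move: (up); rewrite inE => /cards2P[x [y [xy ue]]].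
    have [z uz] : exists z, u = [set z; v].
      move: vu; rewrite ue !inE => /orP[]/eqP->; [exists y; exact: setUC|by exists x].
    case: (boolP (z \in F0)) => zF.
      by move: nin; rewrite inE up uz subUset !sub1set zF (subsetP FF0).
    move/negP: nj; apply; apply/bigcupP; exists v => //; rewrite uz.
    by apply: (imset_f (fun x => [set x; v])); rewrite inE.
  + rewrite /= !inE !negb_or !nself !(ne2 _ _ _ _ (ee' k k)) // 1?eq_sym ?(ne2 _ _ _ _ (ee' k k)) //.
  + by split; apply: (proj2 (goodq k _ _)); rewrite !inE eqxx ?orbT.
  + move=> v x vq; have [gv vF] := goodq k v vq; rewrite outN // => xN.
    move: (xN); rewrite !inE => /andP[xF0 xvE].
    apply/setP => y; rewrite in_nb in_set1 adjE adjC.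
    have -> : adj E1 y x = false by apply: contraNF xF0; apply: adj1F0.
    apply/idP/eqP => [/andP[xy xyE]|->]; last first.
      by rewrite /adj xvE andbT; apply: contraNneq xF0 => ->; apply: (subsetP FF0).
    have [u [x' [uF x'F0 /eqP]]] := joinP _ (subsetP E2in _ xyE).
    rewrite eq_set2 => /orP[]/andP[/eqP xx /eqP yu]; last by rewrite xx (subsetP FF0) in xF0.
    have [/existsPn ncl _ _ _] := goodP _ gv.
    by have := ncl (x, u); rewrite /= xF0 uF xvE -yu xyE !andbT /= negbK => /eqP.
- move=> k k' v; have case2 m u : u \in [:: a (e m); b (e m); a (e' m); b (e' m)] ->
      exists2 t, (t == e m) || (t == e' m) & u \in [:: a t; b t].
    by rewrite !inE => /or4P[]/eqP->; [exists (e m)|exists (e m)|exists (e' m)|exists (e' m)];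
      rewrite ?eqxx ?orbT // !inE eqxx ?orbT.
  move=> /case2[t tk vt] /case2[t' tk' vt']; have tt := im_inj im vt vt'.
  move: tk tk'; rewrite -tt => /orP[]/eqP-> /orP[]/eqP.
  + exact: ie.
  + by move/eqP; rewrite (negbTE (ee' _ _)).
  + by move/eqP; rewrite eq_sym (negbTE (ee' _ _)).
  + exact: ie'.
by move=> v vF; rewrite outN //; apply/subsetP => x; rewrite inE => /andP[].
Qed.

End Matching.

Lemma card_bigcup_le (T : finType) M (A : 'I_M -> {set T}) c :
  (forall i, #|A i| <= c)%N -> (#|\bigcup_i A i| <= M * c)%N.
Proof.
move=> Ac; apply: leq_trans (_ : \sum_(i < M) c <= _)%N.
  apply: (big_ind2 (fun (A : {set T}) k => #|A| <= k)%N); rewrite ?cards0 // => B k C l Bk Cl.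
  by apply: leq_trans (leq_card_setU B C) _; apply: leq_add.
by rewrite sum_nat_const card_ord.
Qed.

Lemma eighth_ge0 (R : realFieldType) (u : R) : 0 <= u <= 1 -> 0 <= 1 - u / 8.
Proof. by move=> /andP[? ?]; lra. Qed.

(** * Assembling the second and third exposures *)

Section StageTwo.
Variables (R : realType) (n : nat).
Implicit Types (p : R) (E T : graph n) (F : {set 'I_n}) (v x y : 'I_n).

Lemma matching_not_reconstructible p F0 E1 M (a b : 'I_M -> 'I_n) (K w D : nat) :
  0 <= p <= 1 -> E1 \subset pairs_in F0 -> isolated_matching E1 F0 a b ->
  (0 < K)%N -> (0 < w)%N -> (2 * ((K + K) * (2 * w).+1 ^ 2) <= M)%N ->
  #|~: F0|%:R * p + w%:R <= D%:R -> (2 * D)%:R * p <= 4^-1 ->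
  (1 - p) ^+ (n - (2 * M + 4 * (K * D))) <= 4^-1 ->
  prob p (pairs n :\: pairs_in F0) (fun E2 => `[< reconstructible 2 (E1 :|: E2) >]) <=
    4 * (#|~: F0|%:R * (2 * M)%:R * p ^+ 2 +
         ((1 - p) ^+ #|~: F0| + #|~: F0|%:R * p / w%:R ^+ 2)) +
    ((4 * (K * D))%:R ^+ 2 * p + (1 - (1 - (2 * D)%:R ^+ 2 * p ^+ 2) ^+ n / 8) ^+ K).
Proof.
move=> p01 E1in im K0 w0 MK Dw Dp pn; have /andP[p0 p1] := p01.
pose F := endpoints a b.
have FF0 : F \subset F0.
  by apply/bigcupsP => i _; rewrite subUset !sub1set; apply/andP/(im_in im).
have cF : (#|F| <= 2 * M)%N by rewrite mulnC; apply: card_bigcup_le => i; rewrite cards2; case: (_ != _).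
have M0 : (0 < M)%N by apply: leq_trans MK; rewrite !muln_gt0 addn_gt0 K0 ?expn_gt0.
have JT : joins F F0 \subset pairs n :\: pairs_in F0.
  apply/bigcupsP => v vF; apply/subsetP => e /imsetP[x]; rewrite inE => xF0 ->.
  rewrite !inE cards2 (_ : x != v) /=; last first.
    by apply: contraNneq xF0 => ->; apply: (subsetP FF0).
  by rewrite andbT subUset sub1set (negbTE xF0).
have y1 : (2 * D)%:R ^+ 2 * p ^+ 2 <= 1.
  by rewrite -exprMn expr_le1 // ?mulr_ge0 //; apply: le_trans Dp _; rewrite invf_le1 ?ler1n.
have y0 : 0 <= (2 * D)%:R ^+ 2 * p ^+ 2 by rewrite mulr_ge0 ?sqr_ge0.
set s := 1 - (2 * D)%:R ^+ 2 * p ^+ 2.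
have s01 : 0 <= s <= 1 by rewrite /s; lra.
have sn : 0 <= s ^+ n <= 1 by have /andP[s0 s1] := s01; rewrite exprn_ge0 ?exprn_ile1.
apply: (prob_stage (B := fun E => (2 * #|[set v in F | bad_vertex p w F F0 E v]| <= M)%N) p01 JT).
(* At most 2M vertices are each bad with probability at most [eps]; Markov with threshold M/2 gives
   4 [eps]. *)
- apply: le_trans (prob_markov (X := fun E => #|[set v in F | bad_vertex p w F F0 E v]|%:R)
    (c := M%:R / 2) p01 _ _ _) _ => //; first by rewrite divr_gt0 ?ltr0n.
  + move=> E _; rewrite -ltnNge => h; rewrite ler_pdivrMr // -natrM ler_nat mulnC; exact: ltnW.
  rewrite invf_div mulrA ler_pdivrMr ?ltr0n //.
  set eps := (X in 4 * X); have eps0 : 0 <= eps.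
    by rewrite /eps !addr_ge0 ?mulr_ge0 ?invr_ge0 ?exprn_ge0 ?subr_ge0.
  have -> : 4 * eps * M%:R = ((2 * M)%:R * eps) * 2 by rewrite natrM; ring.
  rewrite ler_wpM2r //.
  rewrite (eq_expect p (g := fun E => \sum_(v in F) (bad_vertex p w F F0 E v)%:R)); last first.
    move=> E _; rewrite -sum1_card natr_sum big_mkcond [RHS]big_mkcond; apply: eq_bigr => v _.
    by rewrite inE; case: (v \in F); case: bad_vertex.
  rewrite expect_sum; apply: le_trans (_ : \sum_(v in F) eps <= _); last first.
    by rewrite sumr_const -[leLHS]mulr_natl ler_wpM2r // ler_nat.
  apply: ler_sum => v vF; apply: le_trans (prob_bad_vertex p01 w0 (subxx _) vF) _.
  by rewrite lerD2r ler_wpM2r ?sqr_ge0 // ler_wpM2l // ler_nat.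
- move=> E2 E2J few.
  have [i [j [e [e' [/andP[i0 iD] /andP[j0 jD] qc inj outs]]]]] :=
    matching_quads im p01 E1in E2J K0 MK Dw few.
  have := quads_not_reconstructible p01 _ qc inj _ i0 j0 _ _ _.
  set E := E1 :|: E2; set T := _ :\: joins F F0.
  set U := \bigcup_k quad_nbhd _ _ _ _ _ _; set Z := ~: (_ :|: U).
  have cU : (#|U| <= 4 * (K * D))%N.
    rewrite mulnC -mulnA; apply: card_bigcup_le => k.
    apply: leq_trans (leq_card_setU _ _) _; rewrite (qc_jd (qc k)).
    apply: leq_trans (leq_add (leq_card_setU _ _) (leqnn _)) _; rewrite (qc_ic (qc k)).
    apply: leq_trans (leq_add (leq_add (leq_card_setU _ _) (leqnn _)) (leqnn _)) _.
    by rewrite (qc_ia (qc k)) (qc_jb (qc k)) mulnC !mulSn mul0n addn0 -!addnA !leq_add.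
  have cZ : (n - (2 * M + 4 * (K * D)) <= #|Z|)%N.
    rewrite leq_subLR -[leqLHS]card_ord -(cardsC (F :|: U)) leq_add2r.
    exact: leq_trans (leq_card_setU F U) (leq_add cF cU).
  have Zn : (#|Z| <= n)%N by rewrite -[leqRHS]card_ord max_card.
  have small k : (k <= D)%N -> (k + k)%:R * p <= 4^-1.
    by move=> kD; apply: le_trans Dp; rewrite ler_wpM2r // ler_nat addnn -mul2n leq_mul2l.
  move=> h; apply: le_trans (_ : _ <= #|U|%:R ^+ 2 * p +
      (1 - (1 - (i + i)%:R * (j + j)%:R * p ^+ 2) ^+ #|Z| / 8) ^+ K) _.
    rewrite -/T (_ : prob p T _ = prob p T (fun E3 => `[< reconstructible 2 (E :|: E3) >])); last first.
      by apply: eq_expect => E3 _; rewrite setUA.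
    apply: h => //.
    + by apply: subset_trans (subsetDl _ _) (subsetDl _ _).
    + move=> x y /bigcupP[k _ xU]; rewrite /Z inE in_setU negb_or => /andP[yF yU].
      have xF0 : x \notin F0.
        have [aF bF cF' dF] := qc_F (qc k).
        have := outs _ aF; have := outs _ bF; have := outs _ cF'; have := outs _ dF.
        move=> /subsetP od /subsetP oc /subsetP ob /subsetP oa; rewrite -in_setC.
        by move: xU; rewrite !in_setU -!orbA => /or4P[/oa|/ob|/oc|/od].
      have xF : x \notin F by apply: contra xF0; apply: (subsetP FF0).
      rewrite !in_setD; apply/and3P; split.
      * apply/bigcupP => -[v vF /imsetP[x']]; rewrite inE => x'F0 /eqP.
        rewrite eq_set2 => /orP[/andP[_ /eqP yv]|/andP[/eqP xv _]].
          by rewrite yv vF in yF.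
        by rewrite xv vF in xF.
      * by rewrite inE subUset sub1set (negbTE xF0) /= andbF.
      rewrite inE cards2 (_ : x != y) //; apply: contraNneq yU => <-.
      by apply/bigcupP; exists k.
    + exact: small.
    + exact: small.
    by apply: le_trans pn; apply: ler_wiXn2l => //; rewrite ?subr_ge0 // gerBl.
  apply: lerD; first by rewrite ler_wpM2r // lerXn2r ?nnegrE // ler_nat.
  have ijD : (i + i)%:R * (j + j)%:R * p ^+ 2 <= (2 * D)%:R ^+ 2 * p ^+ 2.
    rewrite ler_wpM2r ?sqr_ge0 // -natrM -natrX ler_nat -mulnn !addnn -!mul2n.
    by rewrite leq_mul // leq_mul2l.
  have t0 : 0 <= (i + i)%:R * (j + j)%:R * p ^+ 2 by rewrite mulr_ge0 ?sqr_ge0 // mulr_ge0.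
  move: (_ * _ * p ^+ 2) ijD t0 => t ijD t0; have t1 := le_trans ijD y1.
  (* The bound must not depend on what was revealed: replacing the degrees by [D] and the size of
     [Z] by n only lowers the guaranteed chance of success. *)
  have le1 : s ^+ n <= (1 - t) ^+ #|Z|.
    apply: le_trans (_ : s ^+ #|Z| <= _); first by apply: ler_wiXn2l; case/andP: s01.
    by rewrite lerXn2r ?nnegrE ?subr_ge0 // /s lerD2l lerN2.
  have le2 : (1 - t) ^+ #|Z| <= 1 by apply: exprn_ile1; rewrite ?subr_ge0 // gerBl.
  have le0 : 0 <= (1 - t) ^+ #|Z| by rewrite exprn_ge0 // subr_ge0.
  by rewrite lerXn2r ?nnegrE ?eighth_ge0 ?le0 // lerD2l lerN2 ler_pM2r ?invr_gt0.
by rewrite addr_ge0 ?mulr_ge0 ?sqr_ge0 // exprn_ge0 // eighth_ge0.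
Qed.

End StageTwo.

(** * First exposure: isolated edges inside a small vertex set *)

Section StageOne.
Variables (R : realType) (n : nat).
Implicit Types (p : R) (E T : graph n) (F : {set 'I_n}) (v x y : 'I_n).

Definition isolated_edges E : graph n :=
  [set e in E | [forall e' in E, (e' != e) ==> [disjoint e & e']]].

Definition touching (E : graph n) : {set {set 'I_n} * {set 'I_n}} :=
  [set u | [&& u.1 \in E, u.2 \in E, u.2 != u.1 & ~~ [disjoint u.1 & u.2]]].

(** An edge that is not isolated is the first component of some touching pair. *)
Lemma card_isolated_edges E : (#|E| <= #|isolated_edges E| + #|touching E|)%N.
Proof.
apply: leq_trans (_ : #|isolated_edges E :|: (fst @: touching E)| <= _)%N; last first.
  by apply: leq_trans (leq_card_setU _ _) _; rewrite leq_add2l leq_imset_card.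
apply/subset_leq_card/subsetP => e eE; rewrite in_setU inE eE /=.
case: forallP => //= /forallP/forallPn[e']; rewrite !negb_imply => /and3P[e'E ne nd].
by apply/imsetP; exists (e, e') => //; rewrite inE /= eE e'E ne nd.
Qed.

Lemma isolated_edges_matching F0 E M : E \subset pairs_in F0 -> (M <= #|isolated_edges E|)%N ->
  exists a b : 'I_M -> 'I_n, isolated_matching E F0 a b.
Proof.
move=> EF h; pose e i := enum_val (widen_ord h i).
have eI i : e i \in isolated_edges E by apply: enum_valP.
have eE i : e i \in E by have := eI i; rewrite inE => /andP[].
have einj i j : e i = e j -> i = j by move=> /enum_val_inj/(congr1 val)/= /val_inj.
have iso i e' : e' \in E -> e' != e i -> [disjoint e i & e'].
  by have := eI i; rewrite inE => /andP[_ /forall_inP H] e'E ne; have := H e' e'E; rewrite ne.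
have [f fP] : exists f : 'I_M -> 'I_n * 'I_n, forall i, (f i).1 != (f i).2 /\ e i = [set (f i).1; (f i).2].
  apply: (fin_all_exists (P := fun i u => u.1 != u.2 /\ e i = [set u.1; u.2])) => i.
  have : #|e i| == 2 by have := subsetP EF _ (eE i); rewrite !inE => /andP[].
  by move=> /cards2P[x [y [xy ->]]]; exists (x, y).
have nbE i x y : x != y -> e i = [set x; y] -> nb E x = [set y].
  move=> xy ei; apply/setP => z; rewrite in_nb in_set1; apply/idP/eqP => [/andP[xz zE]|->]; last first.
    by rewrite /adj xy -ei eE.
  apply/eqP; apply: contraTT (zE) => zy; apply/negP => _.
  have ne : [set x; z] != e i.
    by rewrite ei eq_set2 eqxx (negbTE zy) /= negb_and (eq_sym z) xz orbT.
  by have := disjointFr (iso i _ zE ne); move=> /(_ x); rewrite ei !set21 => /(_ isT).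
exists (fun i => (f i).1), (fun i => (f i).2); split.
- move=> i; have := subsetP EF _ (eE i); rewrite !inE => /andP[_].
  by have [_ ->] := fP i; rewrite subUset !sub1set => /andP[].
- by move=> i; have [ne ei] := fP i; apply: (nbE i).
- by move=> i; have [ne ei] := fP i; apply: (nbE i); rewrite 1?eq_sym // setUC.
move=> i j v vi vj; apply: einj; apply/eqP; rewrite eq_sym; apply: contraT => ne.
have ev k : v \in [:: (f k).1; (f k).2] -> v \in e k by have [_ ->] := fP k; rewrite !inE.
by have := disjointFr (iso i _ (eE j) ne) (ev i vi); rewrite ev.
Qed.

Lemma card_touching F : (#|touching (pairs_in F)| <= #|pairs_in F| * (2 * #|F|))%N.
Proof.
apply: leq_trans (_ : \sum_(e in pairs_in F) 2 * #|F| <= _)%N; last by rewrite sum_nat_const.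
rewrite -sum1_card (partition_big fst (mem (pairs_in F))) /=; last by move=> u; rewrite !inE => /andP[].
apply: leq_sum => e; rewrite inE => /andP[]; rewrite inE => /cards2P[x [y [xy ->]]] eF.
rewrite sum1_card.
apply: leq_trans (_ : #|pair [set x; y] @: (spokes F x :|: spokes F y)| <= _)%N.
  apply/subset_leq_card/subsetP => -[u1 u2]; rewrite unfold_in /= => /andP[uT /eqP /= u1E].
  move: uT; rewrite in_set /= => /and4P[_ u2p _]; rewrite {}u1E.
  rewrite -setI_eq0 => /set0Pn[z /setIP[zxy zu]].
  apply/imsetP; exists u2 => //; move: u2p; rewrite !inE => /andP[/cards2P[s [t [st u2E]]] u2F].
  have key v : v \in u2 -> u2 \in spokes F v.
    move=> vu; move: u2F; rewrite u2E subUset !sub1set => /andP[sF tF].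
    move: vu; rewrite u2E !inE => /orP[]/eqP->.
      by rewrite setUC; apply: (imset_f (fun x => [set x; s])).
    by apply: (imset_f (fun x => [set x; t])).
  by move: zxy; rewrite in_set2 => /orP[]/eqP zz; rewrite zz in zu; rewrite ?in_setU (key _ zu) ?orbT.
apply: leq_trans (leq_imset_card _ _) _; apply: leq_trans (leq_card_setU _ _) _.
by rewrite !card_spokes mul2n -addnn.
Qed.

(** With mean mu, Chebyshev gives more than mu/2 edges and Markov fewer than mu/4 touching pairs,
    which leaves mu/4 >= M isolated edges. *)
Lemma prob_few_isolated p F0 M : 0 < p <= 1 -> 0 < #|pairs_in F0|%:R * p ->
  4 * M%:R <= #|pairs_in F0|%:R * p ->
  prob p (pairs_in F0) (fun E => ~~ (M <= #|isolated_edges E|)%N) <=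
    4 / (#|pairs_in F0|%:R * p) + 8 * (#|F0|%:R * p).
Proof.
move=> /andP[p0 p1] N0 M4; set mu := #|pairs_in F0|%:R * p in N0 M4 *.
have p01 : 0 <= p <= 1 by rewrite ltW.
apply: le_trans (_ : prob p (pairs_in F0) (fun E =>
   (mu / 2 <= `|#|pairs_in F0 :&: E|%:R - mu|) || (mu / 4 <= #|touching E|%:R)) <= _).
  apply: le_prob => // E ES; rewrite -ltnNge => few; apply: contraT; rewrite negb_or -!ltNge.
  rewrite (setIidPr ES) ltr_norml => /andP[/andP[h1 _] h2].
  have := card_isolated_edges E; rewrite -(ler_nat R) natrD => h3.
  have : #|isolated_edges E|%:R < M%:R :> R by rewrite ltr_nat.
  lra.
apply: le_trans (probU _ _ _ p01) _; apply: lerD.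
  apply: le_trans (prob_card_dev p01 (subxx _) _) _; first by rewrite divr_gt0.
  by rewrite -/mu le_eqVlt; apply/orP; left; apply/eqP; field; lra.
apply: le_trans (prob_markov (X := fun E => #|touching E|%:R) (c := mu / 4) p01 _ _ _) _ => //.
  by rewrite divr_gt0.
rewrite ler_pdivrMr ?divr_gt0 //.
have -> : 8 * (#|F0|%:R * p) * (mu / 4) = (#|pairs_in F0| * (2 * #|F0|))%:R * p ^+ 2.
  by rewrite /mu !natrM; field.
rewrite (eq_expect p (g := fun E => \sum_(u in touching (pairs_in F0)) (u.1 \in E)%:R * (u.2 \in E)%:R)).
  rewrite expect_sum (eq_bigr (fun=> p ^+ 2)) => [|[u1 u2]].
    by rewrite sumr_const -[leLHS]mulr_natl ler_wpM2r ?sqr_ge0 // ler_nat card_touching.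
  by rewrite in_set /= => /and4P[u1S u2S ne _]; rewrite expect_mem2 // eq_sym (negbTE ne).
move=> E ES; rewrite -sum1_card natr_sum big_mkcond [RHS]big_mkcond; apply: eq_bigr => -[u1 u2] _.
rewrite !in_set /= -natrM mulnb.
case: (boolP (u1 \in E)) => [u1E|]; case: (boolP (u2 \in E)) => [u2E|]; rewrite ?andbF //=;
  try by case: ifP.
by have := subsetP ES _ u1E; have := subsetP ES _ u2E; rewrite !inE => -> ->.
Qed.

Lemma prob_reconstructible_le p F0 (M K w D : nat) : 0 < p <= 1 ->
  0 < #|pairs_in F0|%:R * p -> 4 * M%:R <= #|pairs_in F0|%:R * p ->
  (0 < K)%N -> (0 < w)%N -> (2 * ((K + K) * (2 * w).+1 ^ 2) <= M)%N ->
  #|~: F0|%:R * p + w%:R <= D%:R -> (2 * D)%:R * p <= 4^-1 ->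
  (1 - p) ^+ (n - (2 * M + 4 * (K * D))) <= 4^-1 ->
  prob p (pairs n) (fun E => `[< reconstructible 2 E >]) <=
    4 / (#|pairs_in F0|%:R * p) + 8 * (#|F0|%:R * p) +
    (4 * (#|~: F0|%:R * (2 * M)%:R * p ^+ 2 +
         ((1 - p) ^+ #|~: F0| + #|~: F0|%:R * p / w%:R ^+ 2)) +
    ((4 * (K * D))%:R ^+ 2 * p + (1 - (1 - (2 * D)%:R ^+ 2 * p ^+ 2) ^+ n / 8) ^+ K)).
Proof.
move=> p01' N0 M4 K0 w0 MK Dw Dp pn; have p01 : 0 <= p <= 1 by case/andP: p01' => /ltW->.
have sub : pairs_in F0 \subset pairs n by apply/subsetP => e; rewrite inE => /andP[].
apply: (prob_stage (B := fun E => (M <= #|isolated_edges E|)%N) p01 sub).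
- exact: prob_few_isolated.
- move=> E1 E1S h; have [a [b im]] := isolated_edges_matching E1S h.
  exact: matching_not_reconstructible im K0 w0 MK Dw Dp pn.
have y1 : (2 * D)%:R ^+ 2 * p ^+ 2 <= 1.
  have /andP[p0 _] := p01; rewrite -exprMn expr_le1 ?mulr_ge0 //.
  by apply: le_trans Dp _; rewrite invf_le1 ?ler1n.
have y0 : 0 <= (2 * D)%:R ^+ 2 * p ^+ 2 by rewrite mulr_ge0 ?sqr_ge0.
have s0 : 0 <= 1 - (2 * D)%:R ^+ 2 * p ^+ 2 by rewrite subr_ge0.
have /andP[p0 p1] := p01.
rewrite !addr_ge0 ?mulr_ge0 ?invr_ge0 ?sqr_ge0 ?addr_ge0 ?mulr_ge0 ?exprn_ge0 ?invr_ge0 ?sqr_ge0 ?subr_ge0 //.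
rewrite ler_pdivrMr // mul1r; apply: le_trans (_ : 1 <= 8); last by rewrite ler1n.
by apply: exprn_ile1 => //; rewrite gerBl.
Qed.

End StageOne.

(** * The sparse case: two path components *)

Section Paths.
Variable n : nat.
Implicit Types (E : graph n) (x y : 'I_n).

Record path_component E v0 v1 v2 v3 v4 : Prop := PathComponent {
  pc0 : nb E v0 = [set v1]; pc1 : nb E v1 = [set v0; v2]; pc2 : nb E v2 = [set v1; v3];
  pc3 : nb E v3 = [set v2; v4]; pc4 : nb E v4 = [set v3] }.

(* Switching v1 v2 and w2 w3 produces a path on four and a path on six vertices. *)
Lemma two_paths_not_reconstructible E v0 v1 v2 v3 v4 w0 w1 w2 w3 w4 :
  path_component E v0 v1 v2 v3 v4 -> path_component E w0 w1 w2 w3 w4 ->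
  uniq [:: v0; v1; v2; v3; v4; w0; w1; w2; w3; w4] -> ~ reconstructible 2 E.
Proof.
move=> [p0 p1 p2 p3 p4] [q0 q1 q2 q3 q4] hu.
(* Addressing the ten vertices by position makes every required inequality an instance of [uniq]: v0
   to v4 are positions 0 to 4 and w0 to w4 are 5 to 9. *)
have ne i j : (i < j < 10)%N -> nth v0 [:: v0; v1; v2; v3; v4; w0; w1; w2; w3; w4] i !=
    nth v0 [:: v0; v1; v2; v3; v4; w0; w1; w2; w3; w4] j.
  by move=> /andP[ij j10]; rewrite nth_uniq ?(ltn_trans ij) // neq_ltn ij.
have neC i j : (i < j < 10)%N -> nth v0 [:: v0; v1; v2; v3; v4; w0; w1; w2; w3; w4] j !=
    nth v0 [:: v0; v1; v2; v3; v4; w0; w1; w2; w3; w4] i.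
  by move=> /ne; rewrite eq_sym.
have sw : switchable E v1 v2 w2 w3 [set v0] [set v3] [set w1] [set w4].
  split; rewrite ?cards1 //.
  - by rewrite p1 setUC.
  - by rewrite q2 setUC.
  - by rewrite /= !inE !negb_or (ne 1 2) // (ne 1 7) // (ne 1 8) // (ne 2 7) // (ne 2 8) // (ne 7 8).
  - by split; rewrite !inE !negb_or ?(neC 0 1) ?(ne 1 3) ?(ne 1 6) ?(ne 1 9)
      ?(neC 0 2) ?(ne 2 3) ?(ne 2 6) ?(ne 2 9) ?(neC 0 7) ?(neC 3 7) ?(neC 6 7) ?(ne 7 9)
      ?(neC 0 8) ?(neC 3 8) ?(neC 6 8) ?(ne 8 9).
  - by rewrite disjoints1 inE (ne 0 6).
  - by rewrite disjoints1 inE (ne 3 9).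
  - move=> x y; rewrite !inE -!orbA => /or4P[]/eqP-> yU; rewrite -in_nb ?p0 ?p3 ?q1 ?q4 !inE ?negb_or;
      case/or4P: yU => /eqP->;
      rewrite ?(ne 0 1) ?(neC 1 3) ?(neC 1 6) ?(neC 1 9) ?(ne 0 2) ?(neC 2 3) ?(neC 2 6) ?(neC 2 9)
        ?(ne 0 4) ?(ne 3 4) ?(neC 4 6) ?(neC 4 9) ?(ne 0 5) ?(ne 3 5) ?(neC 5 6) ?(neC 5 9)
        ?(ne 0 7) ?(ne 3 7) ?(ne 6 7) ?(neC 7 9) ?(ne 0 8) ?(ne 3 8) ?(ne 6 8) ?(neC 8 9) //.
  move=> x z; rewrite in_set2 in_set2 => xx zz y; apply/negP; rewrite (adjC _ y z) -!in_nb.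
  case/orP: xx => /eqP->; case/orP: zz => /eqP->; rewrite ?p0 ?q1 ?p3 ?q4 ?in_set1 ?in_set2.
  - by case/andP => /eqP-> ; rewrite (negbTE (ne 1 2 isT)) (negbTE (ne 1 4 isT)).
  - by case/andP => /eqP->; rewrite (negbTE (ne 1 8 isT)).
  - case/andP => /orP[]/eqP->; rewrite ?(negbTE (neC 2 5 isT)) ?(negbTE (neC 4 5 isT)) //.
    by rewrite (negbTE (neC 2 7 isT)) (negbTE (neC 4 7 isT)).
  - by case/andP => /orP[]/eqP->; rewrite ?(negbTE (ne 5 8 isT)) ?(negbTE (ne 7 8 isT)).
have d1 x y : nb E x = [set y] -> #|nb E x| = 1%N by move=> ->; rewrite cards1.
have d2 x y z : y != z -> nb E x = [set y; z] -> #|nb E x| = 2%N by move=> yz ->; rewrite cards2 yz.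
have e2 x y z : y != z -> nb E x = [set y; z] -> nb_deg E x = (#|nb E y| + #|nb E z|)%N.
  by move=> yz h; rewrite /nb_deg h big_setU1 ?inE // big_set1.
have D0 := d1 _ _ p0; have D1 := d2 _ _ _ (ne 0 2 isT) p1; have D2 := d2 _ _ _ (ne 1 3 isT) p2.
have D3 := d2 _ _ _ (ne 2 4 isT) p3; have Q4 := d1 _ _ q4.
have Q1 := d2 _ _ _ (ne 5 7 isT) q1; have Q2 := d2 _ _ _ (ne 6 8 isT) q2.
have Q3 := d2 _ _ _ (ne 7 9 isT) q3.
(* Here s(v1) = 1 + 2 and s(w2) = 2 + 2, while s(v2) = 2 + 2 and s(w3) = 2 + 1. Cutting the second
   path at w2 w3, not at its mirror image, is what makes both pairs differ. *)
apply: (switchable_not_reconstructible sw).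
  by rewrite (e2 _ _ _ (ne 0 2 isT) p1) (e2 _ _ _ (ne 6 8 isT) q2) D0 D2 Q1 Q3.
by rewrite (e2 _ _ _ (ne 1 3 isT) p2) (e2 _ _ _ (ne 7 9 isT) q3) D1 D3 Q2 Q4.
Qed.

End Paths.

(** The threshold is one because two components are needed. As mu >= 2, a count of at most one
    deviates from mu by at least mu/2, and the variance is at most mu + (C - 1) mu^2. *)
Lemma second_moment (R : realFieldType) (I J : finType) (p : R) (T : {set I})
    (A : J -> pred {set I}) (C : R) :
  0 <= p <= 1 -> 1 <= C ->
  (forall j k, j != k -> prob p T (fun E => A j E && A k E) <= C * (prob p T (A j) * prob p T (A k))) ->
  let mu := \sum_j prob p T (A j) in 2 <= mu ->
  prob p T (fun E => (#|[set j | A j E]| <= 1)%N) <= 4 / mu + 4 * (C - 1).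
Proof.
move=> p01 C1 AC mu mu2.
pose X E : R := \sum_j (A j E)%:R.
have XE E : #|[set j | A j E]|%:R = X E.
  rewrite -sum1_card natr_sum big_mkcond; apply: eq_bigr => j _.
  by rewrite inE; case: (A j E).
have EX : expect p T X = mu by rewrite expect_sum.
have EX2 : expect p T (fun E => X E * X E) <= mu + C * mu ^+ 2.
  rewrite (eq_expect p (g := fun E => \sum_j \sum_k (A j E)%:R * (A k E)%:R)); last first.
    by move=> E _; rewrite /X mulr_suml; apply: eq_bigr => j _; rewrite mulr_sumr.
  rewrite expect_sum expr2 {2}/mu mulr_suml mulr_sumr -big_split /=.
  apply: ler_sum => j _; rewrite expect_sum (bigD1 j) //=.
  apply: lerD.
    by rewrite le_eqVlt; apply/orP; left; apply/eqP/eq_expect => E _; case: (A j E); rewrite ?mulr1 ?mulr0.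
  rewrite mulr_sumr mulr_sumr [leRHS](bigD1 j) //= -[leLHS]add0r; apply: lerD.
    by rewrite mulr_ge0 ?mulr_ge0 ?prob_ge0 //; apply: le_trans C1.
  apply: ler_sum => k kj; rewrite (eq_expect p (g := fun E => (A j E && A k E)%:R)).
    by apply: AC; rewrite eq_sym.
  by move=> E _; rewrite -natrM mulnb.
apply: le_trans (prob_markov (X := fun E => (X E - mu) ^+ 2) (c := (mu / 2) ^+ 2) p01 _ _ _) _.
- by rewrite exprn_gt0 //; lra.
- by move=> E _; apply: sqr_ge0.
- move=> E _; rewrite -(ler_nat R) XE => X1; rewrite -[leRHS]sqrrN opprB lerXn2r ?nnegrE //; lra.
rewrite ler_pdivrMr ?exprn_gt0 //; last by lra.
rewrite (eq_expect p (g := fun E => X E * X E + ((- 2 * mu) * X E + mu ^+ 2))); last first.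
  by move=> E _; ring.
rewrite !expectD expectZ expect_const EX.
have -> : (4 / mu + 4 * (C - 1)) * (mu / 2) ^+ 2 = mu + (C - 1) * mu ^+ 2 by field; lra.
by move: EX2; rewrite expr2; nra.
Qed.

(** * Counting path components on five vertices *)

Section PathCount.
Variables (R : realType) (n q : nat) (phi : 'I_5 -> 'I_q -> 'I_n).
Hypothesis phi_inj : forall i j s s', phi i s = phi j s' -> i = j /\ s = s'.
Implicit Types (E : graph n) (t : {ffun 'I_5 -> 'I_q}).

(** The i-th vertex comes from the i-th of five disjoint blocks: the vertices are distinct
    automatically and no path is counted in both directions, at the cost of a constant factor in the
    mean. *)
Definition pv t i := phi i (t i).
Definition pvs t : {set 'I_n} := [set pv t i | i : 'I_5].
Definition pnext (k : 'I_4) : 'I_5 := lift ord0 k.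
Definition pprev (k : 'I_4) : 'I_5 := widen_ord (leqnSn 4) k.
Definition ppath t : graph n := [set [set pv t (pprev k); pv t (pnext k)] | k : 'I_4].
Definition phit t : graph n := [set e in pairs n | ~~ [disjoint e & pvs t]].
(** A component is a pattern of prescribed present and absent pairs, so its probability is exact by
    [prob_pattern]. *)
Definition pcomp t E := (ppath t \subset E) && [disjoint phit t :\: ppath t & E].

Lemma pv_inj t t' i j : pv t i = pv t' j -> i = j /\ t i = t' j.
Proof. exact: phi_inj. Qed.

Lemma ppath_pairs t e : e \in ppath t -> e \in pairs n /\ e \subset pvs t.
Proof.
move=> /imsetP[k _ ->]; rewrite inE cards2 (_ : pv _ _ != pv _ _); last first.
  by apply/eqP => /pv_inj[/(congr1 val)]; rewrite /= /bump /= => /eqP; rewrite -[X in X == _]addn0 addnC eqn_add2r.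
by split=> //; rewrite subUset !sub1set !imset_f.
Qed.

Lemma ppath_hit t : ppath t \subset phit t.
Proof.
apply/subsetP => e ep; have [e2 es] := ppath_pairs ep; rewrite inE e2 /=.
have : e != set0 by move: e2; rewrite inE -card_gt0 => /eqP->.
by apply: contraNN => /disjoint_setI0; rewrite (setIidPl es) => ->.
Qed.

Lemma card_ppath t : #|ppath t| = 4%N.
Proof.
rewrite card_imset ?card_ord // => k l /eqP; rewrite eq_set2 => /orP[]/andP[/eqP /pv_inj[+ _] /eqP/pv_inj[+ _]].
  by move=> /(congr1 val)/= /val_inj.
by move=> /(congr1 val) /= + /(congr1 val) /=; rewrite /bump /=; lia.
Qed.

Lemma card_phit t : (#|phit t| <= 5 * n)%N.
Proof.
apply: leq_trans (_ : #|(fun u : 'I_n * 'I_n => [set u.1; u.2]) @: setX (pvs t) setT| <= _)%N.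
  apply/subset_leq_card/subsetP => e; rewrite !inE => /andP[/cards2P[x [y [xy ->]]]].
  rewrite -setI_eq0 => /set0Pn[z /setIP[]]; rewrite in_set2 => /orP[]/eqP-> zv; apply/imsetP.
    by exists (x, y); rewrite // !inE zv.
  by exists (y, x); rewrite ?inE ?zv //= setUC.
apply: leq_trans (leq_imset_card _ _) _; rewrite cardsX cardsT card_ord leq_mul2r.
by rewrite (leq_trans (leq_imset_card _ _)) ?orbT // card_ord.
Qed.

(** An edge of the first path that meets the second must belong to the second, whose other incident
    pairs are absent. Agreement at one block therefore spreads to the adjacent blocks. *)
Lemma pcomp_meet t t' E : pcomp t E -> pcomp t' E -> ~~ [disjoint pvs t & pvs t'] -> t = t'.
Proof.
move=> /andP[pE _] /andP[_ dE] meet.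
have key k : t (pprev k) = t' (pprev k) \/ t (pnext k) = t' (pnext k) ->
    t (pprev k) = t' (pprev k) /\ t (pnext k) = t' (pnext k).
  move=> h; set e := [set pv t (pprev k); pv t (pnext k)].
  have ep : e \in ppath t by apply: imset_f.
  have eE := subsetP pE _ ep; have [e2 _] := ppath_pairs ep.
  have eh : e \in phit t'.
    rewrite inE e2 /=; apply/negP => /disjointFr ed.
    case: h => h.
      by have := ed (pv t (pprev k)); rewrite set21 /pv h imset_f // => /(_ isT).
    by have := ed (pv t (pnext k)); rewrite set22 /pv h imset_f // => /(_ isT).
  have ep' : e \in ppath t'.
    apply: contraT => nep; have := disjointFr dE (x := e); rewrite inE nep eh eE.
    by move=> /(_ isT).
  have [_ /subsetP es] := ppath_pairs ep'.
  have [/imsetP[i _ /pv_inj[<- ->]] /imsetP[j _ /pv_inj[<- ->]]] := (es _ (set21 _ _), es _ (set22 _ _)).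
  by [].
have [i ti] : exists i, t i = t' i.
  move: meet; rewrite -setI_eq0 => /set0Pn[x /setIP[/imsetP[i _ ->] /imsetP[j _ /pv_inj[ij tt]]]].
  by exists i; rewrite {2}ij.
(* The spread runs in both directions along the path, so all [P k] are equivalent to [P 0], and the
   common vertex provides one of them. *)
pose P (k : nat) := forall h : (k < 5)%N, t (Ordinal h) = t' (Ordinal h).
have step k : (k < 4)%N -> P k <-> P k.+1.
  move=> k4; have := key (Ordinal k4).
  have -> : pprev (Ordinal k4) = Ordinal (leqW k4) by apply: val_inj.
  have -> : pnext (Ordinal k4) = Ordinal (k4 : (k.+1 < 5)%N) by apply: val_inj.
  move=> kk; split=> Pk h.
    by rewrite (bool_irrelevance h k4); have [] := kk (or_introl (Pk _)).
  by rewrite (bool_irrelevance h (leqW k4)); have [] := kk (or_intror (Pk _)).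
have all0 k : (k < 5)%N -> P k <-> P 0%N.
  elim: k => [//|k IH] k5; exact: iff_trans (iff_sym (step k k5)) (IH (ltnW k5)).
have P0 : P 0%N.
  apply: (all0 i (ltn_ord i)).1 => h; have -> : Ordinal h = i by apply: val_inj.
  exact: ti.
apply/ffunP => j; have := (all0 j (ltn_ord j)).2 P0 (ltn_ord j).
by have -> : Ordinal (ltn_ord j) = j by apply: val_inj.
Qed.


Lemma pcomp_path t E : E \subset pairs n -> pcomp t E ->
  path_component E (pv t (inord 0)) (pv t (inord 1)) (pv t (inord 2)) (pv t (inord 3)) (pv t (inord 4)).
Proof.
move=> Ep /andP[pE dE].
have path_in e : e \in E -> ~~ [disjoint e & pvs t] -> e \in ppath t.
  move=> eE h; apply: contraT => nep; have := disjointFr dE (x := e).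
  by rewrite in_setD nep inE (subsetP Ep) // h eE => /(_ isT).
have nbE i y : adj E (pv t i) y = [exists j : 'I_5, ((j.+1 == i) || (i.+1 == j)) && (y == pv t j)].
  apply/idP/existsP => [/andP[xy e]|[j /andP[ij /eqP->]]].
    have /imsetP[k _ /eqP] : [set pv t i; y] \in ppath t.
      apply: path_in => //; apply/negP => /disjointFr/(_ (set21 _ _)).
      by rewrite imset_f.
    rewrite eq_set2 => /orP[]/andP[/eqP/pv_inj[-> _] /eqP ->].
      by exists (pnext k); rewrite eqxx /= /bump /= add1n eqxx orbT.
    by exists (pprev k); rewrite eqxx /= /bump /= add1n eqxx.
  apply/andP; split; first by apply/eqP => /pv_inj[e _]; rewrite e in ij; lia.
  apply: (subsetP pE).
  have in_path (u v : 'I_5) : u.+1 = v -> [set pv t u; pv t v] \in ppath t.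
    move=> uv; have u4 : (u < 4)%N by have := ltn_ord v; rewrite -uv.
    apply/imsetP; exists (Ordinal u4) => //; congr [set pv t _; pv t _]; apply: val_inj => //=.
  by case/orP: ij => /eqP ij; [rewrite setUC|]; apply: in_path.
have val5 k : (k < 5)%N -> nat_of_ord (inord k : 'I_5) = k by move=> k5; rewrite inordK.
have nb1 i j : (i < 5)%N -> (j < 5)%N ->
    (forall l, (l < 5)%N -> (l.+1 == i) || (i.+1 == l) = (l == j)) ->
    nb E (pv t (inord i)) = [set pv t (inord j)].
  move=> i5 j5 h; apply/setP => y; rewrite in_nb nbE in_set1 val5 //.
  apply/existsP/eqP => [[l]|->]; last by exists (inord j); rewrite val5 // h // !eqxx.
  by rewrite h // => /andP[/eqP <- /eqP->]; rewrite inord_val.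
have nb2 i j k : (i < 5)%N -> (j < 5)%N -> (k < 5)%N ->
    (forall l, (l < 5)%N -> (l.+1 == i) || (i.+1 == l) = (l == j) || (l == k)) ->
    nb E (pv t (inord i)) = [set pv t (inord j); pv t (inord k)].
  move=> i5 j5 k5 h; apply/setP => y; rewrite in_nb nbE in_set2 val5 //.
  apply/existsP/orP => [[l]|[]/eqP->].
  - by rewrite h // => /andP[/orP[]/eqP <- /eqP->]; rewrite inord_val eqxx; [left|right].
  - by exists (inord j); rewrite val5 // h // !eqxx.
  - by exists (inord k); rewrite val5 // h // !eqxx orbT.
by split; [apply: nb1|apply: nb2|apply: nb2|apply: nb2|apply: nb1] => // -[|[|[|[|[|l]]]]].
Qed.

Lemma pcomp_two t t' E : E \subset pairs n -> t != t' -> pcomp t E -> pcomp t' E ->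
  ~ reconstructible 2 E.
Proof.
move=> Ep tt pt pt'.
have dis : [disjoint pvs t & pvs t'] by apply: contraT => /(pcomp_meet pt pt') e; rewrite e eqxx in tt.
apply: two_paths_not_reconstructible (pcomp_path Ep pt) (pcomp_path Ep pt') _.
pose s := [seq pv u (inord k : 'I_5) | u <- [:: t; t'], k <- iota 0 5].
rewrite (_ : [:: _; _; _; _; _; _; _; _; _; _] = s) //.
apply: allpairs_uniq => //; first by rewrite /= inE tt.
move=> [u k] [u' k'] /allpairsP hx /allpairsP hy /= e; move: e.
case: hx => -[x y] [/= xu yk [-> ->]]; case: hy => -[x' y'] [/= xu' yk' [-> ->]] e.
have [/(congr1 val) /= ke _] := pv_inj e.
have lt5 (z : nat) : z \in [:: 0; 1; 2; 3; 4]%N -> (z < 5)%N by case: z => [|[|[|[|[|z]]]]].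
move: ke (lt5 _ yk) (lt5 _ yk') => + y5 y5'; rewrite !inordK // => <-; congr (_, _).
move: xu xu'; rewrite !in_cons !in_nil !orbF => /orP[]/eqP xu /orP[]/eqP xu'; rewrite xu xu' //.
  by have := disjointFr dis (x := pv x (inord y)); rewrite {2}e xu xu' !imset_f // => /(_ isT).
by have := disjointFr dis (x := pv x' (inord y')); rewrite -{2}e xu xu' !imset_f // => /(_ isT).
Qed.

Lemma prob_pcomp (p : R) t :
  prob p (pairs n) (pcomp t) = p ^+ 4 * (1 - p) ^+ #|phit t :\: ppath t|.
Proof.
rewrite -(card_ppath t); apply: prob_pattern.
- by apply/subsetP => e /ppath_pairs[].
- by apply/subsetP => e; rewrite !inE => /andP[_ /andP[]].
by rewrite disjoint_sym disjoints_subset; apply/subsetP => e; rewrite inE => /andP[h _]; rewrite inE.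
Qed.

(** Paths that share a vertex cannot both be components. Disjoint ones are correlated only through
    pairs prescribed absent by both, and each of these joins one path to the other: at most 5 times
    5 of them. *)
Lemma prob_pcomp2 (p : R) t t' : 0 <= p < 1 -> t != t' ->
  prob p (pairs n) (fun E => pcomp t E && pcomp t' E) <=
  (1 - p) ^- 25 * (prob p (pairs n) (pcomp t) * prob p (pairs n) (pcomp t')).
Proof.
move=> /andP[p0 p1] tt; have p01 : 0 <= p <= 1 by rewrite p0 ltW.
have q0 : 0 < 1 - p by rewrite subr_gt0.
case: (boolP [disjoint pvs t & pvs t']) => [dis|meet]; last first.
  rewrite (_ : prob _ _ _ = expect p (pairs n) (fun=> 0)).
    by rewrite expect_const !mulr_ge0 ?invr_ge0 ?exprn_ge0 ?prob_ge0 // ltW.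
  apply: eq_expect => E _; case: (boolP (pcomp t E)) => //= pt.
  by case: (boolP (pcomp t' E)) => //= pt'; rewrite (pcomp_meet pt pt' meet) eqxx in tt.
have hitno u u' e : [disjoint pvs u & pvs u'] -> e \in ppath u -> e \notin phit u'.
  by move=> d /ppath_pairs[_ es]; rewrite inE negb_and negbK (disjointWl es d) orbT.
have dis' : [disjoint pvs t' & pvs t] by rewrite disjoint_sym.
pose S := ppath t :|: ppath t'; pose S' := (phit t :\: ppath t) :|: (phit t' :\: ppath t').
have dSS : [disjoint S & S'].
  rewrite -setI_eq0; apply/eqP/setP => e; rewrite in_setI [RHS]inE; apply/negP => /andP[].
  rewrite !in_setU !in_setD => /orP[] h /orP[]/andP[h1 h2].
  - by rewrite h in h1.
  - by rewrite (negbTE (hitno _ _ _ dis h)) in h2.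
  - by rewrite (negbTE (hitno _ _ _ dis' h)) in h2.
  - by rewrite h in h1.
have cS : #|S| = 8%N.
  rewrite cardsU !card_ppath (_ : ppath t :&: ppath t' = set0) ?cards0 //.
  apply/setP => e; rewrite in_setI [RHS]inE; apply/negP => /andP[h /(subsetP (ppath_hit t'))].
  by rewrite (negbTE (hitno _ _ _ dis h)).
have cI : (#|(phit t :\: ppath t) :&: (phit t' :\: ppath t')| <= 25)%N.
  apply: leq_trans (_ : #|(fun u : 'I_n * 'I_n => [set u.1; u.2]) @: setX (pvs t) (pvs t')| <= _)%N.
    apply/subset_leq_card/subsetP => e; rewrite in_setI !in_setD => /andP[/andP[_ h] /andP[_ h']].
    move: h h'; rewrite !inE => /andP[/cards2P[x [y [xy ->]]] h] /andP[_ h'].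
    have meetE v : ~~ [disjoint [set x; y] & pvs v] -> (x \in pvs v) || (y \in pvs v).
      by rewrite -setI_eq0 => /set0Pn[z /setIP[]]; rewrite in_set2 => /orP[]/eqP-> ->; rewrite ?orbT.
    have nboth z : z \in pvs t -> z \in pvs t' -> False.
      by move=> z1 z2; have := disjointFr dis z1; rewrite z2.
    apply/imsetP; case/orP: (meetE _ h) => a; case/orP: (meetE _ h') => b.
    + by case: (nboth x).
    + by exists (x, y); rewrite // inE /= a b.
    + by exists (y, x); rewrite ?inE /= ?a ?b //= setUC.
    + by case: (nboth y).
  apply: leq_trans (leq_imset_card _ _) _; rewrite cardsX (_ : 25 = 5 * 5)%N //.
  by apply: leq_mul; rewrite (leq_trans (leq_imset_card _ _)) // card_ord.
apply: le_trans (_ : prob p (pairs n) (fun E => (S \subset E) && [disjoint S' & E]) <= _).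
  apply: le_prob => // E _ /andP[/andP[a b] /andP[c d]].
  rewrite subUset a c /= -setI_eq0 setIUl (disjoint_setI0 b) (disjoint_setI0 d) setU0.
  exact: eqxx.
have Sp : S \subset pairs n by apply/subsetP => e; rewrite inE => /orP[]/ppath_pairs[].
have S'p : S' \subset pairs n.
  by apply/subsetP => e; rewrite !inE => /orP[]/andP[_ /andP[]].
rewrite prob_pattern // !prob_pcomp cS.
have -> : forall a b : nat, (1 - p) ^- 25 * (p ^+ 4 * (1 - p) ^+ a * (p ^+ 4 * (1 - p) ^+ b)) =
    p ^+ 8 * ((1 - p) ^+ (a + b) / (1 - p) ^+ 25).
  move=> a b; have gen (c x u v : R) : c * (x * u * (x * v)) = x * x * (u * v * c) by ring.
  by rewrite gen -!exprD.
rewrite ler_wpM2l ?exprn_ge0 // ler_pdivlMr ?exprn_gt0 // -exprD.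
apply: ler_wiXn2l; [exact: ltW|by rewrite gerBl|].
by rewrite -cardsUI leq_add2l.
Qed.

Lemma prob_reconstructible_sparse (p : R) : 0 <= p < 1 ->
  let mu := q%:R ^+ 5 * p ^+ 4 * (1 - p) ^+ (5 * n) in 2 <= mu ->
  prob p (pairs n) (fun E => `[< reconstructible 2 E >]) <= 4 / mu + 4 * ((1 - p) ^- 25 - 1).
Proof.
move=> p01' mu mu2; have /andP[p0 p1] := p01'.
have p01 : 0 <= p <= 1 by rewrite p0 ltW.
have q0 : 0 < 1 - p by rewrite subr_gt0.
have C1 : 1 <= (1 - p) ^- 25.
  rewrite -[leLHS]invr1 lef_pV2 ?posrE ?exprn_gt0 //.
  by apply: exprn_ile1; [exact: ltW|rewrite gerBl].
pose m := \sum_t prob p (pairs n) (pcomp t).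
have mum : mu <= m.
  apply: le_trans (_ : \sum_(t : {ffun 'I_5 -> 'I_q}) p ^+ 4 * (1 - p) ^+ (5 * n) <= _).
    by rewrite sumr_const card_ffun !card_ord -[leRHS]mulr_natl natrX /mu mulrA.
  apply: ler_sum => t _; rewrite prob_pcomp ler_wpM2l ?exprn_ge0 //.
  apply: ler_wiXn2l; [exact: ltW|by rewrite gerBl|].
  by apply: leq_trans (card_phit t); apply/subset_leq_card/subsetDl.
apply: le_trans (_ : 4 / m + 4 * ((1 - p) ^- 25 - 1) <= _); last first.
  by rewrite lerD2r ler_wpM2l // lef_pV2 ?posrE //; lra.
have m2 : 2 <= m by apply: le_trans mum.
apply: le_trans (second_moment (A := fun t => pcomp t) p01 C1 _ m2); last first.
  by move=> t t' tt; apply: prob_pcomp2.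
apply: le_prob => // E Ep /asboolP rec; rewrite leqNgt; apply/negP => /card_gt1P[t [t' [pt pt' tt]]].
by move: pt pt'; rewrite !inE => pt pt'; apply: (pcomp_two Ep tt pt pt').
Qed.

End PathCount.

(** * Numerical estimates for the dense case *)

Section Estimates.
Variable R : realType.
Implicit Types (x c p : R).

Lemma onem_exp_le p k : 0 <= p <= 1 -> (1 - p) ^+ k <= expR (- (k%:R * p)).
Proof.
move=> /andP[p0 p1]; rewrite -mulrN expRM_natl lerXn2r ?nnegrE ?expR_ge0 ?subr_ge0 //.
exact: expR_ge1Dx.
Qed.

(** The hypothesis on c gives (1 - x)(1 + c x) >= 1, and 1 + c x <= exp(c x). *)
Lemma onem_exp_ge c x k : 0 <= x < 1 -> 1 <= c * (1 - x) ->
  expR (- (c * (k%:R * x))) <= (1 - x) ^+ k.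
Proof.
move=> /andP[x0 x1] cx; rewrite mulrCA -mulrN expRM_natl lerXn2r ?nnegrE ?expR_ge0 //; first by lra.
have h : 1 <= (1 - x) * expR (c * x).
  apply: le_trans (_ : (1 - x) * (1 + c * x) <= _); first by nra.
  by rewrite ler_wpM2l ?expR_ge1Dx //; lra.
by rewrite expRN -[leLHS]mul1r ler_pdivrMr ?expR_gt0.
Qed.

Lemma expRN_le_inv x : 0 < x -> expR (- x) <= x^-1.
Proof.
move=> x0; rewrite expRN lef_pV2 ?posrE ?expR_gt0 //.
by apply: le_trans (expR_ge1Dx x); rewrite lerDr.
Qed.

Lemma truncn_ge_half x : 1 <= x -> x / 2 <= (Num.truncn x)%:R <= x.
Proof.
move=> x1; have x0 : 0 <= x by lra.
have /andP[h1 h2] := truncn_itv x0; rewrite h1 andbT.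
have h3 : (1 <= Num.truncn x)%N by rewrite truncn_gt0.
move: h2; rewrite -natr1 => h2; have : (1 : R) <= (Num.truncn x)%:R by rewrite ler1n.
lra.
Qed.

Lemma card_pairs_in n (F : {set 'I_n}) : #|pairs_in F| = 'C(#|F|, 2).
Proof.
rewrite -cards_draws; apply: eq_card => e; rewrite !inE andbC; by [].
Qed.

Lemma card_pairs_in_ge n (F : {set 'I_n}) : (2 <= #|F|)%N ->
  #|F|%:R ^+ 2 / 4 <= #|pairs_in F|%:R :> R.
Proof.
move=> F2; rewrite card_pairs_in bin2; have : (#|F| ^ 2 <= 4 * (#|F| * #|F|.-1)./2)%N.
  have := odd_double_half (#|F| * #|F|.-1); have : odd (#|F| * #|F|.-1) = false.
    by case: #|F| F2 => // k _; rewrite oddM /= andbC; case: (odd k).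
  move=> -> /=; rewrite -mul2n -mulnn; move: (_./2) => h.
  by move: F2; case: #|F| => [|[|k]] // _ /=; nia.
rewrite -(ler_nat R) natrX natrM; lra.
Qed.


(** The cross term of the square is split by 5 (y/5 - 3s)^2 >= 0. The coefficient 6/5 of the main
    term is part of the slack between 4/81 and 1/10. *)
Lemma dense_window (y l d : R) : 1 <= y -> 0 <= l -> d <= y + 3 * Num.sqrt (y * l) -> 0 <= d ->
  d ^+ 2 <= 6 / 5 * y ^+ 2 + 54 * (y * l).
Proof.
move=> y1 l0 dy d0; have yl : 0 <= y * l by rewrite mulr_ge0 //; lra.
rewrite -(sqr_sqrtr yl); have s0 := sqrtr_ge0 (y * l).
move: (Num.sqrt (y * l)) s0 dy => s s0 dy.
apply: le_trans (_ : (y + 3 * s) ^+ 2 <= _); first by rewrite lerXn2r ?nnegrE //; lra.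
by have := sqr_ge0 (y / 5 - 3 * s); nra.
Qed.

(* Here [t] is n^(1/100) and [l] is ln n.  The initial vertex set has size t^56 and there
   are t^10 trials, each successful with probability at least of order t^(-8). *)
Lemma dense_bound n p (t l : R) :
  10 ^+ 5 <= t -> n%:R = t ^+ 100 -> 20 <= l -> l <= t -> expR (l / 100) = t -> 0 < p ->
  l <= 20 * (n%:R * p) -> 81 * (n%:R * p) ^+ 4 <= n%:R * l ->
  prob p (pairs n) (fun E => `[< reconstructible 2 E >]) <=
    (64 + 8 + 4 * 288 + 4 + 52 ^+ 2 + 16 * expR 2) / t + 4 / l.
Proof.
move=> t5 nt l20 lt et p0 ly y4; set y := n%:R * p in ly y4.
have t1 : 1 <= t by apply: le_trans t5; rewrite -natrX ler1n.
have t0 : 0 < t by lra.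
have tp k : 0 < t ^+ k by rewrite exprn_gt0.
have tle i j : (i <= j)%N -> t ^+ i <= t ^+ j by move=> ij; rewrite ler_weXn2l.
have y1 : 1 <= y by lra.
have y0 : 0 <= y by lra.
(* From y^4 <= n l <= t^101 <= t^104. From here on error terms are compared by their exponents of
   t. *)
have y26 : y <= t ^+ 26.
  have h : y ^+ 4 <= (t ^+ 26) ^+ 4.
    have : y ^+ 4 <= 81 * y ^+ 4 by rewrite ler_peMl ?exprn_ge0 ?ler1n //; lra.
    move=> /le_trans; apply; apply: le_trans y4 _; rewrite nt -exprM.
    by apply: le_trans (_ : t ^+ 100 * t <= _); [rewrite ler_pM2l|rewrite -exprSr tle].
  by move: h; rewrite ler_pXn2r ?nnegrE ?(ltW (tp _)).
have yk k : y ^+ k <= t ^+ (26 * k) by rewrite exprM lerXn2r ?nnegrE ?(ltW (tp _)).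
have pE : p = y / t ^+ 100 by rewrite /y nt mulrAC mulfV ?mul1r // lt0r_neq0.
have tinv k : (k <= 99)%N -> t ^+ k / t ^+ 100 <= t^-1.
  by move=> k99; rewrite ler_pdivrMr // mulrC ler_pdivlMr // -exprSr tle.
have p74 : p <= t^-1.
  by rewrite pE; apply: le_trans (tinv 26%N isT); rewrite ler_pM2r ?invr_gt0.
have tV1 : t^-1 <= 10^-1.
  rewrite lef_pV2 ?posrE //; apply: le_trans t5; rewrite -natrX ler_nat //.
have p01 : 0 < p <= 1 by rewrite p0 /=; lra.
have p01' : 0 <= p <= 1 by rewrite ltW //=; lra.
(* The mean number of edges inside the initial set is at least y t^12 / 16, beyond the multiple of y
   t^11 required by the pigeonhole, while m p <= t^(-18) keeps those edges mostly isolated. *)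
pose m := Num.truncn (t ^+ 56); pose K := Num.truncn (t ^+ 10).
have /andP[m1 m2] : t ^+ 56 / 2 <= m%:R <= t ^+ 56 by apply/truncn_ge_half/exprn_ege1.
have /andP[K1 K2] : t ^+ 10 / 2 <= K%:R <= t ^+ 10 by apply/truncn_ge_half/exprn_ege1.
have l0 : 0 <= l by apply: le_trans l20.
have l0' : 0 < l by apply: lt_le_trans l20.
have y0' : 0 < y by apply: lt_le_trans y1.
have yl0 : 0 <= y * l by apply: mulr_ge0.
(* The deviation allowed for a degree: it exceeds the standard deviation, at most the square root of
   y, by the factor sqrt(l), so Chebyshev costs 1/l. *)
pose s := Num.sqrt (y * l).
have s0 : 0 <= s by apply: sqrtr_ge0.
have s2 : s ^+ 2 = y * l by apply: sqr_sqrtr.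
have s1 : 1 <= s by rewrite -(ler_pXn2r (n := 2)) ?nnegrE // expr1n s2; move: y1 l20; clear; nra.
have y5 : 0 <= 5 * y by apply: mulr_ge0.
have s5 : s <= 5 * y.
  by rewrite -(ler_pXn2r (n := 2)) ?nnegrE // s2; move: y1 ly; clear; nra.
pose w := (Num.truncn s).+1.
have /andP[w1 w2] : s <= w%:R <= s + 1.
  by have /andP[h1 h2] := truncn_itv s0; rewrite ltW //= /w -natr1 lerD2r.
pose D := (Num.truncn (y + w%:R)).+1.
have /andP[D1 D2] : y + w%:R <= D%:R <= y + w%:R + 1.
  have h : 0 <= y + w%:R by apply: addr_ge0.
  by have /andP[h1 h2] := truncn_itv h; rewrite ltW //= /D -natr1 lerD2r.
have D13 : D%:R <= 13 * y by move: D2 w2 s5 s1 y1; clear; lra.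
have D0 : 0 <= D%:R :> R by [].
have Dw3 : D%:R <= y + 3 * s by move: D2 w2 s1; clear; lra.
pose M := (2 * ((K + K) * (2 * w).+1 ^ 2))%N.
have wsq : ((2 * w).+1 ^ 2)%:R <= 36 * (y * l).
  rewrite natrX -s2 -natr1 natrM; apply: le_trans (_ : (6 * s) ^+ 2 <= _).
    by rewrite lerXn2r ?nnegrE ?addr_ge0 ?mulr_ge0 //; move: w2 s1; clear; lra.
  by rewrite exprMn -natrX ler_wpM2r ?sqr_ge0 // ler_nat.
have MR : M%:R <= 144 * (y * t ^+ 11).
  rewrite /M; move: ((2 * w).+1 ^ 2)%N wsq => W wsq; rewrite !natrM natrD.
  apply: le_trans (_ : 2 * ((t ^+ 10 + t ^+ 10) * (36 * (y * t))) <= _).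
    rewrite ler_wpM2l //; apply: ler_pM; [by rewrite addr_ge0|by []|by apply: lerD|].
    by apply: le_trans wsq _; rewrite ler_wpM2l // ler_wpM2l.
  by rewrite le_eqVlt; apply/orP; left; apply/eqP; ring.
have mn : (m <= n)%N by rewrite -(ler_nat R) nt; apply: le_trans m2 (tle _ _ _).
pose F0 : {set 'I_n} := [set widen_ord mn i | i : 'I_m].
have cF0 : #|F0| = m by rewrite card_imset ?card_ord // => i j /(congr1 val) /= /val_inj.
have cC : (#|~: F0| + m = n)%N by rewrite -cF0 addnC cardsC card_ord.
have cCn : #|~: F0|%:R <= n%:R :> R by rewrite ler_nat -[leqRHS]cC leq_addr.
have half : t ^+ 56 <= n%:R / 2.
  rewrite nt (_ : 100 = 56 + 44)%N // exprD -mulrA ler_peMr ?(ltW (tp _)) //.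
  by have := tle 1%N 44%N isT; rewrite expr1; move: t5; clear; lra.
have cCh : n%:R / 2 <= #|~: F0|%:R :> R.
  have h : #|~: F0|%:R + m%:R = n%:R :> R by rewrite -natrD cC.
  by move: h half m2; clear; lra.
have mge2 : (2 <= m)%N.
  rewrite -(ler_nat R); apply: le_trans m1; have := tle 1%N 56%N isT; rewrite expr1; move: t5; clear; lra.
have N1 : y * t ^+ 12 / 16 <= #|pairs_in F0|%:R * p.
  apply: le_trans (_ : (m%:R ^+ 2 / 4) * p <= _); last first.
    have := @card_pairs_in_ge n F0; rewrite cF0 => /(_ mge2) h.
    by rewrite ler_wpM2r // ltW.
  rewrite [in leRHS]pE (_ : y * t ^+ 12 / 16 = ((t ^+ 56 / 2) ^+ 2 / 4) * (y / t ^+ 100)).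
    apply: ler_wpM2r; first by rewrite divr_ge0 // ltW.
    rewrite ler_pM2r ?invr_gt0 //; apply: lerXn2r => //; rewrite nnegrE.
      by rewrite divr_ge0 // ltW.
    exact: ler0n.
  by field; rewrite lt0r_neq0.
have t11 : 0 <= y * t ^+ 11 by rewrite mulr_ge0 // ltW.
have t12E : y * t ^+ 12 = (y * t ^+ 11) * t by rewrite -mulrA -exprSr.
have M4 : 4 * M%:R <= #|pairs_in F0|%:R * p.
  apply: le_trans N1; apply: le_trans (_ : 576 * (y * t ^+ 11) <= _); first by move: MR; clear; lra.
  by rewrite t12E; move: t11 t5; clear; nra.
have t12 : t <= y * t ^+ 12.
  rewrite t12E ler_peMl //; first exact: ltW.
  by rewrite -[leLHS]mulr1 ler_pM // exprn_ege1.
have N0 : 0 < #|pairs_in F0|%:R * p by move: N1 t12 t0; clear; lra.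
have K0 : (0 < K)%N by rewrite truncn_gt0 exprn_ege1.
have Dw : #|~: F0|%:R * p + w%:R <= D%:R.
  apply: le_trans D1; rewrite lerD2r; apply: ler_wpM2r => //; exact: ltW.
have tV : 0 < t^-1 by rewrite invr_gt0.
have tV5 : t^-1 <= (10 ^+ 5)^-1 by rewrite lef_pV2 ?posrE // exprn_gt0.
have Dp0 : (2 * D)%:R * p <= 26 * t^-1.
  rewrite natrM pE; apply: le_trans (_ : 2 * (13 * y) * (y / t ^+ 100) <= _).
    by apply: ler_wpM2r; [rewrite divr_ge0 // ltW|rewrite ler_wpM2l].
  rewrite (_ : _ * _ = 26 * (y ^+ 2 / t ^+ 100)); last by ring.
  rewrite ler_wpM2l //; apply: le_trans (tinv 52%N isT).
  by rewrite ler_pM2r ?invr_gt0 //; apply: (yk 2%N).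
have Dp : (2 * D)%:R * p <= 4^-1 by apply: le_trans Dp0 _; move: tV5; clear; lra.
have KD : (4 * (K * D))%:R <= 52 * (t ^+ 10 * y).
  rewrite !natrM; apply: le_trans (_ : 4 * (t ^+ 10 * (13 * y)) <= _).
    by rewrite ler_wpM2l // ler_pM.
  by rewrite le_eqVlt; apply/orP; left; apply/eqP; ring.
(* The lower bound l <= 20 y acts here: exp(-y/2) <= exp(-l/40) <= exp(-l/100) = 1/t. *)
have expy k : n%:R / 2 <= k%:R :> R -> (1 - p) ^+ k <= t^-1.
  move=> hk; apply: le_trans (onem_exp_le k p01') _; rewrite -et -expRN ler_expR lerN2.
  apply: le_trans (_ : n%:R / 2 * p <= _); last by rewrite ler_wpM2r // ltW.
  by rewrite mulrAC -/y; move: ly l0; clear; lra.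
have pn : (1 - p) ^+ (n - (2 * M + 4 * (K * D))) <= 4^-1.
  apply: le_trans (expy _ _) _; last by move: tV5; clear; lra.
  have t37 : y * t ^+ 11 <= t ^+ 37 by rewrite (exprD t 26 11) ler_wpM2r // ltW.
  have t36 : t ^+ 10 * y <= t ^+ 37.
    by apply: le_trans (_ : t ^+ 36 <= _); rewrite ?tle // (exprD t 10 26) ler_wpM2l // ltW.
  have t38 : t ^+ 37 * 10 ^+ 5 <= n%:R.
    apply: le_trans (_ : t ^+ 38 <= _); first by rewrite [leRHS]exprSr ler_wpM2l // ltW.
    by rewrite nt tle.
  have sm : (2 * M + 4 * (K * D))%:R <= 340 * t ^+ 37.
    rewrite natrD natrM; move: MR KD t37 t36; clear; lra.
  have t37p := tp 37%N.
  have le_n : (2 * M + 4 * (K * D) <= n)%N by rewrite -(ler_nat R); move: sm t38 t37p; clear; lra.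
  by rewrite natrB //; move: sm t38 t37p; clear; lra.
have := prob_reconstructible_le p01 N0 M4 K0 (ltn0Sn _ : (0 < w)%N) (leqnn M) Dw Dp pn.
move=> /le_trans; apply.
have B1 : 4 / (#|pairs_in F0|%:R * p) <= 64 * t^-1.
  rewrite ler_pdivrMr // mulrAC; apply: le_trans (_ : 64 * (t / 16) / t <= _).
    by rewrite le_eqVlt; apply/orP; left; apply/eqP; field; rewrite lt0r_neq0.
  by rewrite ler_pM2r // ler_pM2l //; move: N1 t12; clear; lra.
have B2 : 8 * (#|F0|%:R * p) <= 8 * t^-1.
  rewrite ler_wpM2l // cF0; apply: le_trans (tinv 82%N isT).
  rewrite pE mulrA ler_pM2r ?invr_gt0 // (exprD t 56 26) ler_pM //; exact: (yk 1%N).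
have B3 : #|~: F0|%:R * (2 * M)%:R * p ^+ 2 <= 288 * t^-1.
  apply: le_trans (_ : n%:R * (2 * (144 * (y * t ^+ 11))) * p ^+ 2 <= _).
    by rewrite ler_wpM2r ?sqr_ge0 // ler_pM // natrM ler_wpM2l.
  rewrite (_ : _ * _ = 288 * (y * t ^+ 11 * (n%:R * p) * p)); last by rewrite /y; ring.
  rewrite ler_wpM2l // -/y; apply: le_trans (tinv 89%N isT).
  rewrite pE (_ : _ * _ = y ^+ 3 * t ^+ 11 / t ^+ 100); last by ring.
  by rewrite ler_pM2r ?invr_gt0 // (exprD t 78 11) ler_wpM2r ?(ltW (tp _)) //; apply: (yk 3%N).
have B4 : (1 - p) ^+ #|~: F0| <= t^-1 by apply: expy.
have B5 : #|~: F0|%:R * p / w%:R ^+ 2 <= l^-1.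
  apply: le_trans (_ : y / (y * l) <= _); last first.
    by rewrite le_eqVlt; apply/orP; left; apply/eqP; field; apply/andP; split; rewrite lt0r_neq0.
  have yl1 : 0 < y * l by rewrite mulr_gt0.
  apply: ler_pM => //.
  - by rewrite mulr_ge0 // ltW.
  - by rewrite invr_ge0 sqr_ge0.
  - by rewrite ler_wpM2r // ltW.
  rewrite lef_pV2 ?posrE ?exprn_gt0 ?ltr0n // -s2 lerXn2r ?nnegrE //.
have B6 : (4 * (K * D))%:R ^+ 2 * p <= 52 ^+ 2 * t^-1.
  apply: le_trans (_ : (52 * (t ^+ 10 * y)) ^+ 2 * p <= _).
    have h : 0 <= 52 * (t ^+ 10 * y) by rewrite !mulr_ge0 // ltW.
    by rewrite ler_pM2r // lerXn2r ?nnegrE.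
  rewrite pE (_ : _ * _ = 52 ^+ 2 * (t ^+ 20 * y ^+ 3 / t ^+ 100)); last first.
    by rewrite (exprM t 10 2); ring.
  rewrite ler_wpM2l ?exprn_ge0 //; apply: le_trans (tinv 98%N isT).
  by rewrite ler_pM2r ?invr_gt0 // (exprD t 20 78) ler_wpM2l ?(ltW (tp _)) //; apply: (yk 3%N).
set x := (2 * D)%:R ^+ 2 * p ^+ 2.
have x0 : 0 <= x by rewrite mulr_ge0 ?sqr_ge0.
have x16 : x <= 5^-1.
  apply: le_trans (_ : (4^-1) ^+ 2 <= _); last by clear; lra.
  rewrite /x -exprMn; apply: lerXn2r => //; rewrite nnegrE ?invr_ge0 //.
  by rewrite mulr_ge0 // ltW.
(* The expected number of spoiling vertices of a trial, about 4 y^3 p. The upper bound on p enters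
   as y^3 p = y^4 / n <= l/81; the deviation of the degrees adds the small second term. *)
have nx : n%:R * x <= 24 / 5 * (l / 81) + 216 * t^-1.
  have -> : n%:R * x = 4 * (D%:R ^+ 2 * (y * p)) by rewrite /x /y natrM; ring.
  apply: le_trans (_ : 4 * ((6 / 5 * y ^+ 2 + 54 * (y * l)) * (y * p)) <= _).
    rewrite ler_wpM2l // ler_wpM2r; [by []|by rewrite mulr_ge0 // ltW|].
    exact: dense_window.
  have -> : 4 * ((6 / 5 * y ^+ 2 + 54 * (y * l)) * (y * p)) =
      24 / 5 * (y ^+ 3 * p) + 216 * (y ^+ 2 * l * p) by ring.
  apply: lerD.
    rewrite ler_wpM2l ?divr_ge0 //.
    have n0 : 0 < n%:R :> R by rewrite nt.
    rewrite -(ler_pM2l n0) (_ : n%:R * (y ^+ 3 * p) = y ^+ 4); last by rewrite /y; ring.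
    by move: y4; clear; lra.
  rewrite ler_wpM2l //; apply: le_trans (tinv 79%N isT).
  rewrite pE (_ : y ^+ 2 * l * (y / t ^+ 100) = y ^+ 3 * l / t ^+ 100); last by ring.
  rewrite ler_pM2r ?invr_gt0 // (exprD t 78 1) expr1.
  by apply: ler_pM => //; rewrite ?exprn_ge0 //; apply: (yk 3%N).
(* The factor 5/4 from [onem_exp_ge] turns 24/5 into 6, and 6/81 < 8/100, so t^(-8) covers the main
   term and exp(-2) the rest. *)
have S8 : (expR 2 * t ^+ 8)^-1 <= (1 - x) ^+ n.
  apply: le_trans (@onem_exp_ge (5 / 4) x n _ _); [|by rewrite x0 /=; move: x16; clear; lra|by move: x16; clear; lra].
  rewrite -et -expRM_natl -expRD -expRN ler_expR lerN2.
  by move: nx tV5 l0; clear; lra.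
have B7 : (1 - (1 - x) ^+ n / 8) ^+ K <= 16 * expR 2 * t^-1.
  have S1 : (1 - x) ^+ n <= 1 by apply: exprn_ile1; move: x0 x16; clear; lra.
  have S0 : 0 <= (1 - x) ^+ n by rewrite exprn_ge0 //; move: x16; clear; lra.
  apply: le_trans (onem_exp_le K _) _; first by apply/andP; split; move: S0 S1; clear; lra.
  have e0 := expR_gt0 (2 : R).
  (* About t^10 trials of success probability t^(-8) give a mean of order t^2. *)
  have lower : t / (16 * expR 2) <= K%:R * ((1 - x) ^+ n / 8).
    apply: le_trans (_ : (t ^+ 10 / 2) * ((expR 2 * t ^+ 8)^-1 / 8) <= _).
      rewrite [leRHS](_ : _ = t ^+ 2 / (16 * expR 2)); last first.
        have gen (a b e : R) : b != 0 -> e != 0 -> (a * b) / 2 * ((e * b)^-1 / 8) = a / (16 * e).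
          by move=> b0 e0'; field; rewrite b0 e0'.
        by rewrite (exprD t 2 8) gen // lt0r_neq0.
      rewrite ler_pM2r ?invr_gt0 ?mulr_gt0 //; have := tle 1%N 2%N isT; by rewrite expr1.
    apply: ler_pM => //.
    - by rewrite divr_ge0 // ltW.
    - by rewrite divr_ge0 // invr_ge0 mulr_ge0 // ltW.
    by rewrite ler_pM2r ?invr_gt0.
  have te0 : 0 < t / (16 * expR 2) by rewrite divr_gt0 ?mulr_gt0.
  apply: le_trans (_ : expR (- (t / (16 * expR 2))) <= _); first by rewrite ler_expR lerN2.
  by apply: le_trans (expRN_le_inv te0) _; rewrite invf_div.
have comb (c1 c2 c3 c4 c5 u v : R) : (c1 + c2 + 4 * c3 + 4 + c4 + c5) * u + 4 * v =
    c1 * u + c2 * u + (4 * (c3 * u + (u + v)) + (c4 * u + c5 * u)) by ring.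
by rewrite comb; do ![apply: lerD => //|apply: ler_wpM2l => //].
Qed.

End Estimates.

Lemma leq_ten_divn5 n : (10 <= n -> n <= 10 * (n %/ 5))%N.
Proof. lia. Qed.

(** * The sparse estimate and a bound uniform in n and p *)

Section Uniform.
Variable R : realType.
Implicit Types (x c p t l V : R).

Lemma sparse_bound n p t l V :
  10 ^+ 5 <= t -> n%:R = t ^+ 100 -> 0 <= l -> l <= t -> expR (l / 100) = t -> 0 < p ->
  20 * (n%:R * p) <= l -> 2 <= V -> V * (10 ^+ 5 * expR 10) <= p ^+ 4 * n%:R ^+ 5 ->
  V * 10 ^+ 5 <= t ^+ 50 ->
  prob p (pairs n) (fun E => `[< reconstructible 2 E >]) <= 4 / V + 10 / t.
Proof.
move=> t5 nt l0 lt et p0 ly V2 Vn Vt.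
have t1 : 1 <= t by apply: le_trans t5; rewrite -natrX ler1n.
have t0 : 0 < t by apply: lt_le_trans t1.
have pt : p <= t^-1 / 20.
  have h : n%:R * p <= t / 20 by move: ly lt; clear; lra.
  rewrite -(ler_pM2l (_ : 0 < n%:R)); last by rewrite nt exprn_gt0.
  apply: le_trans h _; rewrite mulrA ler_pM2r ?invr_gt0 // ler_pdivlMr // nt -expr2.
  by rewrite ler_weXn2l.
have tV5 : t^-1 <= (10 ^+ 5)^-1 by rewrite lef_pV2 ?posrE // exprn_gt0.
have tV0 : 0 < t^-1 by rewrite invr_gt0.
have p1 : p <= 1 / 50 by move: pt tV5; clear; lra.
have p01 : 0 <= p < 1 by rewrite ltW //=; move: p1; clear; lra.
pose q := (n %/ 5)%N.
have lt_phi (i : 'I_5) (s : 'I_q) : (i * q + s < n)%N.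
  have qn : (5 * q <= n)%N by rewrite mulnC leq_trunc_div.
  apply: leq_trans (_ : i.+1 * q <= _)%N; first by rewrite mulSn addnC ltn_add2r.
  by apply: leq_trans qn; rewrite leq_mul2r ltn_ord orbT.
pose phi i s := Ordinal (lt_phi i s).
have phi_inj i j s s' : phi i s = phi j s' -> i = j /\ s = s'.
  move=> /(congr1 val) /= e; have q0 : (0 < q)%N by apply: leq_ltn_trans (ltn_ord s).
  have := congr1 (fun k => k %/ q)%N e; have := congr1 (fun k => k %% q)%N e.
  rewrite !modnMDl !divnMDl // !modn_small // !divn_small // !addn0 => es ei.
  by split; apply: val_inj.
have V0 : 0 < V by apply: lt_le_trans V2.
have main : V <= q%:R ^+ 5 * p ^+ 4 * (1 - p) ^+ (5 * n).
  have qn : n%:R / 10 <= q%:R :> R.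
    have : (n <= 10 * q)%N.
      have n10 : (10 <= n)%N.
        rewrite -(ler_nat R) nt; apply: le_trans (_ : t ^+ 1 <= _); last by rewrite ler_weXn2l.
        by rewrite expr1; apply: le_trans t5; rewrite -natrX ler_nat.
      exact: leq_ten_divn5.
    by rewrite -(ler_nat R) natrM; clear; lra.
  have e1 : expR (- (2 * ((5 * n)%:R * p))) <= (1 - p) ^+ (5 * n).
    by apply: onem_exp_ge; move: p1 p01; clear; lra.
  have e2 : - (2 * ((5 * n)%:R * p)) = - (10 * (n%:R * p)) by rewrite natrM; ring.
  rewrite e2 in e1.
  apply: le_trans (_ : (n%:R / 10) ^+ 5 * p ^+ 4 * expR (- (10 * (n%:R * p))) <= _); last first.
    have h : 0 <= n%:R / 10 :> R by rewrite divr_ge0.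
    apply: ler_pM => //; first by rewrite mulr_ge0 // exprn_ge0 // ltW.
      by rewrite expR_ge0.
    by rewrite ler_pM2r ?exprn_gt0 // lerXn2r ?nnegrE.
  rewrite (_ : (n%:R / 10) ^+ 5 * p ^+ 4 = p ^+ 4 * n%:R ^+ 5 / 10 ^+ 5); last by field.
  case: (leP (n%:R * p) 1) => y1.
    apply: le_trans (_ : (V * (10 ^+ 5 * expR 10)) / 10 ^+ 5 * expR (- 10) <= _).
      rewrite expRN le_eqVlt; apply/orP; left; apply/eqP.
      by have := expR_gt0 (10 : R); move: (expR 10) => e e0; field; rewrite lt0r_neq0.
    apply: ler_pM; rewrite ?expR_ge0 //.
    - by rewrite divr_ge0 ?exprn_ge0 // mulr_ge0 ?ltW // mulr_gt0 ?exprn_gt0 ?expR_gt0.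
    - by rewrite ler_pM2r ?invr_gt0 ?exprn_gt0.
    by rewrite ler_expR lerN2; move: y1; clear; lra.
  apply: le_trans (_ : t ^+ 100 / 10 ^+ 5 * expR (- (50%:R * (l / 100))) <= _).
    rewrite expRN expRM_natl et mulrAC ler_pdivlMr ?exprn_gt0 //.
    by rewrite (_ : 100 = 50 + 50)%N // exprD mulfK // expf_neq0 // lt0r_neq0.
  apply: ler_pM; rewrite ?expR_ge0 //.
  - by rewrite divr_ge0 ?exprn_ge0 // ltW.
  - rewrite ler_pM2r ?invr_gt0 ?exprn_gt0 // -nt.
    rewrite (_ : p ^+ 4 * n%:R ^+ 5 = n%:R * (n%:R * p) ^+ 4); last by ring.
    by rewrite ler_peMr // exprn_ege1 // ltW.
  by rewrite ler_expR lerN2; move: ly; clear; lra.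
have mu2 := le_trans V2 main.
apply: le_trans (prob_reconstructible_sparse phi_inj p01 mu2) _; apply: lerD.
  by rewrite ler_pM2l // lef_pV2 ?posrE //; apply: lt_le_trans mu2.
have b : 1 - 25%:R * p <= (1 - p) ^+ 25.
  by apply: bernoulli_ineq; move: p1 p01; clear; lra.
have b0 : 0 < 1 - 25%:R * p by move: p1; clear; lra.
(* This is where p <= 1/50 is used; four times 50 p is then at most 10/t. *)
have : (1 - p) ^- 25 <= 1 + 50 * p.
  apply: le_trans (_ : (1 - 25%:R * p)^-1 <= _).
    by rewrite lef_pV2 ?posrE // (lt_le_trans b0).
  rewrite -[leLHS]mul1r ler_pdivrMr //; move: p1 p0; clear; nra.
move: pt; clear; lra.
Qed.

Lemma dense_bound_const : exists2 C : R, 0 < C & forall n p t l,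
  10 ^+ 5 <= t -> n%:R = t ^+ 100 -> 20 <= l -> l <= t -> expR (l / 100) = t -> 0 < p ->
  l <= 20 * (n%:R * p) -> 81 * (n%:R * p) ^+ 4 <= n%:R * l ->
  prob p (pairs n) (fun E => `[< reconstructible 2 E >]) <= C / t + 4 / l.
Proof.
exists (64 + 8 + 4 * 288 + 4 + 52 ^+ 2 + 16 * expR 2).
  by rewrite !addr_gt0 ?mulr_gt0 ?exprn_gt0 ?expR_gt0 ?ltr0n.
exact: dense_bound.
Qed.

(** The function p may alternate between the two regimes as n grows, so the case distinction is made
    for each n, with thresholds that depend on eps only. *)
Lemma prob_reconstructible_small (eps : R) : 0 < eps ->
  exists L Y : R, forall n p, L <= ln n%:R -> 0 < p -> Y <= p ^+ 4 * n%:R ^+ 5 ->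
    81 * (n%:R * p) ^+ 4 <= n%:R * ln n%:R ->
    p <= 1 /\ prob p (pairs n) (fun E => `[< reconstructible 2 E >]) <= eps.
Proof.
move=> e0; pose V := 2 + 8 / eps; have [C C0 dense] := dense_bound_const.
have V8 : 8 / eps <= V by rewrite lerDr.
have V2 : 2 <= V by rewrite lerDl divr_ge0 // ltW.
(* The summands serve in turn the size of t, the dense error (with 1/t <= 100/l), half of eps in the
   sparse error, and V 10^5 <= t. The other half of eps is 4/V. *)
exists (10 ^+ 7 + (100 * C + 4) / eps + 2000 / eps + 10 ^+ 7 * V), (V * (10 ^+ 5 * expR 10)).
move=> n p; set l := ln n%:R; set N := n%:R => Ll p0 Yp p4.
have a1 : 0 <= (100 * C + 4) / eps by rewrite divr_ge0 ?ltW // addr_gt0 // mulr_gt0.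
have a2 : 0 <= 2000 / eps by rewrite divr_ge0 // ltW.
have a3 : 0 <= 10 ^+ 7 * V by rewrite mulr_ge0 ?exprn_ge0 // (le_trans _ V2).
have L1 : 10 ^+ 7 <= l by move: Ll a1 a2 a3; clear; lra.
have L2 : (100 * C + 4) / eps <= l.
  by move: ((100 * C + 4) / eps) Ll a1 => z; move: a2 a3; clear; lra.
have L3 : 2000 / eps <= l by move: ((100 * C + 4) / eps) Ll a1 => z; move: a2 a3; clear; lra.
have L4 : 10 ^+ 7 * V <= l by move: ((100 * C + 4) / eps) Ll a1 => z; move: a2 a3; clear; lra.
have l0 : 0 < l by move: L1; clear; lra.
have N0 : 0 < N.
  by rewrite ltNge; apply: contraTN l0 => N0; rewrite -leNgt /l ln0.
pose t := expR (l / 100).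
have tN : N = t ^+ 100 by rewrite /t -expRM_natl (_ : 100%:R * (l / 100) = l) ?lnK //; field.
have tl : l / 100 <= t by apply: le_trans (expR_ge1Dx _); rewrite lerDr.
have lt : l <= t.
  have x0 : 0 <= l / 100 by rewrite divr_ge0 // ltW.
  have := expR_ge1Dxn 1 x0; rewrite -/t (_ : 2`! = 2)%N //.
  have h : 10 ^+ 7 * l <= l * l by rewrite ler_pM2r.
  by move: h l0; clear; lra.
have t5 : 10 ^+ 5 <= t by move: tl L1; clear; lra.
have t1 : 1 <= t by move: t5; clear; lra.
have t0 : 0 < t by apply: lt_le_trans t1.
have tinv : t^-1 <= 100 / l by rewrite -[leRHS]invf_div lef_pV2 ?posrE // divr_gt0.
have inv_l c : 0 < c -> c / eps <= l -> c / l <= eps.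
  by move=> c0 h; rewrite ler_pdivrMr // mulrC -ler_pdivrMr.
split.
  have tN1 : t <= N by rewrite tN -[leLHS]expr1 ler_weXn2l.
  have N1 : 1 <= N by apply: le_trans tN1.
  (* If p > 1, the upper bound would give n^4 <= 81 (np)^4 <= n ln n <= n^2. *)
  rewrite leNgt; apply/negP => p1.
  have : N ^+ 4 <= N * N.
    apply: le_trans (_ : 81 * (N * p) ^+ 4 <= _).
      rewrite exprMn; have : 1 <= p ^+ 4 by rewrite exprn_ege1 // ltW.
      have : 0 <= N ^+ 4 by rewrite exprn_ge0 // ltW.
      by move: (N ^+ 4) (p ^+ 4) => u v; clear; nra.
    by apply: le_trans p4 _; rewrite ler_pM2l //; apply: le_trans lt tN1.
  have N2 : 2 <= N by apply: le_trans tN1; move: t5; clear; lra.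
  have NN : 1 < N * N by move: N2; clear; nra.
  rewrite leNgt (_ : N ^+ 4 = N * N * (N * N)); last by ring.
  by rewrite ltr_pMr ?NN // mulr_gt0.
case: (leP l (20 * (N * p))) => ly.
  have l20 : 20 <= l by move: L1; clear; lra.
  apply: le_trans (dense n p t l t5 tN l20 lt erefl p0 ly p4) _.
  apply: le_trans (_ : (100 * C + 4) / l <= _); last first.
    by apply: inv_l => //; rewrite addr_gt0 // mulr_gt0.
  rewrite [leRHS]mulrDl lerD2r (mulrC 100) -[leRHS]mulrA.
  by apply: ler_wpM2l; first exact: ltW.
have Vt : V * 10 ^+ 5 <= t ^+ 50.
  apply: le_trans (_ : t <= _); first by move: L4 tl; clear; lra.
  by rewrite -[leLHS]expr1 ler_weXn2l.
apply: le_trans (sparse_bound t5 tN (ltW l0) lt erefl p0 (ltW ly) V2 Yp Vt) _.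
have h1 : 4 / V <= eps / 2.
  rewrite ler_pdivrMr; last by apply: lt_le_trans V2.
  have : 8 <= V * eps by rewrite -ler_pdivrMr.
  by clear; lra.
have h2 : 2000 / l <= eps by apply: inv_l.
by move: tinv h1 h2; clear; lra.
Qed.

End Uniform.

(* Translation of the asymptotic hypotheses and the limit *)
From mathcomp Require Import classical_sets topology normedtype.
Import numFieldNormedType.Exports.

Lemma Gnp_prob_predC (R : realType) n (p : R) (A : graph n -> Prop) :
  Gnp_prob p (fun G => ~ A G) = 1 - prob p (pairs n) (fun E => `[< A E >]).
Proof.
rewrite -prob_predC /Gnp_prob /prob /expect big_mkcondr; apply: eq_bigr => E _.
by rewrite asbool_neg; case: ifP; rewrite ?mulr1 ?mulr0.
Qed.

Lemma powR_expr (R : realType) (x e : R) k m : 0 < x -> e * k%:R = m -> (x `^ e) ^+ k = x `^ m.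
Proof. by move=> x0 <-; rewrite powRrM powR_mulrn // powR_ge0. Qed.

(** The fourth power of the ratio is p^4 x^5, and a number that is at least 1 is bounded by its
    fourth power. *)
Lemma powR_lower (R : realType) (x p y : R) : 0 < x -> 1 <= y -> y <= p / x `^ (- (5 / 4)) ->
  0 < p /\ y <= p ^+ 4 * x ^+ 5.
Proof.
move=> x0 y1 h; have u0 : 0 < x `^ (- (5 / 4)) by apply: powR_gt0.
have a1 := le_trans y1 h; have a0 := lt_le_trans ltr01 a1.
split; first by move: a0; rewrite pmulr_lgt0 // invr_gt0.
have u4 : (x `^ (- (5 / 4))) ^+ 4 = (x ^+ 5)^-1.
  by rewrite (powR_expr (m := - 5%:R)) //; [rewrite powRN powR_mulrn // ltW|field].
have -> : p ^+ 4 * x ^+ 5 = (p / x `^ (- (5 / 4))) ^+ 4 by rewrite exprMn exprVn u4 invrK.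
by apply: le_trans h _; rewrite -[leLHS]expr1 ler_weXn2l.
Qed.

(** Taking fourth powers removes the real exponents and turns the constant 1/3 into 1/81. *)
Lemma powR_upper (R : realType) (x p : R) : 1 < x -> 0 <= p ->
  p <= 3^-1 * (x `^ (- (3 / 4))) * (ln x) `^ (1 / 4) -> 81 * (x * p) ^+ 4 <= x * ln x.
Proof.
move=> x1 p0 h; have x0 : 0 < x by apply: lt_trans x1.
have l0 : 0 < ln x by apply: ln_gt0.
have : p ^+ 4 <= (3^-1 * (x `^ (- (3 / 4))) * (ln x) `^ (1 / 4)) ^+ 4.
  by rewrite lerXn2r ?nnegrE // !mulr_ge0 ?powR_ge0 ?invr_ge0.
rewrite !exprMn (powR_expr (m := - 3%:R)) //; last by field.
rewrite (powR_expr (m := 1)) //; last by field.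
rewrite powRr1 ?(ltW l0) // powRN powR_mulrn ?(ltW x0) // => p4.
apply: le_trans (_ : 81 * (x ^+ 4 * (3^-1 ^+ 4 / x ^+ 3 * ln x)) <= _).
  by rewrite ler_pM2l // ler_pM2l // exprn_gt0.
by rewrite le_eqVlt; apply/orP; left; apply/eqP; field; rewrite lt0r_neq0.
Qed.

Local Open Scope classical_set_scope.
Local Open Scope ring_scope.

Theorem theorem1p4 (R : realType) (p : nat -> R) :
  (\forall n \near \oo,
      p n <= 3^-1 * (n%:R `^ (- (3 / 4))) * (ln (n%:R)) `^ (1 / 4)) ->
  ((fun n => p n / (n%:R `^ (- (5 / 4)))) @ \oo --> +oo) ->
  (fun n => Gnp_prob (p n) (fun G : graph n => ~ reconstructible 2 G)) @ \oo --> (1 : R).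
Proof.
move=> p_le /cvgryPge p_ge; apply/cvgrPdist_le => eps e0.
have [L [Y small]] := prob_reconstructible_small e0.
(* The maximum with 1 also yields p n > 0, which no hypothesis states; likewise [Num.max 1 L] below
   yields n > 1. *)
have Y_le := p_ge (Num.max 1 Y).
have n_ge : \forall n \near \oo, expR (Num.max 1 L) <= n%:R by apply: nbhs_infty_ger.
near=> n.
have nL : expR (Num.max 1 L) <= n%:R :> R by near: n.
have x1 : 1 < n%:R :> R by apply: lt_le_trans nL; rewrite expR_gt1 lt_max ltr01.
have x0 : 0 < n%:R :> R by apply: lt_trans x1.
have Ln : L <= ln n%:R :> R.
  by rewrite -ler_expR lnK ?posrE //; apply: le_trans nL; rewrite ler_expR le_max lexx orbT.
have [p0 pY] : 0 < p n /\ Num.max 1 Y <= p n ^+ 4 * n%:R ^+ 5.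
  by apply: powR_lower => //; [rewrite le_max lexx|near: n].
have p4 : 81 * (n%:R * p n) ^+ 4 <= n%:R * ln n%:R.
  by apply: powR_upper => //; [exact: ltW|near: n].
have Yn : Y <= p n ^+ 4 * n%:R ^+ 5 by apply: le_trans pY; rewrite le_max lexx orbT.
have [p1 le_eps] := small n (p n) Ln p0 Yn p4.
rewrite Gnp_prob_predC opprB addrC subrK ger0_norm //.
by apply: prob_ge0; rewrite ltW.
Unshelve. all: by end_near.
Qed.
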